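(* Suppose that for each $h$ there exists a Fortin projection $\mathcal{F}_h:\mathbf{H}^1_0(\Omega)\to\mathbf{X}_h$ satisfying, with a constant $c$ independent of $h$, $$\|v-\mathcal{F}_hv\|_{\mathbf{L}^2}\le c\,h\,\|v\|_{\mathbf{H}^1}\quad\text{for all } v\in\mathbf{H}^1_0(\Omega).$$ Then the generalized LBB condition holds: there is a constant $c'>0$ independent of $h$ such that $$c'\,\|\nabla q_h\|_{\mathbf{L}^2}\le \sup_{0\ne v_h\in\mathbf{X}_h}\frac{\int_\Omega(\nabla\cdot v_h)\,q_h}{\|v_h\|_{\mathbf{L}^2}}\quad\text{for all } q_h\in M_h.$$
   Context: $\Omega\subset\mathbb{R}^d$, $d\in\{2,3\}$, is a bounded open domain with Lipschitz boundary. Bold symbols denote spaces of $\mathbb{R}^d$-valued functions: $\mathbf{L}^2=L^2(\Omega)^d$, $\mathbf{H}^1=H^1(\Omega)^d$, $\mathbf{H}^1_0(\Omega)=H^1_0(\Omega)^d$. $L^2_{\int=0}(\Omega)$ is the set of functions in $L^2(\Omega)$ with mean zero. $\{\mathcal{T}_h\}_h$ is a family of conforming, shape-regular and quasi-uniform triangulations of $\Omega$, the size of whose cells is characterized by $h>0$. $\mathbf{X}_h\subset\mathbf{H}^1_0(\Omega)$ and $M_h\subset L^2_{\int=0}(\Omega)\cap H^1(\Omega)$ are finite dimensional spaces constructed on $\mathcal{T}_h$ (for instance using finite elements). Standing assumptions, with constants $c$ independent of $h$: (i) $\|v_h\|_{\mathbf{H}^1}\le c h^{-1}\|v_h\|_{\mathbf{L}^2}$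 for all $v_h\in\mathbf{X}_h$; (ii) $\|q_h\|_{H^1}\le c h^{-1}\|q_h\|_{L^2}$ for all $q_h\in M_h$; (iii) there is an operator (the Scott-Zhang interpolation operator) $\mathcal{C}_h:\mathbf{H}^1_0(\Omega)\to\mathbf{X}_h$ with $\|v-\mathcal{C}_hv\|_{\mathbf{L}^2}+h\|\mathcal{C}_hv\|_{\mathbf{H}^1}\le c h\|v\|_{\mathbf{H}^1}$ for all $v\in\mathbf{H}^1_0(\Omega)$. Definition: an operator $\mathcal{F}_h:\mathbf{H}^1_0(\Omega)\to\mathbf{X}_h$ is called a Fortin projection (Fortin operator) if $\mathcal{F}_h^2=\mathcal{F}_h$ and $\int_\Omega\nabla\cdot(v-\mathcal{F}_hv)\,q_h=0$ for all $v\in\mathbf{H}^1_0(\Omega)$ and all $q_h\in M_h$.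
   Formalization: ''M_h constructed on T_h'' is made precise: on each affine simplex, the functions of M_h are affine images of functions in one fixed finite-dimensional subspace of H^1 of the reference simplex, independent of h and the cell; for arbitrary M_h satisfying only (i)-(iii) the claim is false. *)

(* Defs.v *)
From HB Require Import structures.
From mathcomp Require Import all_boot all_order all_algebra.
From mathcomp Require Import all_classical all_reals all_analysis.

Set Implicit Arguments.
Unset Strict Implicit.
Unset Printing Implicit Defensive.
Import Order.TTheory GRing.Theory Num.Theory.
Import numFieldNormedType.Exports.
Local Open Scope classical_set_scope.
Local Open Scope ring_scope.

(** * Lebesgue measure on R^n *)

Definition measure_rV_display : measure_display -> measure_display.
Proof. exact. Qed.

(* The sigma-algebra generated by the coordinates; for R it is the Borel one. *)
Section measurable_rV.
Context {d} {T : sigmaRingType d}.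
Variable n : nat.

Let coors : 'I_n -> 'rV[T]_n -> T := fun i x => x ord0 i.

Let rV_set0 : g_sigma_preimage coors set0.
Proof. exact: sigma_algebra0. Qed.

Let rV_setC A : g_sigma_preimage coors A -> g_sigma_preimage coors (~` A).
Proof. exact: sigma_algebraC. Qed.

Let rV_bigcup (F : _^nat) : (forall i, g_sigma_preimage coors (F i)) ->
  g_sigma_preimage coors (\bigcup_i (F i)).
Proof. exact: sigma_algebra_bigcup. Qed.

HB.instance Definition _ := @isMeasurable.Build (measure_rV_display d)
  'rV[T]_n (g_sigma_preimage coors) rV_set0 rV_setC rV_bigcup.

End measurable_rV.

Lemma measurable_coord d (T : sigmaRingType d) n (i : 'I_n) :
  measurable_fun [set: 'rV[T]_n] (fun x : 'rV[T]_n => x ord0 i).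
Proof.
move=> _ Y mY; rewrite setTI; apply: sub_sigma_algebra => /=.
rewrite -bigcup_seq/=; exists i => /=; first by rewrite mem_index_enum.
by exists Y => //; rewrite setTI.
Qed.

Lemma measurable_fun_rVP d1 d2 (T1 : measurableType d1)
    (T2 : measurableType d2) n (f : T1 -> 'rV[T2]_n) :
  measurable_fun [set: T1] f <->
  forall i, measurable_fun [set: T1] (fun x => f x ord0 i).
Proof.
split=> [mf i|mf].
  exact: (measurableT_comp (measurable_coord (T:=T2) i) mf).
apply: (@iffLR (g_sigma_preimage
    (fun i => (fun x : 'rV[T2]_n => x ord0 i) \o f) `<=` measurable)).
  rewrite g_sigma_preimage_comp; split=> [prefS|mf' A [/= C preC <-]].
    by move=> _ A mA; apply: prefS; exists A.
  exact: mf'.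
apply: smallest_sub; first exact: sigma_algebra_measurable.
case: n => [|n] in f mf *; first by rewrite big_ord0.
rewrite -bigcup_mkord_ord; apply: bigcup_sub => i Ii.
by move=> A [B mB <-]; exact: mf.
Qed.

Lemma sigma_finite_product d1 d2 (T1 : measurableType d1)
    (T2 : measurableType d2) (R : realType)
    (m1 : {sigma_finite_measure set T1 -> \bar R})
    (m2 : {sigma_finite_measure set T2 -> \bar R}) :
  sigma_finite setT (m1 \x m2)%E.
Proof.
have /sigma_finiteP[F [TF ndF Foo]] := sigma_finiteT m1.
have /sigma_finiteP[G [TG ndG Goo]] := sigma_finiteT m2.
exists (fun n => F n `*` G n).
  rewrite -setXTT TF TG predeqE => -[x y]; split.
    move=> [/= [n _ Fnx] [k _ Gky]]; exists (maxn n k) => //; split.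
    - by move: x Fnx; exact/subsetPset/ndF/leq_maxl.
    - by move: y Gky; exact/subsetPset/ndG/leq_maxr.
  by move=> [n _ []/= ? ?]; split; exists n.
move=> k; have [? ?] := Foo k; have [? ?] := Goo k.
split; first exact: measurableX.
by rewrite product_measure1E// lte_mul_pinfty// ge0_fin_numE.
Qed.

Section lebesgue_rV.
Context {R : realType}.

Definition cons_rV n (p : R * 'rV[R]_n) :
    'rV[R]_n.+1 :=
  \row_i oapp (fun j => p.2 ord0 j) p.1 (unlift ord0 i).

Lemma measurable_cons_rV n : measurable_fun setT (@cons_rV n).
Proof.
apply/measurable_fun_rVP => i.
under eq_fun do rewrite mxE.
case: (unlift ord0 i) => [j|] /=; last exact: measurable_fst.
exact: (measurableT_comp (measurable_coord (T:=R) j)).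
Qed.

Section step.
Variables (n : nat).
Variable m : {sigma_finite_measure set 'rV[R]_n -> \bar R}.

Definition lebesgue_step : set 'rV[R]_n.+1 -> \bar R :=
  pushforward (lebesgue_measure \x m)%E (@cons_rV n).

Let step0 : lebesgue_step set0 = 0%E.
Proof. by rewrite /lebesgue_step /pushforward preimage_set0 measure0. Qed.

Let step_ge0 A : (0 <= lebesgue_step A)%E.
Proof. by rewrite /lebesgue_step /pushforward measure_ge0. Qed.

Let step_sigma_additive : semi_sigma_additive lebesgue_step.
Proof.
move=> F mF tF mUF; rewrite /lebesgue_step /pushforward preimage_bigcup.
have mc A : measurable A -> measurable (@cons_rV n @^-1` A).
  by move=> mA; rewrite -[X in measurable X]setTI; exact: measurable_cons_rV.
apply: measure_semi_sigma_additive.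
- by move=> k; exact: mc.
- apply/trivIsetP => /= i j _ _ ij; rewrite -preimage_setI.
  by move/trivIsetP : tF => /(_ _ _ _ _ ij) ->//; rewrite preimage_set0.
- by rewrite -preimage_bigcup; exact: mc.
Qed.

HB.instance Definition _ := isMeasure.Build _ _ _
  lebesgue_step step0 step_ge0 step_sigma_additive.

Let step_sigma_finite : sigma_finite setT lebesgue_step.
Proof.
have [F FT mF] : sigma_finite setT (lebesgue_measure \x m)%E.
  exact: sigma_finite_product.
pose g (x : 'rV[R]_n.+1) :
    R * 'rV[R]_n :=
  (x ord0 ord0, \row_j x ord0 (lift ord0 j)).
have mg : measurable_fun setT g.
  apply/measurable_fun_pairP; split.
    exact: (measurable_coord (T:=R)).
  apply/measurable_fun_rVP => i /=.
  under eq_fun do rewrite mxE.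
  exact: (measurable_coord (T:=R)).
have gK p : g (cons_rV p) = p.
  rewrite /g /cons_rV mxE unlift_none /=; case: p => a b /=; congr (_, _).
  by apply/rowP => j; rewrite !mxE liftK.
exists (fun k => g @^-1` (F k)); first by rewrite -preimage_bigcup -FT.
move=> k; have [mFk Fk] := mF k; split.
  by rewrite -[X in measurable X]setTI; exact: mg.
rewrite /lebesgue_step /pushforward (_ : _ @^-1` _ = F k)//.
by apply/seteqP; split=> p /=; rewrite gK.
Qed.

HB.instance Definition _ :=
  Measure_isSigmaFinite.Build _ _ _ lebesgue_step step_sigma_finite.

End step.

Fixpoint lebesgue_rV (n : nat) :
    {sigma_finite_measure set 'rV[R]_n -> \bar R} :=
  match n return {sigma_finite_measure set 'rV[R]_n -> \bar R} with
  | 0 => @dirac _ 'rV[R]_0 0 R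
  | k.+1 => lebesgue_step (lebesgue_rV k)
  end.

End lebesgue_rV.

(** * Sobolev spaces on an open set *)

Section sobolev.
Context {R : realType} {d : nat}.
Implicit Types (Omega D : set 'rV[R]_d) (f g phi q : 'rV[R]_d -> R).
Implicit Types (u v : 'rV[R]_d -> 'rV[R]_d).

Definition integral_on D f : R := \int[lebesgue_rV d]_(x in D) f x.

Definition ae_equal (V : Type) D (f g : 'rV[R]_d -> V) : Prop :=
  ae_eq (lebesgue_rV d) D f g.

Definition partial (i : 'I_d) f : 'rV[R]_d -> R :=
  fun x => 'D_(delta_mx ord0 i) f x.

Definition iter_partial (s : seq 'I_d) f : 'rV[R]_d -> R :=
  foldr partial f s.

Definition smooth f : Prop :=
  forall s : seq 'I_d, continuous (iter_partial s f) /\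
    forall (i : 'I_d) x, derivable (iter_partial s f) x (delta_mx ord0 i).

Definition test_function Omega phi : Prop :=
  smooth phi /\
  exists K : set 'rV[R]_d,
    [/\ compact K, K `<=` Omega & forall x, ~ K x -> phi x = 0].

(* Functions are total and only their values on Omega matter; the spaces below
   consist of (Borel) measurable representatives, and the norms are invariant
   under equality a.e. on Omega. *)
Definition L2 Omega f : Prop :=
  measurable_fun Omega f /\
  (lebesgue_rV d).-integrable Omega (fun x => (f x ^+ 2)%:E).

Definition L2norm Omega f : R := Num.sqrt (integral_on Omega (fun x => f x ^+ 2)).

Definition is_weak_partial Omega (i : 'I_d) f g : Prop :=
  L2 Omega g /\
  forall phi, test_function Omega phi ->
    integral_on Omega (fun x => f x * partial i phi x) =
    - integral_on Omega (fun x => g x * phi x).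

(* The i-th weak derivative of f in L^2(Omega), a representative of which is
   picked when it exists. *)
Definition weak_partial Omega (i : 'I_d) f : 'rV[R]_d -> R :=
  xget (fun=> 0) [set g | is_weak_partial Omega i f g].

Definition H1 Omega f : Prop :=
  L2 Omega f /\ forall i, exists g, is_weak_partial Omega i f g.

Definition grad_norm Omega f : R :=
  Num.sqrt (\sum_(i < d) L2norm Omega (weak_partial Omega i f) ^+ 2).

Definition H1norm Omega f : R :=
  Num.sqrt (L2norm Omega f ^+ 2 + grad_norm Omega f ^+ 2).

Definition H10 Omega f : Prop :=
  H1 Omega f /\
  forall e : R, 0 < e ->
    exists phi, test_function Omega phi /\ H1norm Omega (f - phi) < e.

Definition L2_mean_zero Omega f : Prop :=
  L2 Omega f /\ integral_on Omega f = 0.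

Definition coord (i : 'I_d) v : 'rV[R]_d -> R := fun x => v x ord0 i.

Definition vL2norm Omega v : R :=
  Num.sqrt (\sum_(i < d) L2norm Omega (coord i v) ^+ 2).

Definition vH1norm Omega v : R :=
  Num.sqrt (\sum_(i < d) H1norm Omega (coord i v) ^+ 2).

Definition vH10 Omega v : Prop := forall i, H10 Omega (coord i v).

Definition divergence Omega v : 'rV[R]_d -> R :=
  fun x => \sum_(i < d) weak_partial Omega i (coord i v) x.

End sobolev.

(** * Lipschitz domains *)

Section lipschitz.
Context {R : realType} {d : nat}.
Implicit Types (Omega A : set 'rV[R]_d) (x y e : 'rV[R]_d).

Definition dot x y : R := \sum_(i < d) x ord0 i * y ord0 i.

(* The norm that the library puts on 'rV[R]_d is the sup norm. *)
Definition enorm x : R := Num.sqrt (dot x x).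

(* Near each boundary point, in suitable orthogonal coordinates whose last
   axis is e, Omega is the set of points above the graph of a Lipschitz
   function of the other coordinates; y - dot y e *: e is the projection of y
   on the hyperplane orthogonal to e. *)
Definition lipschitz_boundary Omega : Prop :=
  forall x, (closure Omega `\` Omega°) x ->
    exists (e : 'rV[R]_d) (gamma : 'rV[R]_d -> R) (L r : R),
      [/\ enorm e = 1, 0 < r,
          forall y z, `|gamma y - gamma z| <= L * enorm (y - z)
        & forall y, enorm (y - x) < r ->
            (Omega y <-> gamma (y - dot y e *: e) < dot y e)].

Definition bounded_lipschitz_domain Omega : Prop :=
  [/\ Omega !=set0, open Omega, connected Omega, bounded_set Omega
    & lipschitz_boundary Omega].

End lipschitz.

(** * Triangulations *)

(* A simplex is given by the matrix whose d + 1 rows are its vertices. *)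
Section triangulation.
Context {R : realType} {d : nat}.
Local Notation cell := 'M[R]_(d.+1, d).
Implicit Types (K L : cell) (A : set 'rV[R]_d).

Definition face K (S : {set 'I_d.+1}) : set 'rV[R]_d :=
  [set x | exists w : 'rV[R]_d.+1,
    [/\ forall i, 0 <= w ord0 i, forall i, i \notin S -> w ord0 i = 0,
        \sum_i w ord0 i = 1 & x = w *m K]].

Definition simplex K : set 'rV[R]_d := face K [set: 'I_d.+1]%SET.

Definition edges K : 'M[R]_d :=
  \matrix_(i < d) (row (lift ord0 i) K - row ord0 K).

Definition common_vertices K L : {set 'I_d.+1} :=
  [set i | [exists j, row i K == row j L]]%SET.

Definition conforming_triangulation (Omega : set 'rV[R]_d) (T : seq cell) :
    Prop :=
  [/\ forall K, K \in T -> edges K \in unitmx,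
      closure Omega = [set x | exists2 K, K \in T & simplex K x],
      forall K L, K \in T -> L \in T -> K <> L ->
        (simplex K)° `&` (simplex L)° = set0
    & forall K L, K \in T -> L \in T ->
        simplex K `&` simplex L = face K (common_vertices K L)].

Definition diameter A : R :=
  sup [set r | exists x y, [/\ A x, A y & r = enorm (x - y)]].

Definition inscribed_diameter A : R :=
  sup [set s | exists x r, [/\ 0 <= r,
    forall y, enorm (y - x) <= r -> A y & s = 2 * r]].

Definition shape_regular (sizes : set R) (T : R -> seq cell) : Prop :=
  exists2 sigma : R, 0 < sigma & forall h K, sizes h -> K \in T h ->
    diameter (simplex K) <= sigma * inscribed_diameter (simplex K).

(* All the cells of T h have a diameter comparable with h. *)
Definition quasi_uniform (sizes : set R) (T : R -> seq cell) : Prop :=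
  exists c1 c2 : R, [/\ 0 < c1, 0 < c2 & forall h K, sizes h -> K \in T h ->
    c1 * h <= diameter (simplex K) <= c2 * h].

Definition ref_simplex : set 'rV[R]_d :=
  [set x | (forall i, 0 <= x ord0 i) /\ \sum_i x ord0 i <= 1].

(* The affine map that sends ref_simplex onto simplex K. *)
Definition cell_map K (x : 'rV[R]_d) : 'rV[R]_d := row ord0 K + x *m edges K.

(* M h is built on T h with finite elements: on each cell, its functions are
   images under the affine map of the cell of functions of a reference space,
   span (phi j), that is finite dimensional and does not depend on h or on the
   cell. *)
Definition built_on (sizes : set R) (T : R -> seq cell)
    (M : R -> set ('rV[R]_d -> R)) : Prop :=
  exists (m : nat) (phi : 'I_m -> 'rV[R]_d -> R),
    (forall j, H1 (ref_simplex°) (phi j)) /\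
    forall h K q, sizes h -> K \in T h -> M h q ->
      exists a : 'I_m -> R,
        ae_equal ref_simplex (q \o cell_map K)
          (fun x => \sum_(j < m) a j * phi j x).

End triangulation.

(** * Discrete spaces and Fortin projections *)

(* S is a set of representatives of a finite dimensional space of functions
   defined up to equality a.e. on Omega. *)
Definition finite_dim_space {R : realType} {d : nat} {V : lmodType R}
    (Omega : set 'rV[R]_d) (S : set ('rV[R]_d -> V)) : Prop :=
  [/\ S (fun=> 0),
      forall (a : R) u v, S u -> S v -> S (fun x => a *: u x + v x)
    & exists (n : nat) (e : 'I_n -> 'rV[R]_d -> V), (forall j, S (e j)) /\
        forall u, S u -> exists a : 'I_n -> R,
          ae_equal Omega u (fun x => \sum_(j < n) a j *: e j x)].

Section fortin.
Context {R : realType} {d : nat}.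
Variables (Omega : set 'rV[R]_d) (X : set ('rV[R]_d -> 'rV[R]_d)).
Implicit Types F : ('rV[R]_d -> 'rV[R]_d) -> 'rV[R]_d -> 'rV[R]_d.

(* F is a map from H^1_0(Omega)^d, a set of classes for equality a.e., to X;
   linearity is not assumed. *)
Definition operator_into F : Prop :=
  (forall v, vH10 Omega v -> X (F v)) /\
  (forall u v, vH10 Omega u -> vH10 Omega v ->
     ae_equal Omega u v -> ae_equal Omega (F u) (F v)).

Definition fortin_projection (M : set ('rV[R]_d -> R)) F : Prop :=
  [/\ operator_into F,
      forall v, vH10 Omega v -> ae_equal Omega (F (F v)) (F v)
    & forall v q, vH10 Omega v -> M q ->
        integral_on Omega (fun x => divergence Omega (v - F v) x * q x) = 0].

End fortin.

(* Main.v *)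
Require Import Defs.
From HB Require Import structures.
From mathcomp Require Import all_boot all_order all_algebra.
From mathcomp Require Import all_classical all_reals all_analysis.
From mathcomp Require Import measurable_realfun lra ring.
Set Implicit Arguments.
Unset Strict Implicit.
Unset Printing Implicit Defensive.
Import Order.TTheory GRing.Theory Num.Theory.
Import numFieldNormedType.Exports.
Local Open Scope classical_set_scope.
Local Open Scope ring_scope.

(** The supremum is bounded below by testing with [F v], where [F] is the
    Fortin projection and [v] is a field with the three properties
    - [int (div v) q = - |grad q|^2],
    - [|v| <= C |grad q|] in L^2,
    - [h |v|_(H^1) <= C |grad q|],
    the constants being independent of [h] and [q]. By the Fortin property
    [int (div (F v)) q = int (div v) q], and the approximation property gives
    [|F v| <= |v| + c h |v|_(H^1) <= C' |grad q|]. The quotient for [- F v] is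
    therefore at least [|grad q| / C']. The inverse inequality on [X h] bounds
    the set of quotients, so that this value is below its supremum, and it
    excludes [F v = 0].

    The field [v] is a truncated version of [grad q], built cell by cell. On a
    cell, read on the reference simplex, each component of [grad q] belongs to
    a fixed finite dimensional space [W], spanned by the derivatives of the
    reference functions ([gradient_on_cell]). Smooth functions with compact
    support in the open reference simplex separate the elements of [W], so
    there is a finite rank operator [w |-> sum_k <psi_k, w> e_k], with [psi_k]
    such functions, that is the identity on [W] ([finite_rank_identity]). The
    function [f = sum_k <w, e_k> psi_k] then satisfies [<f, w> = <w, w>], and
    its norm and the norms of its derivatives are bounded by [C |w|], because
    the [psi_k] and [e_k] are fixed ([bump_dual]). Transported to the cells
    and added up, these functions give the components of [v] ([dual_bump]):
    affine maps multiply all integrals over a cell by the same constant, which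
    disappears from the estimates, and shape regularity bounds the inverse of
    the linear part of the affine maps by [C / h] ([shape_regular_inv]).

    The analysis on [R^d] behind this has four ingredients. Lebesgue measure is
    translation invariant, hence multiplied by a constant under affine maps
    ([lebesgue_rV_mulmx]). Derivatives of compactly supported functions
    integrate to 0 ([integral_derive0]), which makes classical derivatives weak
    derivatives. Bump functions separate square integrable functions on an
    intersection of half-spaces ([orthogonal_bump0]), hence on [Omega]
    ([domain_bump_separating]), so weak derivatives are unique up to null
    sets. Finally the cells cover [Omega] up to a null set
    ([cell_decomposition]); that their interiors lie inside [Omega] uses the
    Lipschitz boundary ([lipschitz_interior_closure]). *)

(** * Lebesgue measure under translations and linear maps *)

Section pushforward_measure.
Context d1 d2 (T1 : measurableType d1) (T2 : measurableType d2) (R : realType).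
Variables (m : {measure set T1 -> \bar R}) (f : T1 -> T2).
Hypothesis mf : measurable_fun setT f.

(** The image measure as a bundled measure, which needs the measurability of
    [f]. *)
Definition image_measure : {measure set T2 -> \bar R}.
Proof. by refine [the measure _ _ of pushforward m f]; exact: mf. Defined.

End pushforward_measure.

Section lebesgue_rV_theory.
Context {R : realType}.

Lemma lebesgue_measure_shift (a : R) (A : set R) : measurable A ->
  lebesgue_measure ((fun x => x + a) @^-1` A) = lebesgue_measure A.
Proof.
move=> mA.
have ms : measurable_fun setT ((fun x : R => x + a) : _ -> measurableTypeR R).
  exact: measurable_funD.
transitivity (pushforward lebesgue_measure ((fun x => x + a) : R -> measurableTypeR R) A).
  by [].
apply/esym; apply: lebesgue_measure_unique => //.
move=> X [[x y] /= _ <-]; rewrite /pushforward /=.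
rewrite (_ : _ @^-1` _ = `]x - a, y - a]%classic); last first.
  by apply/seteqP; split=> z /=; rewrite !in_itv /= ltrBlDr lerBrDr.
rewrite !lebesgue_measure_itv /= !lte_fin ltrD2r.
by case: ifP => // _; rewrite -!EFinD; congr (_%:E); rewrite opprD opprK addrACA addNr addr0.
Qed.

Lemma measurable_shift_rV n (a : 'rV[R]_n) : measurable_fun setT (fun x : 'rV[R]_n => x + a).
Proof.
apply/measurable_fun_rVP => i; under eq_fun do rewrite mxE.
by apply: measurable_funD => //; exact: (measurable_coord (T:=R)).
Qed.

Lemma lebesgue_rV_shift n (a : 'rV[R]_n) (A : set 'rV[R]_n) : measurable A ->
  lebesgue_rV n ((fun x => x + a) @^-1` A) = lebesgue_rV n A.
Proof.
elim: n a A => [|n IH] a A mA.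
  by congr (lebesgue_rV 0 _); apply/seteqP; split=> x /=; rewrite [x + a]thinmx0 [x]thinmx0.
rewrite /= /lebesgue_step /pushforward.
set t := a ord0 ord0; pose s := \row_j a ord0 (lift ord0 j).
pose sh (p : measurableTypeR R * 'rV[R]_n) : measurableTypeR R * 'rV[R]_n := (p.1 + t, p.2 + s).
have msh : measurable_fun setT sh.
  apply/measurable_fun_pairP; split => /=.
    exact: measurable_funD.
  exact: (measurableT_comp (measurable_shift_rV s)).
rewrite (_ : _ @^-1` _ = sh @^-1` (@cons_rV R n @^-1` A)); last first.
  rewrite -comp_preimage; apply/seteqP; split=> p /=;
  rewrite (_ : cons_rV (sh p) = cons_rV p + a) //;
  by apply/rowP => i; rewrite !mxE; case: unliftP => [j|] -> //=; rewrite !mxE.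
transitivity (image_measure (lebesgue_measure \x lebesgue_rV n)%E msh (@cons_rV R n @^-1` A)) => //.
apply: esym; refine (@product_measure_unique _ _ _ _ _ lebesgue_measure (lebesgue_rV n) (image_measure (lebesgue_measure \x lebesgue_rV n)%E msh) _ _ _); last first.
- by rewrite -[X in measurable X]setTI; apply: measurable_cons_rV.
- move=> B C mB mC.
  transitivity ((lebesgue_measure \x lebesgue_rV n)%E
    (((fun x => x + t) @^-1` B) `*` ((fun x => x + s) @^-1` C))); first by [].
  have mB' : measurable ((fun x : R => x + t) @^-1` B).
    by rewrite -[X in measurable X]setTI; apply: measurable_funD.
  have mC' : measurable ((fun x : 'rV[R]_n => x + s) @^-1` C).
    by rewrite -[X in measurable X]setTI; apply: measurable_shift_rV.
  by rewrite product_measure1E //; congr (_ * _)%E;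
    [exact: lebesgue_measure_shift|exact: IH].
Qed.

Definition cube n (a b : R) : set 'rV[R]_n := [set x | forall i, a <= x ord0 i <= b].

Lemma measurable_cube n a b : measurable (@cube n a b).
Proof.
rewrite (_ : cube a b = \bigcap_(i in [set: 'I_n]) ((fun x : 'rV[R]_n => x ord0 i) @^-1` `[a, b])).
  apply: fin_bigcap_measurable => // i _; rewrite -[X in measurable X]setTI.
  by apply: (measurable_coord (T:=R)) => //.
apply/seteqP; split=> x /=.
  by move=> h i _ /=; rewrite in_itv /=; exact: h.
by move=> h i; have := h i I; rewrite /= in_itv.
Qed.

Lemma lebesgue_rV_cube n a b : a <= b ->
  lebesgue_rV n (@cube n a b) = ((b - a) ^+ n)%:E.
Proof.
move=> ab; elim: n => [|n IH] /=.
  by rewrite diracE expr0 mem_set // => -[].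
rewrite /lebesgue_step /pushforward.
rewrite (_ : _ @^-1` _ = `[a, b]%classic `*` @cube n a b).
  rewrite product_measure1E //; last exact: measurable_cube.
  rewrite exprS EFinM -IH; congr (_ * _)%E.
  transitivity (lebesgue_measure `[a, b]%classic); first by [].
  rewrite lebesgue_measure_itv /= lte_fin.
  by case: ltgtP ab => // ->; rewrite subrr.
apply/seteqP; split=> -[x y] /=.
  move=> h; split.
    by have := h ord0; rewrite /cons_rV mxE unlift_none /= in_itv.
  by move=> i; have := h (lift ord0 i); rewrite /cons_rV mxE liftK.
move=> [xab h] i; rewrite /cons_rV mxE; case: unliftP => [j|] _ /=; first exact: h.
by move: xab; rewrite in_itv.
Qed.

Lemma measurable_mulmx n m (B : 'M[R]_(n, m)) :
  measurable_fun setT (fun x : 'rV[R]_n => x *m B).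
Proof.
apply/measurable_fun_rVP => j; under eq_fun do rewrite mxE.
apply: measurable_sum => i; apply: measurable_funM => //.
exact: (measurable_coord (T:=R)).
Qed.

(** Two translation invariant measures are proportional. For [f x = x *m B], let
    [S] be the set of the pairs [(x, y)] with [x] in [A] and [x + f y] in [C].
    Integrating over [y] first, translation invariance gives [m A * m (f^-1 C)].
    Shearing [S] along [x |-> x - f y] first, it gives [m C * m ((-f)^-1 A)].
    With [A] the unit cube, the constant is the measure of the parallelepiped
    [(-f)^-1 A]. *)
Lemma lebesgue_rV_mulmx n (B : 'M[R]_n) : B \in unitmx ->
  exists2 c : R, 0 < c & forall A : set 'rV[R]_n, measurable A ->
    lebesgue_rV n ((fun x => x *m B) @^-1` A) = (c%:E * lebesgue_rV n A)%E.
Proof.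
move=> uB; pose m := lebesgue_rV (R := R) n.
pose f x : 'rV[R]_n := x *m B; pose g x : 'rV[R]_n := - (x *m B).
have mB : measurable_fun setT f := measurable_mulmx B.
have mBN : measurable_fun setT g.
  rewrite /g; under eq_fun do rewrite -mulmxN; exact: measurable_mulmx.
have mpre (k : 'rV[R]_n -> 'rV[R]_n) A :
    measurable_fun setT k -> measurable A -> measurable (k @^-1` A).
  by move=> mf mA; rewrite -[X in measurable X]setTI; exact: mf.
have mpre2 (k : 'rV[R]_n * 'rV[R]_n -> 'rV[R]_n) A :
    measurable_fun setT k -> measurable A -> measurable (k @^-1` A).
  by move=> mf mA; rewrite -[X in measurable X]setTI; exact: mf.
have msw : forall X : set ('rV[R]_n * 'rV[R]_n), measurable X ->
    (\int[m]_x m (xsection X x) = \int[m]_y m (ysection X y))%E.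
  move=> X mX; transitivity ((m \x m)%E X); first by [].
  transitivity ((m \x^ m)%E X); last by [].
  by apply: product_measure_unique => //= ? ? ? ?; rewrite product_measure2E.
have msum (s : R) : measurable_fun setT
    (fun p : 'rV[R]_n * 'rV[R]_n => p.1 + s *: (p.2 *m B)).
  apply/measurable_fun_rVP => i; under eq_fun do rewrite !mxE.
  apply: measurable_funD; first exact: (measurableT_comp (measurable_coord (T:=R) i)).
  apply: measurable_funM => //; apply: measurable_sum => j; apply: measurable_funM => //.
  exact: (measurableT_comp (measurable_coord (T:=R) j)).
have key A C : measurable A -> measurable C ->
    (m A * m (f @^-1` C) =
     m C * m (g @^-1` A))%E.
  move=> mA mC.
  pose S1 := [set p : 'rV[R]_n * 'rV[R]_n | A p.1 /\ C (p.1 + 1 *: (p.2 *m B))].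
  pose S2 := [set p : 'rV[R]_n * 'rV[R]_n | A (p.1 + (-1) *: (p.2 *m B)) /\ C p.1].
  have mS1 : measurable S1.
    by apply: measurableI; apply: mpre2 => //; exact: msum.
  have mS2 : measurable S2.
    by apply: measurableI; apply: mpre2 => //; exact: msum.
  transitivity (\int[m]_x m (xsection S1 x))%E.
    rewrite (eq_integral (fun x => (\1_A x)%:E * m (f @^-1` C))%E); last first.
      move=> x _; rewrite indicE; case: (boolP (x \in A)) => [|/negP] xA.
        rewrite mul1e -(lebesgue_rV_shift (x *m invmx B) (A := f @^-1` C)); last exact: mpre.
        congr (m _); apply/seteqP; split=> y.
          rewrite /xsection /= inE /S1 /= /f scale1r => -[_].
          by rewrite mulmxDl mulmxKV // addrC.
        rewrite /xsection /= inE /S1 /= /f scale1r mulmxDl mulmxKV // addrC => Cx.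
        by split => //; rewrite inE in xA.
      rewrite mul0e (_ : xsection _ _ = set0) ?measure0 //.
      by apply/seteqP; split=> // y; rewrite /xsection /= inE => -[Ax]; case: xA; rewrite inE.
    rewrite (@ge0_integralZr _ _ _ m); [|by []| | |by apply: measure_ge0; exact: mpre]; last 2 first.
    - by apply/measurable_EFinP; apply: measurable_indic.
    - by move=> x _; rewrite lee_fin.
    by rewrite integral_indic // setIT.
  rewrite msw //.
  transitivity (\int[m]_x m (xsection S2 x))%E; last first.
    rewrite (eq_integral (fun x => (\1_C x)%:E * m (g @^-1` A))%E); last first.
      move=> x _; rewrite indicE; case: (boolP (x \in C)) => [|/negP] xC.
        rewrite mul1e -(lebesgue_rV_shift (- (x *m invmx B)) (A := g @^-1` A)); last exact: mpre.
        congr (m _); apply/seteqP; split=> y.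
          rewrite /xsection /= inE /S2 /= /g scaleN1r => -[+ _].
          by rewrite mulmxDl mulNmx mulmxKV // opprD opprK addrC.
        rewrite /xsection /= inE /S2 /= /g scaleN1r mulmxDl mulNmx mulmxKV // opprD opprK addrC => Cx.
        by split => //; rewrite inE in xC.
      rewrite mul0e (_ : xsection _ _ = set0) ?measure0 //.
      by apply/seteqP; split=> // y; rewrite /xsection /= inE => -[_ Ax]; case: xC; rewrite inE.
    rewrite (@ge0_integralZr _ _ _ m); [|by []| | |by apply: measure_ge0; exact: mpre]; last 2 first.
    - by apply/measurable_EFinP; apply: measurable_indic.
    - by move=> x _; rewrite lee_fin.
    by rewrite integral_indic // setIT.
  rewrite msw //; apply: eq_integral => y _.
  rewrite -(lebesgue_rV_shift (y *m B) (A := ysection S2 y)); last exact: measurable_ysection.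
  congr (m _); apply/seteqP; split=> x; rewrite /ysection /= !inE /S1 /S2 /=;
    by rewrite scale1r scaleN1r addrK.
have m1 : m (cube 0 1) = 1%E by rewrite /m lebesgue_rV_cube // subr0 expr1n.
(* The constant of proportionality is the measure of this set, which is
   bounded; it is not 0, otherwise the whole space would be null. *)
pose A1 := g @^-1` (cube 0 1).
have keyC C : measurable C -> m (f @^-1` C) = (m A1 * m C)%E.
  move=> mC; have := key _ _ (measurable_cube 0 1) mC.
  by rewrite m1 mul1e => ->; rewrite muleC.
have fA1 : (m A1 < +oo)%E.
  (* The entries of the preimage of a point of the unit cube are bounded by sums
     of entries of the inverse matrix. *)
  pose M := \sum_i \sum_j `|invmx B i j|.
  have M0 : 0 <= M by apply: sumr_ge0 => i _; exact: sumr_ge0.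
  apply: (@le_lt_trans _ _ (m (cube (- M) M))).
    apply: le_measure; rewrite ?inE.
    - by apply: mpre => //; exact: measurable_cube.
    - exact: measurable_cube.
    - rewrite /A1 /g => x /= hx i.
      have xE : x = - (- (x *m B) *m invmx B) by rewrite mulNmx opprK mulmxK.
      rewrite -ler_norml xE mxE normrN mxE (le_trans (ler_norm_sum _ _ _)) //.
      apply: ler_sum => j _; rewrite normrM (@le_trans _ _ `|invmx B j i|) //.
        rewrite ler_piMl // ger0_norm; by have /andP[] := hx j.
      by rewrite (bigD1 i) //= lerDl sumr_ge0.
  by rewrite /m lebesgue_rV_cube ?ltry // ge0_cp.
have A1fin : m A1 \is a fin_num by rewrite ge0_fin_numE.
exists (fine (m A1)).
  rewrite fine_gt0 // fA1 andbT lt0e measure_ge0 andbT; apply/eqP => A10.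
  have := keyC setT measurableT; rewrite preimage_setT A10 mul0e => mT.
  have : (m (cube 0 1) <= m setT)%E.
    by apply: le_measure; rewrite ?inE //; exact: measurable_cube.
  by rewrite m1 mT lee_fin ler10.
by move=> A mA; rewrite fineK // keyC.
Qed.
End lebesgue_rV_theory.

(** * Topology of R^n and affine changes of variables *)

Section topology_rV.
Context {R : realType} {n : nat}.
Implicit Types (x y : 'rV[R]_n) (A U : set 'rV[R]_n).

Lemma le_coord_norm x i : `|x ord0 i| <= `|x|.
Proof.
rewrite [leRHS]/Num.norm /= mx_normrE; apply/bigmax_geP; right => /=.
by exists (ord0, i).
Qed.

Lemma norm_le_coord x (e : R) : 0 <= e ->
  (forall i, `|x ord0 i| <= e) -> `|x| <= e.
Proof.
move=> e0 xe; rewrite /Num.norm /= mx_normrE; apply/bigmax_leP; split => //.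
by move=> [i j] _ /=; rewrite [i]ord1.
Qed.

Lemma bounded_rVP A : bounded_set A <-> exists2 M : R, 0 <= M & A `<=` cube (- M) M.
Proof.
split=> [[M [_ hM]]|[M M0 hA]].
  exists (`|M| + 1); first by rewrite addr_ge0.
  move=> x Ax i; rewrite -ler_norml (le_trans (le_coord_norm _ _)) //.
  by apply: (hM (`|M| + 1)) => //; rewrite ltr_pwDr // ler_norm.
exists M; split; first exact: num_real.
move=> N MN x Ax /=; apply: norm_le_coord => [|i]; first by apply: le_trans M0 (ltW MN).
by rewrite (le_trans _ (ltW MN)) // ler_norml; exact: hA.
Qed.

(** The open set is the union of the rational boxes that it contains. *)
Lemma open_measurable_rV U : open U -> measurable U.
Proof.
move=> oU.
pose box (p : 'rV[rat]_n * nat) : set 'rV[R]_n :=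
  [set x | forall i, `|x ord0 i - ratr (p.1 ord0 i)| <= p.2.+1%:R^-1].
have mbox p : measurable (box p).
  rewrite (_ : box p = \bigcap_(i in [set: 'I_n])
      ((fun x : 'rV[R]_n => x ord0 i) @^-1` [set t | `|t - ratr (p.1 ord0 i)| <= p.2.+1%:R^-1])); last first.
    by apply/seteqP; split=> [x h i _|x h i]; [exact: h|exact: (h i I)].
  apply: fin_bigcap_measurable => // i _; rewrite -[X in measurable X]setTI.
  apply: (measurable_coord (T:=R)) => //.
  rewrite (_ : mkset _ = `[ratr (p.1 ord0 i) - p.2.+1%:R^-1, ratr (p.1 ord0 i) + p.2.+1%:R^-1]%classic) //.
  by apply/seteqP; split=> t /=; rewrite ler_distl in_itv.
rewrite (_ : U = \bigcup_p (if `[< box p `<=` U >] then box p else set0)).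
  by apply: countable_bigcupT_measurable => // p; case: ifP.
apply/seteqP; split=> [x Ux|x [p _]]; last by case: asboolP => // h /h.
have /nbhs_ballP[e /= e0 xeU] : nbhs x U by exact: open_nbhs_nbhs.
have [k ke] : exists k, (k.+1%:R^-1 : R) < e / 2.
  have e20 : 0 < e / 2 by rewrite divr_gt0.
  have [N _ hN] := near_infty_natSinv_lt (PosNum e20).
  by exists N; apply: hN => /=.
have k0 : 0 < (k.+1%:R^-1 : R) by rewrite invr_gt0.
have hq i : exists q : rat, `|x ord0 i - ratr q| <= k.+1%:R^-1.
  have /rat_in_itvoo[q] : x ord0 i - k.+1%:R^-1 < x ord0 i + k.+1%:R^-1.
    by rewrite ltrBlDr -addrA ltrDl addr_gt0.
  by rewrite in_itv /= => /andP[h1 h2]; exists q; rewrite ler_distlC (ltW h1) (ltW h2).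
have [q qP] := choice hq.
exists (\row_i q i, k) => //=; case: asboolP => [_ i|] /=; first by rewrite mxE.
case=> y hy; apply: xeU; rewrite mx_norm_ball /ball_ /=.
rewrite (@le_lt_trans _ _ (k.+1%:R^-1 + k.+1%:R^-1)) //; last by rewrite [ltRHS](splitr e) ltrD.
apply: norm_le_coord => [|i]; first by rewrite addr_ge0 // ltW.
rewrite !mxE -(subrKA (ratr (q i))) (le_trans (ler_normD _ _)) // lerD //.
by have := hy i; rewrite mxE distrC.
Qed.

Lemma continuous_measurable_rV (f : 'rV[R]_n -> R) :
  continuous f -> measurable_fun setT f.
Proof.
move=> /continuousP cf; apply: (measurability _ (RGenOpens.measurableE R)).
move=> _ [_ [a [b ->] <-]]; rewrite setTI; apply: open_measurable_rV.
exact/cf/interval_open.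
Qed.

Lemma lebesgue_rV_bounded A : bounded_set A -> measurable A ->
  (lebesgue_rV n A < +oo)%E.
Proof.
move=> /bounded_rVP[M M0 hA] mA; apply: (@le_lt_trans _ _ (lebesgue_rV n (cube (- M) M))).
  by apply: le_measure; rewrite ?inE //; exact: measurable_cube.
by rewrite lebesgue_rV_cube ?ltry // ge0_cp.
Qed.

Lemma continuous_coord i : continuous (fun x : 'rV[R]_n => x ord0 i).
Proof. exact: coord_continuous. Qed.

Lemma continuous_sum_rV (I : Type) (r : seq I) (T : topologicalType)
    (f : I -> T -> R) :
  (forall i, continuous (f i)) -> continuous (fun t => \sum_(i <- r) f i t).
Proof.
move=> cf; elim: r => [|i r IH] x.
  by under eq_fun do rewrite big_nil; exact: cvg_cst.
by under eq_fun do rewrite big_cons; apply: continuousD; [exact: cf|exact: IH].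
Qed.

Lemma continuous_rVP (T : topologicalType) (f : T -> 'rV[R]_n) :
  (forall i, continuous (fun t => f t ord0 i)) -> continuous f.
Proof.
move=> cf x; apply/cvgrPdist_le => e e0; near=> y.
apply: norm_le_coord => [|i]; first exact: ltW.
rewrite !mxE; move: i; near: y.
apply: filter_forall => i; have /cvgrPdist_le := cf i x; exact.
Unshelve. all: by end_near. Qed.

End topology_rV.

Section affine.
Context {R : realType} {n : nat}.
Implicit Types (a x y : 'rV[R]_n) (B : 'M[R]_n).

Definition affine a B x : 'rV[R]_n := a + x *m B.

Lemma continuous_affine a B : continuous (affine a B).
Proof.
apply: continuous_rVP => i; under eq_fun do rewrite !mxE.
move=> x; apply: (@continuousD _ R^o) => //; first exact: cst_continuous.
apply: continuous_sum_rV => j y; apply: continuousM; first exact: continuous_coord.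
exact: cst_continuous.
Qed.

Lemma measurable_affine a B : measurable_fun setT (affine a B).
Proof.
apply/measurable_fun_rVP => i; apply: continuous_measurable_rV.
move=> x; apply: (continuous_comp (g := fun y : 'rV[R]_n => y ord0 i)).
  exact: continuous_affine.
exact: continuous_coord.
Qed.

Lemma affineK a B : B \in unitmx ->
  cancel (affine a B) (affine (- a *m invmx B) (invmx B)).
Proof. by move=> uB x; rewrite /affine mulmxDl mulmxK // mulNmx addKr. Qed.

Lemma affineKV a B : B \in unitmx ->
  cancel (affine (- a *m invmx B) (invmx B)) (affine a B).
Proof. by move=> uB x; rewrite /affine mulmxDl !mulmxKV // addrA subrr add0r. Qed.

Lemma lebesgue_rV_affine a B : B \in unitmx ->
  exists2 c : R, 0 < c & forall A, measurable A ->
    lebesgue_rV n (affine a B @^-1` A) = (c%:E * lebesgue_rV n A)%E.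
Proof.
move=> uB; have [c c0 hc] := lebesgue_rV_mulmx uB; exists c => // A mA.
rewrite -(lebesgue_rV_shift a mA) -hc.
  by congr (lebesgue_rV n _); apply/seteqP; split=> x; rewrite /affine /= addrC.
by rewrite -[X in measurable X]setTI; apply: measurable_shift_rV.
Qed.

End affine.

Section scaled.
Context {R : realType} {n : nat}.
Local Notation mu := (lebesgue_rV (R := R) n).
Variables (phi : 'rV[R]_n -> 'rV[R]_n) (c : R).
Hypotheses (mphi : measurable_fun setT phi) (c0 : 0 < c)
  (hphi : forall A, measurable A -> mu (phi @^-1` A) = (c%:E * mu A)%E).
Variables (S : set 'rV[R]_n) (mS : measurable S).

Lemma ge0_integral_scaled (f : 'rV[R]_n -> \bar R) :
  measurable_fun S f -> (forall x, 0 <= f x)%E ->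
  (\int[mu]_(x in phi @^-1` S) f (phi x) = c%:E * \int[mu]_(x in S) f x)%E.
Proof.
move=> mf f0; rewrite -(ge0_integral_pushforward mphi) //.
rewrite -(@ge0_integral_mscale _ _ R mu S mS (NngNum (ltW c0)) f) //.
by apply: eq_measure_integral => A mA _; exact: hphi.
Qed.

Lemma measurable_scaled d' (T' : measurableType d') (f : 'rV[R]_n -> T') :
  measurable_fun S f -> measurable_fun (phi @^-1` S) (f \o phi).
Proof.
move=> mf; apply: (measurable_comp mS) => //; last exact: measurable_funTS.
by move=> _ [x Sx <-].
Qed.

Lemma integrable_scaled (f : 'rV[R]_n -> R) :
  mu.-integrable S (EFin \o f) ->
  mu.-integrable (phi @^-1` S) (EFin \o (f \o phi)).
Proof.
move=> /integrableP[mf fi]; apply/integrableP; split.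
  exact: (measurable_scaled mf).
rewrite (ge0_integral_scaled (f := fun x => `|(f x)%:E|%E)) //.
  by rewrite lte_mul_pinfty // lee_fin ltW.
exact: measurableT_comp.
Qed.

Lemma integral_scaled (f : 'rV[R]_n -> R) :
  mu.-integrable S (EFin \o f) ->
  integral_on (phi @^-1` S) (f \o phi) = c * integral_on S f.
Proof.
move=> fi; have [mf _] := integrableP _ _ _ fi.
rewrite /integral_on /Rintegral.
have fin : (\int[mu]_(x in S) (f x)%:E)%E \is a fin_num.
  exact: integrable_fin_num.
suff -> : (\int[mu]_(x in phi @^-1` S) ((f \o phi) x)%:E =
    c%:E * \int[mu]_(x in S) (f x)%:E)%E by rewrite fineM.
rewrite [in LHS]integralE [in RHS]integralE.
transitivity (\int[mu]_(x in phi @^-1` S) (EFin \o f)^\+%E (phi x) -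
  \int[mu]_(x in phi @^-1` S) (EFin \o f)^\-%E (phi x))%E.
  congr (_ - _)%E; apply: eq_integral => x _.
    by rewrite -[RHS]/((_ \o phi) x) -funepos_comp.
  by rewrite -[RHS]/((_ \o phi) x) -funeneg_comp.
rewrite (ge0_integral_scaled (f := (EFin \o f)^\+%E)) //.
rewrite (ge0_integral_scaled (f := (EFin \o f)^\-%E)) //.
rewrite -muleBr // ?fin_num_adde_defl // ?fin_numN.
- exact: integrable_neg_fin_num.
- exact: measurable_funeneg.
- exact: measurable_funepos.
Qed.

End scaled.

(** * Bump functions *)

Section flat_function.
Context {R : realType}.

(** The functions [t^-k exp (-1/t)] extended by 0 to [t <= 0]. The family in [k]
    is closed under differentiation up to linear combinations, which makes all
    derivatives of [exp (-1/t)] explicit. *)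
Definition flat_exp k (t : R) : R := if 0 < t then t^-1 ^+ k * expR (- t^-1) else 0.

Lemma flat_exp_ge0 k t : 0 <= flat_exp k t.
Proof. by rewrite /flat_exp; case: ifP => // t0; rewrite mulr_ge0 ?expR_ge0 // exprn_ge0 // invr_ge0 ltW. Qed.

Lemma flat_exp_npos k t : t <= 0 -> flat_exp k t = 0.
Proof. by rewrite /flat_exp leNgt => /negbTE ->. Qed.

Lemma flat_exp0_le1 t : flat_exp 0 t <= 1.
Proof.
rewrite /flat_exp; case: ifP => // t0; rewrite expr0 mul1r -expR0 ler_expR oppr_le0.
by rewrite invr_ge0 ltW.
Qed.

(** The exponential series gives [t^-(k+1) <= (k+1)! exp (1/t)]; the factor [t]
    yields both the continuity and the derivative at 0. *)
Lemma flat_exp_le k t : flat_exp k t <= k.+1`!%:R * `|t|.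
Proof.
rewrite /flat_exp; case: ifP => t0; last by rewrite mulr_ge0.
have s0 : 0 < t^-1 by rewrite invr_gt0.
have f0 : 0 < (k.+1`!%:R : R) by rewrite ltr0n fact_gt0.
have -> : t^-1 ^+ k = t * t^-1 ^+ k.+1 by rewrite exprS mulrA mulfV ?gt_eqF // mul1r.
rewrite expRN ler_pdivrMr ?expR_gt0 // gtr0_norm // -mulrA mulrCA ler_pM2l //.
rewrite mulrC -ler_pdivrMr //; apply: le_trans (expR_ge1Dxn k (ltW s0)).
by rewrite lerDr.
Qed.

Lemma is_derive_flat_exp k (t : R) :
  is_derive t (1 : R) (flat_exp k) (flat_exp k.+2 t - k%:R * flat_exp k.+1 t).
Proof.
have [t0|t0|->] := ltgtP t 0.
- rewrite !flat_exp_npos ?ltW // mulr0 subr0.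
  apply: (near_eq_is_derive (f := cst 0)).
  by near=> s; rewrite flat_exp_npos // ltW //; near: s; exact: lt_nbhsl.
- apply: (@near_eq_is_derive _ _ _ (fun s : R => s^-1 ^+ k * expR (- s^-1) : R)).
    near=> s; rewrite /flat_exp ifT //; near: s; exact: lt_nbhsr.
  have dV : is_derive t (1 : R) (fun s : R => s^-1) (- (t^-1 ^+ 2)).
    apply: (is_derive_eq (@is_deriveV _ id _ _ _ _ (is_derive_id _ _))); first by rewrite gt_eqF.
    by rewrite /GRing.scale /= exprVn mulr1.
  have dN := is_deriveN dV.
  have dE : is_derive t (1 : R) (expR \o (- (fun s : R => s^-1))) ((t^-1 ^+ 2) * expR (- t^-1)).
    apply: (is_derive_eq (is_derive1_comp _ dN)) => /=.
    by rewrite opprK mulrC.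
  have -> : (fun s : R => s^-1 ^+ k * expR (- s^-1)) =
      (fun s : R => s^-1) ^+ k * (expR \o (- (fun s : R => s^-1))).
    by apply/funext => s; rewrite !fctE.
  apply: (is_derive_eq (is_deriveM (is_deriveX k dV) dE)).
  rewrite /flat_exp t0 /GRing.scale /=.
  rewrite exprfctE opprfctE; case: (k) => [|m] /=; rewrite ?exprS; ring.
- rewrite !flat_exp_npos // mulr0 subr0.
  suff H : (fun h : R => h^-1 *: ((flat_exp k \o shift 0) (h *: 1) - flat_exp k 0)) h @[h --> 0^'] --> (0 : R).
    by apply: DeriveDef; [apply/cvg_ex; exists 0|apply/cvg_lim].
  apply/cvgrPdist_le => e e0; near=> h.
  rewrite /= addr0 [h *: 1]mulr1 (@flat_exp_npos k 0) // subr0 sub0r normrN normrM.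
  have h0 : h != 0 by near: h; exact: nbhs_dnbhs_neq.
  have -> : `|h^-1| * `|flat_exp k h| = `|flat_exp k.+1 h|.
    rewrite -normrM; congr `|_|; rewrite /flat_exp; case: ifP => _; last by rewrite mulr0.
    by rewrite exprS mulrA.
  rewrite ger0_norm ?flat_exp_ge0 // (le_trans (flat_exp_le _ _)) //.
  rewrite -ler_pdivlMl ?ltr0n ?fact_gt0 //; near: h.
  apply: dnbhs0_le; rewrite mulr_gt0 // invr_gt0 ltr0n fact_gt0 //.
Unshelve. all: by end_near. Qed.

Lemma is_derive_flat_exp_dir k (t u : R) :
  is_derive t u (flat_exp k) (u * (flat_exp k.+2 t - k%:R * flat_exp k.+1 t)).
Proof.
have [h1 h2] := is_derive_flat_exp k t.
have df : differentiable (flat_exp k) t by exact/derivable1_diffP.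
apply: DeriveDef; first exact: diff_derivable.
rewrite -h2 !deriveE // -[u in LHS]mulr1.
by rewrite -[u * 1]/(u *: 1) linearZ.
Qed.

Lemma continuous_flat_exp k : continuous (flat_exp k).
Proof.
move=> t; apply: differentiable_continuous; apply/derivable1_diffP.
by have [] := is_derive_flat_exp k t.
Qed.

End flat_function.

Section elementary_functions.
Context {R : realType} {n : nat}.
Local Notation V := 'rV[R]_n.
Implicit Types (f g : V -> R) (x v : V).

(** An inductive class stable under partial derivatives and affine changes of
    variables. All bump functions used below are taken in it: differentiability,
    smoothness and the chain rule then follow by structural induction. *)
Inductive elementary : (V -> R) -> Prop :=
| elementary_cst c : elementary (fun=> c)
| elementary_flat_exp k c (a : 'I_n -> R) : elementary (fun x => flat_exp k (c + \sum_i x ord0 i * a i))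
| elementaryD f g : elementary f -> elementary g -> elementary (fun x => f x + g x)
| elementaryM f g : elementary f -> elementary g -> elementary (fun x => f x * g x).

Lemma elementary_sum (I : Type) (r : seq I) (F : I -> V -> R) :
  (forall i, elementary (F i)) -> elementary (fun x => \sum_(i <- r) F i x).
Proof.
move=> hF; elim: r => [|i r IH].
  by under eq_fun do rewrite big_nil; exact: elementary_cst.
by under eq_fun do rewrite big_cons; exact: elementaryD.
Qed.

Lemma elementary_affine f a B : elementary f -> elementary (f \o affine a B).
Proof.
elim=> [c|k c b|{}f g _ hf _ hg|{}f g _ hf _ hg].
- exact: elementary_cst.
- rewrite (_ : _ \o _ = fun x => flat_exp k ((c + \sum_i a ord0 i * b i) +
    \sum_j x ord0 j * (\sum_i B j i * b i))); first exact: elementary_flat_exp.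
  apply/funext => x /=; congr (flat_exp k _); rewrite -addrA; congr (_ + _).
  under eq_bigr do rewrite !mxE mulrDl.
  rewrite big_split /=; congr (_ + _).
  under eq_bigr do rewrite mulr_suml.
  rewrite exchange_big /=; apply: eq_bigr => j _; rewrite mulr_sumr.
  by apply: eq_bigr => i _; rewrite mulrA.
- exact: (elementaryD hf hg).
- exact: (elementaryM hf hg).
Qed.

(** The directional derivatives are linear in the direction, and the
    coefficients are again elementary. *)
Lemma elementary_gradient f : elementary f -> exists2 D : 'I_n -> V -> R,
  (forall i, elementary (D i)) &
  (forall x v, is_derive x v f (\sum_i v ord0 i * D i x)).
Proof.
elim=> [c|k c a|{}f g ef [Df eDf hf] eg [Dg eDg hg]|{}f g ef [Df eDf hf] eg [Dg eDg hg]].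
- exists (fun _ _ => 0) => [i|x v]; first exact: elementary_cst.
  by under eq_bigr do rewrite mulr0; rewrite sumr_const mul0rn; exact: is_derive_cst.
- exists (fun i x => a i * (flat_exp k.+2 (c + \sum_i x ord0 i * a i) +
           - k%:R * flat_exp k.+1 (c + \sum_i x ord0 i * a i))) => [i|x v].
    apply: elementaryM; first exact: elementary_cst.
    apply: elementaryD; first exact: elementary_flat_exp.
    by apply: elementaryM; [exact: elementary_cst|exact: elementary_flat_exp].
  set t := c + _; set d := flat_exp k.+2 t + _.
  have [h1 h2] := is_derive_flat_exp_dir k t (\sum_i v ord0 i * a i).
  have E : (fun h : R => h^-1 *: (((fun x : V => flat_exp k (c + \sum_i x ord0 i * a i)) \o shift x) (h *: v) - flat_exp k t)) =
    (fun h : R => h^-1 *: ((flat_exp k \o shift t) (h *: (\sum_i v ord0 i * a i)) - flat_exp k t)).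
    apply/funext => h /=; congr (_ *: (flat_exp k _ - _)).
    rewrite addrCA; congr (_ + _).
    rewrite -[X in _ = X + _]/(h * (\sum_i v ord0 i * a i)) mulr_sumr -big_split /=.
    by apply: eq_bigr => i _; rewrite !mxE mulrDl mulrA.
  apply: DeriveDef; first by rewrite /derivable E.
  rewrite /derive E -/(derive _ _ _) h2 mulr_suml; apply: eq_bigr => i _.
  by rewrite mulrA /d mulNr.
- exists (fun i x => Df i x + Dg i x) => [i|x v]; first exact: elementaryD.
  apply: (is_derive_eq (is_deriveD (hf x v) (hg x v))).
  by rewrite -big_split /=; apply: eq_bigr => i _; rewrite mulrDr.
- exists (fun i x => f x * Dg i x + g x * Df i x) => [i|x v].
    by apply: elementaryD; apply: elementaryM.
  apply: (is_derive_eq (is_deriveM (hf x v) (hg x v))).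
  rewrite /GRing.scale /= !mulr_sumr -big_split /=; apply: eq_bigr => i _.
  by rewrite mulrDr !(mulrCA (v ord0 i)).
Qed.

Lemma elementary_continuous f : elementary f -> continuous f.
Proof.
elim=> [c|k c a|{}f g _ hf _ hg|{}f g _ hf _ hg] x.
- exact: cst_continuous.
- have cl : continuous (fun x : V => c + \sum_i x ord0 i * a i).
    move=> y; apply: (@continuousD _ R^o) => //; first exact: cst_continuous.
    apply: continuous_sum_rV => i z; apply: continuousM; first exact: continuous_coord.
    exact: cst_continuous.
  exact: (continuous_comp (cl x) (@continuous_flat_exp _ k _)).
- by apply: (@continuousD _ R^o); [exact: hf|exact: hg].
- by apply: continuousM; [exact: hf|exact: hg].
Qed.

Lemma elementary_measurable f : elementary f -> measurable_fun setT f.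
Proof. by move=> /elementary_continuous; exact: continuous_measurable_rV. Qed.

Lemma elementary_partialP f : elementary f ->
  (forall i, elementary (partial i f)) /\
  (forall x v, is_derive x v f (\sum_i v ord0 i * partial i f x)).
Proof.
move=> /elementary_gradient[D eD hD].
have E i : partial i f = D i.
  apply/funext => x; rewrite /partial (@derive_val _ _ _ _ _ _ _ (hD x _)).
  rewrite (bigD1 i) //= mxE !eqxx mul1r big1 ?addr0 // => j ji.
  by rewrite mxE eqxx (negbTE ji) mul0r.
split=> [i|x v]; first by rewrite E.
by under eq_bigr do rewrite E; exact: hD.
Qed.

Lemma elementary_smooth f : elementary f -> smooth f.
Proof.
move=> ef s; have es : elementary (iter_partial s f).
  by elim: s => //= i s IH; have [] := elementary_partialP IH.
split=> [|i x]; first exact: elementary_continuous.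
by have [_ h] := elementary_partialP es; have [] := h x (delta_mx ord0 i).
Qed.

(** The difference quotients of both sides are the same function of the step. *)
Lemma derive_affine f a B x v :
  'D_v (f \o affine a B) x = 'D_(v *m B) f (affine a B x).
Proof.
rewrite /derive (_ : (fun h => _) = (fun h : R =>
  h^-1 *: ((f \o shift (affine a B x)) (h *: (v *m B)) - f (affine a B x)))) //.
apply/funext => h /=; congr (_ *: (f _ - _)).
by rewrite /affine mulmxDl -scalemxAl addrCA.
Qed.

Lemma partial_affine f a B i x : elementary f ->
  partial i (f \o affine a B) x = \sum_j B i j * partial j f (affine a B x).
Proof.
move=> /elementary_partialP[_ hf]; have [_ h] := hf (affine a B x) (row i B).
rewrite /partial derive_affine -rowE h.
by apply: eq_bigr => j _; rewrite mxE.
Qed.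

End elementary_functions.

Section bump_functions.
Context {R : realType} {n : nat}.
Implicit Types (f g : 'rV[R]_n -> R) (S : set 'rV[R]_n).

(** Test functions taken in the class of elementary functions. *)
Definition bump S f : Prop :=
  elementary f /\ exists K, [/\ compact K, K `<=` S & forall x, ~ K x -> f x = 0].

Lemma bump_test_function S f : bump S f -> test_function S f.
Proof. by move=> [ef hK]; split => //; exact: elementary_smooth. Qed.

Lemma bump_out S f x : bump S f -> ~ S x -> f x = 0.
Proof. by move=> [_ [K [_ KS fK]]] nSx; apply: fK => /KS. Qed.

Lemma bump0 S : bump S (fun=> 0).
Proof. by split; [exact: elementary_cst|exists set0; split => //; exact: compact0]. Qed.

Lemma bumpD S f g : bump S f -> bump S g -> bump S (fun x => f x + g x).
Proof.
move=> [ef [K [cK KS fK]]] [eg [L [cL LS gL]]]; split; first exact: elementaryD.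
exists (K `|` L); split; first exact: compactU.
  by move=> x [/KS|/LS].
by move=> x /not_orP[Kx Lx]; rewrite fK // gL // addr0.
Qed.

Lemma bumpZ S f c : bump S f -> bump S (fun x => c * f x).
Proof.
move=> [ef [K [cK KS fK]]]; split; first by apply: elementaryM => //; exact: elementary_cst.
by exists K; split => // x Kx; rewrite fK // mulr0.
Qed.

Lemma bump_sum S (I : Type) (r : seq I) (F : I -> 'rV[R]_n -> R) :
  (forall i, bump S (F i)) -> bump S (fun x => \sum_(i <- r) F i x).
Proof.
move=> hF; elim: r => [|i r IH].
  by under eq_fun do rewrite big_nil; exact: bump0.
by under eq_fun do rewrite big_cons; exact: bumpD.
Qed.

Lemma bump_sub S S' f : S `<=` S' -> bump S f -> bump S' f.
Proof.
by move=> SS [ef [K [cK KS fK]]]; split => //; exists K; split => //; exact: subset_trans SS.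
Qed.

Lemma compact_closed_rV (K : set 'rV[R]_n) : compact K -> closed K.
Proof. by move=> cK; apply: compact_closed. Qed.

Lemma derive_out (K : set 'rV[R]_n) f v : compact K -> (forall x, ~ K x -> f x = 0) ->
  forall x, ~ K x -> 'D_v f x = 0.
Proof.
move=> cK fK x Kx; rewrite -(derive_cst (0 : R) x v); apply: near_eq_derive.
have oK : open (~` K) by apply: closed_openC; exact: compact_closed_rV.
have : nbhs x (~` K) by exact: open_nbhs_nbhs.
by apply: filterS => y; exact: fK.
Qed.

Lemma bump_partial S f i : bump S f -> bump S (partial i f).
Proof.
move=> [ef [K [cK KS fK]]]; split; first by have [] := elementary_partialP ef.
by exists K; split => // x; exact: derive_out.
Qed.

Lemma bump_affine S f a B : B \in unitmx -> bump (affine a B @^-1` S) f ->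
  bump S (f \o affine (- a *m invmx B) (invmx B)).
Proof.
move=> uB [ef [K [cK KS fK]]]; split; first exact: elementary_affine.
exists (affine a B @` K); split.
- apply: continuous_compact cK; apply: continuous_subspaceT; exact: continuous_affine.
- by move=> _ [x /KS Kx <-].
- move=> x Kx; apply: fK => Kx'; apply: Kx; exists (affine (- a *m invmx B) (invmx B) x) => //.
  exact: affineKV.
Qed.

End bump_functions.

(** * The L^2 inner product *)

Section L2_inner_product.
Context {R : realType} {n : nat}.
Local Notation mu := (lebesgue_rV (R := R) n).
Variables (D : set 'rV[R]_n) (mD : measurable D).
Implicit Types f g w : 'rV[R]_n -> R.

Definition L2ip f g : R := integral_on D (fun x => f x * g x).

Lemma L2_integrable_mul f g : L2 D f -> L2 D g ->
  mu.-integrable D (EFin \o (fun x => f x * g x)).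
Proof.
move=> [mf f2] [mg g2].
apply: (le_integrable mD (g := EFin \o (fun x => f x ^+ 2 + g x ^+ 2))).
- by apply/measurable_EFinP; exact: measurable_funM.
- move=> x _ /=; rewrite lee_fin normrM [leRHS]ger0_norm ?addr_ge0 ?sqr_ge0 //.
  rewrite -(real_normK (num_real (f x))) -(real_normK (num_real (g x))).
  have := sqr_ge0 (`|f x| - `|g x|); have := sqr_ge0 (`|f x| + `|g x|); nra.
- rewrite (_ : EFin \o _ = (fun x => (f x ^+ 2)%:E) \+ (fun x => (g x ^+ 2)%:E))%E //.
  exact: integrableD.
Qed.

Lemma eq_integral_on f g : (forall x, D x -> f x = g x) ->
  integral_on D f = integral_on D g.
Proof. by move=> fg; apply: eq_Rintegral => x; rewrite inE; exact: fg. Qed.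

Lemma L2_cst0 : L2 D (fun=> 0).
Proof.
split; first exact: measurable_cst.
by under eq_fun do rewrite expr0n /=; exact: integrable0.
Qed.

Lemma L2D f g : L2 D f -> L2 D g -> L2 D (fun x => f x + g x).
Proof.
move=> hf hg; have fg := L2_integrable_mul hf hg.
case: hf hg => [mf f2] [mg g2]; split; first exact: measurable_funD.
rewrite (_ : (fun x => _) = (fun x => (f x ^+ 2)%:E + (g x ^+ 2)%:E +
   (2%:E * (f x * g x)%:E))%E).
  by apply: integrableD => //; [exact: integrableD|exact: integrableZl].
by apply/funext => x; rewrite -EFinM -!EFinD; congr (_%:E); ring.
Qed.

Lemma L2Z c f : L2 D f -> L2 D (fun x => c * f x).
Proof.
move=> [mf f2]; split; first exact: measurable_funM.
by under eq_fun do rewrite exprMn EFinM; exact: integrableZl.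
Qed.

Lemma L2N f : L2 D f -> L2 D (fun x => - f x).
Proof. by move=> hf; under eq_fun do rewrite -mulN1r; exact: L2Z. Qed.

Lemma L2B f g : L2 D f -> L2 D g -> L2 D (fun x => f x - g x).
Proof. by move=> hf hg; apply: L2D => //; exact: L2N. Qed.

Lemma L2_sum (I : Type) (r : seq I) (F : I -> 'rV[R]_n -> R) :
  (forall i, L2 D (F i)) -> L2 D (fun x => \sum_(i <- r) F i x).
Proof.
move=> hF; elim: r => [|i r IH].
  by under eq_fun do rewrite big_nil; exact: L2_cst0.
by under eq_fun do rewrite big_cons; exact: L2D.
Qed.

Lemma L2ipC f g : L2ip f g = L2ip g f.
Proof. by rewrite /L2ip; under eq_fun do rewrite mulrC. Qed.

Lemma L2ipDl f g w : L2 D f -> L2 D g -> L2 D w ->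
  L2ip (fun x => f x + g x) w = L2ip f w + L2ip g w.
Proof.
move=> hf hg hw; rewrite /L2ip -RintegralD //; try exact: L2_integrable_mul.
by under eq_fun do rewrite mulrDl.
Qed.

Lemma L2ipZl c f w : L2 D f -> L2 D w -> L2ip (fun x => c * f x) w = c * L2ip f w.
Proof.
move=> hf hw; rewrite /L2ip -RintegralZl //; last exact: L2_integrable_mul.
by under eq_fun do rewrite -mulrA.
Qed.

Lemma L2ip0l w : L2ip (fun=> 0) w = 0.
Proof.
rewrite /L2ip; under eq_fun do rewrite mul0r.
by rewrite /integral_on /Rintegral integral0_eq.
Qed.

Lemma L2ipNl f w : L2 D f -> L2 D w -> L2ip (fun x => - f x) w = - L2ip f w.
Proof.
by move=> hf hw; under eq_fun do rewrite -mulN1r; rewrite L2ipZl // mulN1r.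
Qed.

Lemma L2ipBl f g w : L2 D f -> L2 D g -> L2 D w ->
  L2ip (fun x => f x - g x) w = L2ip f w - L2ip g w.
Proof. by move=> hf hg hw; rewrite L2ipDl ?L2ipNl //; exact: L2N. Qed.

Lemma L2ip_suml (I : Type) (r : seq I) (F : I -> 'rV[R]_n -> R) w :
  (forall i, L2 D (F i)) -> L2 D w ->
  L2ip (fun x => \sum_(i <- r) F i x) w = \sum_(i <- r) L2ip (F i) w.
Proof.
move=> hF hw; elim: r => [|i r IH].
  by under eq_fun do rewrite big_nil; rewrite L2ip0l big_nil.
under eq_fun do rewrite big_cons.
by rewrite big_cons L2ipDl ?IH //; exact: L2_sum.
Qed.

Lemma L2ip_ge0 f : 0 <= L2ip f f.
Proof. by apply: Rintegral_ge0 => x _; rewrite -expr2 sqr_ge0. Qed.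

Lemma L2normE f : L2norm D f ^+ 2 = L2ip f f.
Proof. by rewrite sqr_sqrtr //; exact: L2ip_ge0. Qed.

Lemma L2norm_ge0 f : 0 <= L2norm D f. Proof. exact: sqrtr_ge0. Qed.

Lemma cauchy_schwarz f g : L2 D f -> L2 D g ->
  `|L2ip f g| <= L2norm D f * L2norm D g.
Proof.
move=> hf hg; set a := L2ip f f; set b := L2ip f g; set c := L2ip g g.
have q t : 0 <= a + 2 * t * b + t ^+ 2 * c.
  have -> : a + 2 * t * b + t ^+ 2 * c = L2ip (fun x => f x + t * g x) (fun x => f x + t * g x).
    have hs : L2 D (fun x => f x + t * g x) by apply: L2D => //; exact: L2Z.
    rewrite L2ipDl // ?L2ipZl //; last exact: L2Z.
    rewrite ![L2ip _ (fun x => f x + _)]L2ipC !L2ipDl ?L2ipZl //; try exact: L2Z.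
    by rewrite (L2ipC g f) -/a -/b -/c; ring.
  exact: L2ip_ge0.
have bac : b ^+ 2 <= a * c.
  have a0 : 0 <= a := L2ip_ge0 f; have c0 : 0 <= c := L2ip_ge0 g.
  have [cz|cn] := eqVneq c 0.
    rewrite cz mulr0; have [->|bn] := eqVneq b 0; first by rewrite expr0n.
    have := q (- (a + 1) / (2 * b)); rewrite cz mulr0 addr0.
    have -> : 2 * (- (a + 1) / (2 * b)) * b = - (a + 1) by field.
    by rewrite opprD addrA subrr add0r oppr_ge0 ler10.
  have cp : 0 < c by rewrite lt0r cn.
  have := q (- b / c).
  have -> : a + 2 * (- b / c) * b + (- b / c) ^+ 2 * c = (a * c - b ^+ 2) / c by field.
  by rewrite pmulr_lge0 ?invr_gt0 // subr_ge0.
rewrite -(ler_pXn2r (n := 2)) ?nnegrE ?mulr_ge0 ?L2norm_ge0 //.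
by rewrite exprMn !L2normE real_normK ?num_real.
Qed.

Lemma L2norm_le f c : 0 <= c -> (L2norm D f <= c) = (L2ip f f <= c ^+ 2).
Proof. by move=> c0; rewrite -L2normE ler_pXn2r ?nnegrE ?L2norm_ge0. Qed.

Lemma L2normD f g : L2 D f -> L2 D g ->
  L2norm D (fun x => f x + g x) <= L2norm D f + L2norm D g.
Proof.
move=> hf hg; rewrite L2norm_le ?addr_ge0 ?L2norm_ge0 //.
have hs : L2 D (fun x => f x + g x) by exact: L2D.
rewrite L2ipDl // ![L2ip _ (fun x => f x + _)]L2ipC !L2ipDl // (L2ipC g f) -!L2normE.
have := le_trans (ler_norm _) (cauchy_schwarz hf hg); lra.
Qed.

Lemma L2normZ c f : L2 D f -> L2norm D (fun x => c * f x) = `|c| * L2norm D f.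
Proof.
move=> hf; apply/eqP; rewrite -(eqrXn2 (n := 2)) ?mulr_ge0 ?L2norm_ge0 // exprMn !L2normE.
rewrite real_normK ?num_real // L2ipZl //; last exact: L2Z.
by rewrite L2ipC L2ipZl // expr2 mulrA.
Qed.

Lemma L2norm0 : L2norm D (fun=> 0) = 0.
Proof. by apply/eqP; rewrite -sqrf_eq0 L2normE L2ip0l. Qed.

Lemma L2norm_sum (I : Type) (r : seq I) (F : I -> 'rV[R]_n -> R) :
  (forall i, L2 D (F i)) ->
  L2norm D (fun x => \sum_(i <- r) F i x) <= \sum_(i <- r) L2norm D (F i).
Proof.
move=> hF; elim: r => [|i r IH].
  by under eq_fun do rewrite big_nil; rewrite L2norm0 big_nil.
under eq_fun do rewrite big_cons.
rewrite big_cons (le_trans (L2normD _ _)) //; first exact: L2_sum.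
by rewrite lerD2l.
Qed.

Lemma eq_L2norm f g : (forall x, D x -> f x = g x) -> L2norm D f = L2norm D g.
Proof. by move=> fg; congr (Num.sqrt _); apply: eq_integral_on => x Dx; rewrite fg. Qed.

(** By the Cauchy-Schwarz inequality; it replaces reasoning on equality almost
    everywhere. *)
Lemma L2normB0 f g : L2 D f -> L2 D g -> L2norm D (fun x => f x - g x) = 0 ->
  (forall w, L2 D w -> L2ip f w = L2ip g w) /\ L2norm D f = L2norm D g.
Proof.
move=> hf hg fg0; have E w : L2 D w -> L2ip f w = L2ip g w.
  move=> hw; apply/eqP; rewrite -subr_eq0 -L2ipBl // -normr_le0.
  by rewrite (le_trans (cauchy_schwarz _ hw)) // ?fg0 ?mul0r //; exact: L2B.
split=> //; apply/eqP; rewrite -(eqrXn2 (n := 2)) ?L2norm_ge0 // !L2normE.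
by rewrite E // L2ipC E.
Qed.

End L2_inner_product.

Lemma integral_on_setT {R : realType} n (D : set 'rV[R]_n) (f : 'rV[R]_n -> R) :
  (forall x, ~ D x -> f x = 0) -> integral_on D f = integral_on setT f.
Proof.
move=> f0; rewrite /integral_on Rintegral_mkcond; congr (Rintegral _ _ _).
apply/funext => x; rewrite patchE; case: ifPn => // /negP; rewrite inE.
by move/f0.
Qed.

Section bounded_functions.
Context {R : realType} {n : nat}.
Local Notation mu := (lebesgue_rV (R := R) n).

Lemma bounded_L2 (D : set 'rV[R]_n) (f : 'rV[R]_n -> R) (M : R) :
  measurable D -> bounded_set D -> measurable_fun setT f ->
  (forall x, `|f x| <= M) -> L2 D f.
Proof.
move=> mD bD mf fM; split; first exact: measurable_funTS.
apply: measurable_bounded_integrable => //; first exact: lebesgue_rV_bounded.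
  by apply: measurable_funTS; exact: measurable_funX.
exists (M ^+ 2); split; first exact: num_real.
move=> N MN x _ /=; rewrite normrX (le_trans _ (ltW MN)) // lerXn2r ?nnegrE //.
exact: le_trans (fM x).
Qed.

Lemma compact_support_bounded (K : set 'rV[R]_n) (f : 'rV[R]_n -> R) :
  compact K -> (forall x, ~ K x -> f x = 0) -> continuous f ->
  exists2 M : R, 0 <= M & forall x, `|f x| <= M.
Proof.
move=> cK fK cf.
have [M [_ hM]] : bounded_set (f @` K).
  by apply: (@compact_bounded R R^o); apply: continuous_compact cK; exact: continuous_subspaceT.
exists (`|M| + 1) => [|x]; first by rewrite addr_ge0.
have [Kx|Kx] := pselect (K x); last by rewrite fK // normr0 addr_ge0.
by apply: (hM (`|M| + 1)); [rewrite ltr_pwDr // ler_norm|exists x].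
Qed.

Lemma bump_L2 (D S : set 'rV[R]_n) f : measurable D -> bounded_set D -> bump S f -> L2 D f.
Proof.
move=> mD bD [ef [K [cK _ fK]]].
have [M _ fM] := compact_support_bounded cK fK (elementary_continuous ef).
exact: (bounded_L2 mD bD (elementary_measurable ef) fM).
Qed.

Lemma test_function_bounded (S : set 'rV[R]_n) f : test_function S f ->
  measurable_fun setT f /\ exists M, forall x, `|f x| <= M.
Proof.
move=> [sf [K [cK _ fK]]]; have [cf _] := sf [::].
split; first exact: continuous_measurable_rV.
by have [M _ fM] := compact_support_bounded cK fK cf; exists M.
Qed.

Lemma test_function_L2 (D S : set 'rV[R]_n) f :
  measurable D -> bounded_set D -> test_function S f -> L2 D f.
Proof.
by move=> mD bD /test_function_bounded[mf [M fM]]; exact: bounded_L2 fM.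
Qed.

Lemma test_function_partial (S : set 'rV[R]_n) f i :
  test_function S f -> test_function S (partial i f).
Proof.
move=> [sf [K [cK KS fK]]]; split.
  by move=> s; have := sf (rcons s i); rewrite /iter_partial foldr_rcons.
by exists K; split => // x; exact: derive_out.
Qed.

End bounded_functions.

(** * Integration by parts *)

Section integration_by_parts.
Context {R : realType} {n : nat}.
Local Notation mu := (lebesgue_rV (R := R) n).

Lemma dominated_cvg_EFin (D : set 'rV[R]_n) (f_ : nat -> 'rV[R]_n -> R) (f g : 'rV[R]_n -> R) :
  measurable D -> (forall k, measurable_fun D (f_ k)) -> measurable_fun D f ->
  (forall x, D x -> f_ k x @[k --> \oo] --> f x) ->
  mu.-integrable D (EFin \o g) -> (forall k x, D x -> `|f_ k x| <= g x) ->
  (\int[mu]_(x in D) (f_ k x)%:E @[k --> \oo] --> \int[mu]_(x in D) (f x)%:E)%E.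
Proof.
move=> mD mf_ mf f_f ig fg.
have [] := @dominated_convergence _ _ _ mu D mD (fun k => EFin \o f_ k) (EFin \o f) (EFin \o g).
- by move=> k; exact/measurable_EFinP.
- exact/measurable_EFinP.
- by apply: aeW => x Dx; apply: cvg_EFin; [exact: nearW|exact: f_f].
- exact: ig.
- by apply: aeW => x k Dx; rewrite lee_fin fg.
- by [].
Qed.

Lemma bounded_support_integrable (A : set 'rV[R]_n) (f : 'rV[R]_n -> R) M :
  measurable A -> bounded_set A -> measurable_fun setT f ->
  (forall x, `|f x| <= M) -> (forall x, ~ A x -> f x = 0) ->
  mu.-integrable setT (EFin \o f).
Proof.
move=> mA bA mf fM fA.
have -> : EFin \o f = (EFin \o f) \_ A.
  apply/funext => x; rewrite patchE; case: ifPn => // /negP; rewrite inE => /fA /= ->.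
  by [].
apply/(integrable_mkcond _ mA); apply: measurable_bounded_integrable => //.
- exact: lebesgue_rV_bounded.
- exact: measurable_funTS.
- exists M; split; first exact: num_real.
  by move=> N MN x _; apply: le_trans (fM x) (ltW MN).
Qed.

(** By translation invariance the integral of a difference quotient is 0. The
    mean value theorem bounds the difference quotients uniformly, and they
    converge to the derivative, so dominated convergence applies. *)
Lemma integral_derive0 (F : 'rV[R]_n -> R) v (K : set 'rV[R]_n) :
  compact K -> (forall x, ~ K x -> F x = 0) -> continuous F ->
  (forall x, derivable F x v) -> continuous (fun x => 'D_v F x) ->
  integral_on setT (fun x => 'D_v F x) = 0.
Proof.
move=> cK FK cF dF cdF.
have [M M0 FM] := compact_support_bounded cK FK cF.
have [N N0 dFN] := compact_support_bounded cK (fun x => @derive_out _ _ K F v cK FK x) cdF.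
have [r r0 Kr] := (bounded_rVP K).1 (compact_bounded cK).
(* All steps are at most 1, so the difference quotients vanish outside this
   cube. *)
pose A := cube (n := n) (- (r + `|v|)) (r + `|v|).
have bA : bounded_set A.
  by apply/bounded_rVP; exists (r + `|v|) => //; rewrite addr_ge0.
have mA : measurable A by exact: measurable_cube.
have KA x (t : R) : `|t| <= 1 -> ~ A x -> ~ K (x + t *: v).
  move=> t1 nAx Kx; apply: nAx => i; rewrite -ler_norml.
  have := Kr _ Kx i; rewrite -ler_norml !mxE => h.
  rewrite -(addrK (t * v ord0 i) (x ord0 i)) (le_trans (ler_normB _ _)) // lerD //.
  by rewrite normrM (le_trans _ (le_coord_norm v i)) // ler_piMl.
pose t k : R := k.+1%:R^-1.
have t0 k : 0 < t k by rewrite invr_gt0 ltr0n.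
have t1 k : `|t k| <= 1 by rewrite gtr0_norm // invf_le1 ?ler1n // ltr0n.
pose G k x := F (x + t k *: v).
pose Q k x := (t k)^-1 * (G k x - F x).
have intF k : mu.-integrable setT (EFin \o (G k)).
  apply: (bounded_support_integrable (A := A) (M := M)) => //.
    apply: (measurable_comp (F := setT)) => //; first exact: continuous_measurable_rV.
    exact: measurable_shift_rV.
    by move=> x; exact: FM.
  by move=> x Ax; apply/FK/KA.
have intF0 : mu.-integrable setT (EFin \o F).
  apply: (bounded_support_integrable (A := A) (M := M)) => //.
    exact: continuous_measurable_rV.
  move=> x Ax; apply: FK; rewrite -(addr0 x) -(scale0r v); apply: KA => //.
  by rewrite normr0.
have Q0 k : (\int[mu]_x (Q k x)%:E = 0)%E.
  have E : integral_on setT (G k) = integral_on setT F.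
    have hs B : measurable B ->
        mu ((fun x : 'rV[R]_n => x + t k *: v) @^-1` B) = (1%:E * mu B)%E.
      by move=> mB; rewrite mul1e lebesgue_rV_shift.
    have := integral_scaled (measurable_shift_rV (t k *: v)) ltr01 hs measurableT intF0.
    by rewrite preimage_setT mul1r.
  have iQ : mu.-integrable setT (EFin \o Q k).
    rewrite (_ : EFin \o Q k = (fun x => (t k)^-1%:E * ((EFin \o (G k)) \- (EFin \o F)) x))%E //.
    by apply: integrableZl => //; exact: integrableB.
  rewrite -[LHS]fineK; last exact: integrable_fin_num.
  congr (_%:E); transitivity (integral_on setT (Q k)); first by [].
  rewrite /integral_on RintegralZl //; last first.
    rewrite (_ : EFin \o _ = (EFin \o (G k)) \- (EFin \o F))%E //.
    exact: integrableB.
  by rewrite RintegralB // -/(integral_on _ _) -/(integral_on _ F) E subrr mulr0.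
have Qcvg x : Q k x @[k --> \oo] --> 'D_v F x.
  have : (fun h : R => h^-1 *: ((F \o shift x) (h *: v) - F x)) h @[h --> 0^'] --> 'D_v F x.
    exact: dF.
  move=> h.
  have ht : t k @[k --> \oo] --> (0 : R).
    apply/cvgrPdist_lt => e e0; near=> k.
    rewrite sub0r normrN gtr0_norm //; near: k.
    exact: (near_infty_natSinv_lt (PosNum e0)).
  have tn0 k : t k != 0 by rewrite gt_eqF.
  have := (cvgr_dnbhsP _ _ _).1 h t (conj tn0 ht).
  apply: cvg_trans; apply: near_eq_cvg; near=> k.
  by rewrite /Q /G /= (addrC x).
have QA k x : `|Q k x| <= N * \1_A x.
  rewrite indicE; case: (boolP (x \in A)) => [_|/negP]; last first.
    rewrite inE => Ax; rewrite mulr0 /Q /G (FK _ (KA _ _ _ Ax)) ?FK ?subrr ?mulr0 ?normr0 //.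
    by have := KA x 0; rewrite normr0 scale0r addr0; exact.
  have dl s : is_derive s (1 : R) (fun s => F (x + s *: v)) ('D_v F (x + s *: v)).
    have E : (fun h : R => h^-1 *: (((fun s => F (x + s *: v)) \o shift s) (h *: 1) - F (x + s *: v))) =
        (fun h : R => h^-1 *: ((F \o shift (x + s *: v)) (h *: v) - F (x + s *: v))).
      apply/funext => h /=; congr (_ *: (F _ - _)).
      by rewrite [h *: 1]mulr1 scalerDl addrCA.
    apply: DeriveDef; first by rewrite /derivable E; exact: dF.
    by rewrite /derive E.
  rewrite mulr1 /Q /G; have [|c _] := MVT_segment (ltW (t0 k)) (fun s _ => dl s).
    apply: continuous_subspaceT => s; apply: differentiable_continuous.
    by apply/derivable1_diffP; have [] := dl s.
  rewrite scale0r addr0 subr0 => ->.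
  by rewrite [_ * t k]mulrC mulKf ?gt_eqF ?dFN.
have mQ k : measurable_fun setT (Q k).
  apply: measurable_funM => //; apply: measurable_funB.
    apply: (measurable_comp (F := setT)) => //; first exact: continuous_measurable_rV.
    exact: measurable_shift_rV.
  exact: continuous_measurable_rV.
have iN : mu.-integrable setT (EFin \o (fun x => N * \1_A x)).
  apply: (bounded_support_integrable (A := A) (M := N)) => //.
  - by apply: measurable_funM => //; exact: measurable_indic.
  - by move=> x; rewrite indicE; case: (_ \in _); rewrite ?mulr1 ?mulr0 ?normr0 // ger0_norm.
  - by move=> x Ax; rewrite indicE memNset // mulr0.
have := @dominated_cvg_EFin setT Q (fun x => 'D_v F x) (fun x => N * \1_A x) measurableT mQ.
move=> /(_ (continuous_measurable_rV cdF) (fun x _ => Qcvg x) iN (fun k x _ => QA k x)).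
under eq_cvg do rewrite Q0.
move=> /cvg_lim; rewrite lim_cst // => E.
by rewrite /integral_on /Rintegral -E.
Unshelve. all: by end_near. Qed.

Lemma integral_by_parts (Omega : set 'rV[R]_n) f g i :
  measurable Omega -> bounded_set Omega ->
  test_function Omega f -> test_function Omega g ->
  L2ip Omega f (partial i g) = - L2ip Omega (partial i f) g.
Proof.
move=> mO bO tf tg; have [sf [K [cK KO fK]]] := tf; have [sg _] := tg.
have [cf df] := sf [::]; have [cg dg] := sg [::].
have [cdf _] := sf [:: i]; have [cdg _] := sg [:: i].
have dfg x : is_derive x (delta_mx ord0 i) (f * g) (f x * partial i g x + g x * partial i f x).
  by apply: is_deriveM; apply: derivableP.
have dE : (fun x => 'D_(delta_mx ord0 i) (f * g) x) =
    (fun x => f x * partial i g x + partial i f x * g x).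
  by apply/funext => x; rewrite (mulrC (partial i f x)) derive_val.
apply/eqP; rewrite -addr_eq0; apply/eqP.
have Lf := test_function_L2 mO bO tf; have Lg := test_function_L2 mO bO tg.
have Ldf := test_function_L2 mO bO (test_function_partial i tf).
have Ldg := test_function_L2 mO bO (test_function_partial i tg).
rewrite /L2ip -RintegralD //; try exact: L2_integrable_mul.
have fgK x : ~ K x -> (f * g) x = 0 by move=> /fK; rewrite mulrfctE => ->; rewrite mul0r.
transitivity (integral_on Omega (fun x => 'D_(delta_mx ord0 i) (f * g) x)); first by rewrite dE.
rewrite integral_on_setT; last first.
  by move=> x Ox; exact: (@derive_out _ _ K (f * g) _ cK fgK x (fun Kx => Ox (KO _ Kx))).
apply: (integral_derive0 cK fgK).
- by move=> x; apply: continuousM; [exact: cf|exact: cg].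
- by move=> x; have [] := dfg x.
- have cFG : continuous (fun x => f x * partial i g x + partial i f x * g x).
    move=> x; apply: (@continuousD _ _ _ (fun x => f x * partial i g x : R^o) (fun x => partial i f x * g x : R^o)).
      by apply: continuousM; [exact: cf|exact: cdg].
    by apply: continuousM; [exact: cdf|exact: cg].
  by rewrite -dE in cFG.
Qed.

Lemma bump_weak_partial (Omega : set 'rV[R]_n) f i :
  measurable Omega -> bounded_set Omega -> bump Omega f ->
  is_weak_partial Omega i f (partial i f).
Proof.
move=> mO bO bf; split; first by apply: (bump_L2 mO bO); exact: bump_partial bf.
by move=> g tg; apply: integral_by_parts => //; exact: bump_test_function.
Qed.

End integration_by_parts.

(** * Null sets and separation by bump functions *)

Section null_sets.
Context {R : realType} {n : nat}.
Local Notation mu := (lebesgue_rV (R := R) n).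

(** Moving [N] by multiples of [v] at most [v] gives infinitely many disjoint
    sets of the same measure inside a bounded set, which has finite measure. *)
Lemma hyperplane_null (c : R) (a : 'I_n -> R) (v : 'rV[R]_n) (N : set 'rV[R]_n) :
  \sum_i v ord0 i * a i != 0 -> measurable N -> bounded_set N ->
  (forall x, N x -> c + \sum_i x ord0 i * a i = 0) -> mu N = 0%E.
Proof.
move=> va0 mN bN Na.
have [M M0 NM] := (bounded_rVP N).1 bN.
pose t k : R := k.+1%:R^-1.
pose F k : set 'rV[R]_n := (fun x => x + t k *: v) @^-1` N.
have mF k : measurable (F k).
  by rewrite -[X in measurable X]setTI; exact: measurable_shift_rV.
have muF k : mu (F k) = mu N by exact: lebesgue_rV_shift.
have tF : trivIset setT F.
  apply/trivIsetP => i j _ _ ij; apply/seteqP; split=> // x [] /Na hi /Na hj.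
  have E (s : R) : c + \sum_k (x + s *: v) ord0 k * a k =
      (c + \sum_k x ord0 k * a k) + s * \sum_k v ord0 k * a k.
    rewrite -addrA mulr_sumr -big_split /=; congr (_ + _); apply: eq_bigr => k _.
    by rewrite !mxE mulrDl mulrA.
  have : (t i - t j) * (\sum_i v ord0 i * a i) = 0.
    apply/eqP; rewrite mulrBl subr_eq0; apply/eqP.
    by apply: (@addrI _ (c + \sum_k x ord0 k * a k)); rewrite -!E hi hj.
  move/eqP; rewrite mulf_eq0 (negbTE va0) orbF subr_eq0 => /eqP/invr_inj/eqP.
  by rewrite eqr_nat eqSS => /eqP ij'; rewrite ij' eqxx in ij.
pose C := cube (n := n) (- (M + `|v|)) (M + `|v|).
have FC k : F k `<=` C.
  move=> x /NM h i; rewrite -ler_norml; have := h i; rewrite -ler_norml !mxE => hi.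
  rewrite -(addrK (t k * v ord0 i) (x ord0 i)) (le_trans (ler_normB _ _)) // lerD //.
  rewrite normrM (le_trans _ (le_coord_norm v i)) // ler_piMl //.
  by rewrite gtr0_norm ?invr_gt0 // invf_le1 ?ler1n.
have fC : (mu C < +oo)%E.
  by rewrite lebesgue_rV_cube ?ltry // ge0_cp // addr_ge0.
have mC : measurable C by exact: measurable_cube.
have key m : (mu N *+ m <= mu C)%E.
  have <- : mu (\big[setU/set0]_(i < m) F i) = (mu N *+ m)%E.
    rewrite measure_bigsetU_ord //; last first.
      apply/trivIsetP => i j _ _ ij; move/trivIsetP : tF; apply => //.
    rewrite (eq_bigr (fun=> mu N)) => [|i _]; last exact: muF.
    by rewrite sumr_const card_ord.
  apply: le_measure; rewrite ?inE //; first by apply: bigsetU_measurable.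
  by rewrite -bigcup_mkord; apply: bigcup_sub => i _; exact: FC.
have fN : mu N \is a fin_num.
  by rewrite ge0_fin_numE // (le_lt_trans (key 1%N)).
apply/eqP; rewrite eq_le measure_ge0 andbT leNgt; apply/negP => N0.
have a0 : 0 < fine (mu N) by rewrite fine_gt0 // N0 -ge0_fin_numE.
have := key (Num.truncn (fine (mu C) / fine (mu N))).+1.
rewrite -(fineK fN) -(@fineK _ (mu C)) ?ge0_fin_numE // -EFin_natmul lee_fin.
rewrite leNgt => /negP; apply; rewrite -mulr_natr mulrC -ltr_pdivrMr //.
exact: truncnS_gt.
Qed.

End null_sets.

Lemma seq_cvgM {R : realType} (u v : nat -> R) (a b l : R) :
  a * b = l ->
  u k @[k --> \oo] --> a -> v k @[k --> \oo] --> b ->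
  u k * v k @[k --> \oo] --> l.
Proof. by move=> <-; exact: cvgM. Qed.

Section half_spaces.
Context {R : realType} {n : nat}.
Local Notation mu := (lebesgue_rV (R := R) n).
Local Notation half := (R * ('I_n -> R))%type.
Implicit Types (p : half) (hs : seq half) (x : 'rV[R]_n).

Definition affine_form p x : R := p.1 + \sum_i x ord0 i * p.2 i.

Definition polyhedron hs : set 'rV[R]_n := [set x | all (fun p => 0 < affine_form p x) hs].

Lemma continuous_affine_form p : continuous (affine_form p).
Proof.
move=> y; apply: (@continuousD _ R^o) => //; first exact: cst_continuous.
apply: continuous_sum_rV => i z; apply: continuousM; first exact: continuous_coord.
exact: cst_continuous.
Qed.

Lemma polyhedron_nil : polyhedron [::] = setT. Proof. by apply/seteqP; split. Qed.

Lemma polyhedron_cons p hs : polyhedron (p :: hs) = (affine_form p @^-1` [set t | 0 < t]) `&` polyhedron hs.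
Proof. by apply/seteqP; split=> x /= => [/andP[]|[h1 h2]] //; apply/andP. Qed.

Lemma polyhedron_cat hs hs' : polyhedron (hs ++ hs') = polyhedron hs `&` polyhedron hs'.
Proof. by apply/seteqP; split=> x; rewrite /polyhedron /= all_cat => /andP. Qed.

Lemma polyhedron_open hs : open (polyhedron hs).
Proof.
elim: hs => [|p hs IH]; first by rewrite polyhedron_nil; exact: openT.
rewrite polyhedron_cons; apply: openI => //; apply: open_comp; last exact: open_gt.
by move=> x _; exact: continuous_affine_form.
Qed.

(** Products of flat functions, equal to 0 outside the polyhedron and converging
    to its indicator function. *)
Definition cutoff k hs x : R := \prod_(p <- hs) flat_exp 0 (k.+1%:R * affine_form p x - 1).

Lemma elementary_cutoff k hs : elementary (cutoff k hs).
Proof.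
rewrite /cutoff; elim: hs => [|p hs IH].
  by under eq_fun do rewrite big_nil; exact: elementary_cst.
under eq_fun do rewrite big_cons; apply: elementaryM => //.
rewrite (_ : (fun x => _) = fun x => flat_exp 0 ((k.+1%:R * p.1 - 1) +
  \sum_i x ord0 i * (k.+1%:R * p.2 i))); first exact: elementary_flat_exp.
apply/funext => x; congr (flat_exp 0 _); rewrite /affine_form mulrDr addrAC; congr (_ + _).
by rewrite mulr_sumr; apply: eq_bigr => i _; rewrite mulrCA.
Qed.

Lemma cutoff_ge0 k hs x : 0 <= cutoff k hs x.
Proof. by apply: prodr_ge0 => p _; exact: flat_exp_ge0. Qed.

Lemma cutoff_le1 k hs x : cutoff k hs x <= 1.
Proof.
rewrite /cutoff; elim: hs => [|p hs IH]; first by rewrite big_nil.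
by rewrite big_cons mulr_ile1 ?flat_exp_ge0 ?flat_exp0_le1 // cutoff_ge0.
Qed.

Lemma cutoff_out k hs x :
  ~ all (fun p => 1 <= k.+1%:R * affine_form p x) hs -> cutoff k hs x = 0.
Proof.
rewrite /cutoff; elim: hs => [//|p hs IH] /= /negP; rewrite negb_and big_cons.
case/orP => [|/negP/IH ->]; last by rewrite mulr0.
by rewrite -ltNge => h; rewrite flat_exp_npos ?mul0r // subr_le0 ltW.
Qed.

Lemma bump_cutoff k hs : bounded_set (polyhedron hs) -> bump (polyhedron hs) (cutoff k hs).
Proof.
move=> bD; split; first exact: elementary_cutoff.
pose K := [set x | all (fun p => 1 <= k.+1%:R * affine_form p x) hs].
have KD : K `<=` polyhedron hs.
  move=> x; apply: sub_all => p /(lt_le_trans ltr01).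
  by rewrite pmulr_rgt0 // ltr0n.
exists K; split => //; last by move=> x; exact: cutoff_out.
apply: bounded_closed_compact.
  by apply/bounded_rVP; have [M M0 DM] := (bounded_rVP _).1 bD; exists M => //; exact: subset_trans DM.
rewrite /K {K KD bD}; elim: hs => [|p hs IH].
  by rewrite (_ : [set x | _] = setT); [exact: closedT|apply/seteqP; split].
rewrite (_ : [set x | _] = (affine_form p @^-1` [set t | k.+1%:R^-1 <= t]) `&`
    [set x | all (fun p => 1 <= k.+1%:R * affine_form p x) hs]); last first.
  have E x : (1 <= k.+1%:R * affine_form p x) = (k.+1%:R^-1 <= affine_form p x).
    by rewrite mulrC -ler_pdivrMr ?ltr0n // mul1r.
  by apply/seteqP; split=> x /=; rewrite E => /andP.
apply: closedI => //; apply: closed_comp; last exact: closed_ge.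
by move=> x _; exact: continuous_affine_form.
Qed.

Lemma cutoff_cvg hs x : polyhedron hs x -> cutoff k hs x @[k --> \oo] --> (1 : R).
Proof.
rewrite /cutoff /polyhedron /=; elim: hs => [_|p hs IH /andP[p0 /IH cIH]].
  by under eq_cvg do rewrite big_nil; exact: cvg_cst.
rewrite (_ : (fun k => _) = (fun k => flat_exp 0 (k.+1%:R * affine_form p x - 1) *
    \prod_(q <- hs) flat_exp 0 (k.+1%:R * affine_form q x - 1))); last first.
  by apply/funext => k; rewrite big_cons.
suff h : flat_exp 0 (k.+1%:R * affine_form p x - 1) @[k --> \oo] --> (1 : R).
  exact: seq_cvgM (mulr1 _) h cIH.
apply/cvgrPdist_le => e e0.
have e1 : 0 < 1 + e^-1 by rewrite addr_gt0 // invr_gt0.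
have pe : 0 < affine_form p x / (1 + e^-1) by rewrite divr_gt0.
near=> k.
have s1 : 1 + e^-1 < k.+1%:R * affine_form p x.
  rewrite -ltr_pdivrMl ?ltr0n // mulrC -ltr_pdivlMl // mulrC; near: k.
  exact: (near_infty_natSinv_lt (PosNum pe)).
set s := k.+1%:R * affine_form p x - 1 in s1 *.
have es : e^-1 < s by rewrite ltrBrDl.
have s0 : 0 < s by apply: lt_trans es; rewrite invr_gt0.
rewrite ger0_norm ?subr_ge0 ?flat_exp0_le1 // /flat_exp s0 expr0 mul1r.
rewrite (@le_trans _ _ s^-1) //; first by have := expR_ge1Dx (- s^-1); lra.
by rewrite -(invrK e) lef_pV2 ?posrE ?invr_gt0 // ltW.
Unshelve. all: by end_near. Qed.

(** The sets [A] with [int_(D n A) z = 0] form a Dynkin system, and the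
    intersections of half-spaces generate the Borel sets. For such an
    intersection the integral vanishes because its indicator function is a limit
    of bump functions. *)
Lemma orthogonal_bump0 hs (z : 'rV[R]_n -> R) : bounded_set (polyhedron hs) ->
  L2 (polyhedron hs) z -> (forall f, bump (polyhedron hs) f -> L2ip (polyhedron hs) f z = 0) ->
  L2norm (polyhedron hs) z = 0.
Proof.
set D := polyhedron hs => bD z2 zf.
have mD : measurable D by apply: open_measurable_rV; exact: polyhedron_open.
have L1 : L2 D (fun=> 1).
  by apply: (bounded_L2 (M := 1)) => // x; rewrite normr1.
have iz : mu.-integrable D (EFin \o z).
  by have := L2_integrable_mul mD L1 z2; under eq_fun do rewrite mul1r.
pose G := [set A | exists hs', A = polyhedron hs'].
have GE : @measurable _ 'rV[R]_n = <<s G>>.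
  apply/seteqP; split=> [A mA|]; last first.
    apply: smallest_sub; first exact: sigma_algebra_measurable.
    by move=> _ [hs' ->]; apply: open_measurable_rV; exact: polyhedron_open.
  have mid : measurable_fun setT (id : g_sigma_algebraType G -> 'rV[R]_n).
    apply/measurable_fun_rVP => i.
    apply: (measurability _ (RGenInftyO.measurableE R)) => _ [_ [t ->] <-].
    rewrite setTI; apply: sub_sigma_algebra.
    exists [:: (t, fun j => - (j == i)%:R)].
    have E (x : 'rV[R]_n) : affine_form (t, fun j => - (j == i)%:R) x = t - x ord0 i.
      rewrite /affine_form /= (bigD1 i) //= eqxx mulrN1 big1 ?addr0 // => j /negbTE ->.
      by rewrite oppr0 mulr0.
    by apply/seteqP; split=> x; rewrite /polyhedron /= in_itv /= E subr_gt0 ?andbT // => ->.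
  by have := mid measurableT A mA; rewrite setTI.
have Gz hs' : (\int[mu]_(x in D `&` polyhedron hs') (z x)%:E = 0)%E.
  pose f k x := cutoff k (hs ++ hs') x * z x.
  have bDh : bounded_set (polyhedron (hs ++ hs')).
    apply/bounded_rVP; have [M M0 DM] := (bounded_rVP _).1 bD; exists M => //.
    by rewrite polyhedron_cat => x [/DM].
  have mDh : measurable (D `&` polyhedron hs').
    by rewrite -polyhedron_cat; apply: open_measurable_rV; exact: polyhedron_open.
  have bf k : bump D (cutoff k (hs ++ hs')).
    by apply: bump_sub (bump_cutoff k bDh); rewrite polyhedron_cat => x [].
  have f0 k : (\int[mu]_(x in D) (f k x)%:E = 0)%E.
    have if_ : mu.-integrable D (EFin \o f k).
      by apply: L2_integrable_mul => //; exact: bump_L2 (bf k).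
    rewrite -[LHS]fineK; last exact: integrable_fin_num if_.
    by have := zf _ (bf k); rewrite /L2ip /integral_on /Rintegral => ->.
  pose g := z \_ (D `&` polyhedron hs').
  have mg : measurable_fun D g.
    apply/(measurable_restrict _ mDh mD).
    by apply: measurable_funS z2.1 => // x [].
  have fg x : D x -> f k x @[k --> \oo] --> g x.
    move=> Dx; rewrite /g patchE; case: ifPn => [|/negP]; rewrite inE => Dhx.
      have h : cutoff k (hs ++ hs') x @[k --> \oo] --> (1 : R).
        by apply: cutoff_cvg; rewrite polyhedron_cat.
      exact: seq_cvgM (mul1r _) h (cvg_cst (z x)).
    have -> : (fun k => f k x) = (fun=> 0); last exact: cvg_cst.
    by apply/funext => k; rewrite /f (bump_out (bump_cutoff _ bDh)) ?mul0r // polyhedron_cat.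
  have fz k x : D x -> `|f k x| <= (fun x => `|z x|) x.
    move=> _; rewrite normrM ger0_norm ?cutoff_ge0 //.
    by rewrite ler_piMl // cutoff_le1.
  have mf k : measurable_fun D (f k).
    apply: measurable_funM; last exact: z2.1.
    by apply: measurable_funTS; apply: elementary_measurable; exact: elementary_cutoff.
  have iz' : mu.-integrable D (EFin \o (fun x => `|z x|)).
    exact: (integrable_abse iz).
  have := dominated_cvg_EFin mD mf mg fg iz' fz.
  under eq_cvg do rewrite f0.
  move=> /cvg_lim; rewrite lim_cst // => E.
  transitivity (\int[mu]_(x in D) (g x)%:E)%E; last by rewrite -E.
  rewrite integral_mkcond [RHS]integral_mkcond; apply: eq_integral => x _.
  rewrite !patchE /g patchE in_setI; case: (x \in D) => //=.
  by case: (x \in _).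
have allz A : measurable A -> (\int[mu]_(x in D `&` A) (z x)%:E = 0)%E.
  move=> mA; have : <<s G>> A by rewrite -GE.
  apply: (dynkin_induction (P := fun A => (\int[mu]_(x in D `&` A) (z x)%:E = 0)%E) GE).
  - by move=> _ _ [a ->] [b ->]; exists (a ++ b); rewrite polyhedron_cat.
  - by rewrite -polyhedron_nil; exact: Gz.
  - by move=> _ [hs' ->]; exact: Gz.
  - move=> S mS S0; have DE : D = (D `&` S) `|` (D `&` ~` S).
      by rewrite -setIUr setUv setIT.
    have mDS : measurable (D `&` S) by exact: measurableI.
    have mDC : measurable (D `&` ~` S) by apply: measurableI => //; exact: measurableC.
    have dis : [disjoint D `&` S & D `&` ~` S].
      by apply/disj_setPS => x [[_ Sx] [_ /(_ Sx)]].
    have mz : measurable_fun ((D `&` S) `|` (D `&` ~` S)) (EFin \o z).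
      by rewrite -DE; apply/measurable_EFinP; exact: z2.1.
    have := integral_setU mu mDS mDC mz dis; rewrite -DE S0 add0e => <-.
    by have := Gz [::]; rewrite polyhedron_nil setIT.
  - move=> F mF tF F0; rewrite setI_bigcupr integral_bigcup.
    + by apply: eseries0 => i _ _; exact: F0.
    + exact: trivIset_setIl.
    + by move=> i; exact: measurableI.
    + apply: integrableS iz => //; first by apply: bigcupT_measurable => i; exact: measurableI.
      by apply: bigcup_sub => i _ x [].
have zae : ae_eq mu D (EFin \o z) (cst 0%E).
  apply: integral_ae_eq => //.
  by move=> E ED mE; rewrite integral0 -(setIidr ED); exact: allz.
have zz : ae_eq mu D (fun x => (z x * z x)%:E) (cst 0%E).
  by apply: filterS zae => x zx Dx; move: (zx Dx) => /= [->]; rewrite mul0r.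
apply/eqP; rewrite -sqrf_eq0 L2normE; apply/eqP.
rewrite /L2ip /integral_on /Rintegral (ae_eq_integral (cst 0%E)) //.
  by rewrite integral0.
by have := L2_integrable_mul mD z2 z2; move/integrableP => [].
Qed.

End half_spaces.

(** * Finite rank operators with bump functions as kernels *)

Section partial_sum.
Context {R : realType} {n : nat}.
Implicit Types f g : 'rV[R]_n -> R.

Lemma partialD f g i x : elementary f -> elementary g ->
  partial i (fun y => f y + g y) x = partial i f x + partial i g x.
Proof.
move=> /elementary_partialP[_ hf] /elementary_partialP[_ hg].
have [df _] := hf x (delta_mx ord0 i); have [dg _] := hg x (delta_mx ord0 i).
exact: (deriveD df dg).
Qed.

Lemma partial_cst c i x : partial i (fun _ : 'rV[R]_n => c : R) x = 0.
Proof. exact: derive_cst. Qed.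

Lemma partialZ c f i x : elementary f -> partial i (fun y => c * f y) x = c * partial i f x.
Proof.
move=> /elementary_partialP[_ hf]; have [df _] := hf x (delta_mx ord0 i).
exact: (deriveZ c df).
Qed.

Lemma partial_sum (I : Type) (r : seq I) (F : I -> 'rV[R]_n -> R) i x :
  (forall k, elementary (F k)) ->
  partial i (fun y => \sum_(k <- r) F k y) x = \sum_(k <- r) partial i (F k) x.
Proof.
move=> hF; elim: r => [|k r IH].
  under [in LHS]eq_fun do rewrite big_nil.
  by rewrite big_nil partial_cst.
under [in LHS]eq_fun do rewrite big_cons.
by rewrite big_cons partialD ?IH //; exact: elementary_sum.
Qed.

End partial_sum.

Section finite_rank.
Context {R : realType} {n : nat}.
Variables (D : set 'rV[R]_n).
Hypotheses (mD : measurable D) (bD : bounded_set D).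
Hypothesis bump_total : forall z, L2 D z ->
  (forall f, bump D f -> L2ip D f z = 0) -> L2norm D z = 0.
Implicit Types (w u : 'rV[R]_n -> R) (psi e : nat -> 'rV[R]_n -> R).

(** [w] is fixed by the finite rank operator [w |-> sum_(k < m) <psi k, w> e k].
    The equality is tested against square integrable functions, which makes it
    linear in [w] and insensitive to null sets. *)
Definition fixed_by m psi e w : Prop := forall u, L2 D u ->
  L2ip D u w = \sum_(k < m) L2ip D (psi k) w * L2ip D u (e k).

Let bL2 f : bump D f -> L2 D f. Proof. exact: bump_L2. Qed.

(** By induction, if [P] is such an operator fixing [w 0, ..., w (N-1)], let [r
    = w N - P (w N)]. If [r] is not null, some bump function [q] satisfies [<q,
    r> = 1]. Then [psi' = q - P^* q] is orthogonal to the previous [w j] and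
    [<psi', w N> = <q, r> = 1], so that adding [r * <psi', _>] to [P] makes it
    fix [w N] as well. *)
Lemma finite_rank_identity N (w : nat -> 'rV[R]_n -> R) :
  (forall j, L2 D (w j)) ->
  exists m psi e, [/\ forall k, bump D (psi k), forall k, L2 D (e k)
    & forall j, (j < N)%N -> fixed_by m psi e (w j)].
Proof.
move=> Lw; elim: N => [|N [m [psi [e [bpsi Le fw]]]]].
  exists 0%N, (fun _ _ => 0), (fun _ _ => 0); split=> // _; first exact: bump0.
  exact: L2_cst0.
have Lpsi k : L2 D (psi k) by exact: bL2.
pose Tw x := \sum_(k < m) L2ip D (psi k) (w N) * e k x.
have LTw : L2 D Tw by apply: L2_sum => // k; exact: L2Z.
pose r x := w N x - Tw x.
have Lr : L2 D r by exact: L2B.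
have ipTw u : L2 D u -> L2ip D u Tw = \sum_(k < m) L2ip D (psi k) (w N) * L2ip D u (e k).
  move=> Lu; rewrite L2ipC L2ip_suml // => [|k]; last exact: L2Z.
  by apply: eq_bigr => k _; rewrite L2ipZl // (L2ipC D u).
have [r0|r0] := eqVneq (L2norm D r) 0.
  exists m, psi, e; split=> // j; rewrite ltnS leq_eqVlt => /predU1P[->|]; last exact: fw.
  move=> u Lu; rewrite -ipTw // ![L2ip D u _]L2ipC.
  by have [E _] := L2normB0 mD (Lw N) LTw r0; exact: E.
have [f bf fr] : exists2 f, bump D f & L2ip D f r != 0.
  apply: contrapT => nf; move/eqP: r0; apply; apply: bump_total => // f bf.
  by apply/eqP/negP => fr; apply: nf; exists f => //; exact/negP.
have Lf := bL2 bf.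
pose q x := (L2ip D f r)^-1 * f x.
have Lq : L2 D q by exact: L2Z.
have qr : L2ip D q r = 1 by rewrite L2ipZl // mulVf.
(* This is [q - P^* q], where [P] is the operator obtained so far. *)
pose psi' x := q x + (-1) * \sum_(k < m) L2ip D q (e k) * psi k x.
have bpsi' : bump D psi'.
  by apply: bumpD; [exact: bumpZ|apply: bumpZ; apply: bump_sum => k; exact: bumpZ].
have ippsi' u : L2 D u ->
    L2ip D psi' u = L2ip D q u - \sum_(k < m) L2ip D (psi k) u * L2ip D q (e k).
  move=> Lu; have LS : L2 D (fun x => \sum_(k < m) L2ip D q (e k) * psi k x).
    by apply: L2_sum => // k; exact: L2Z.
  rewrite L2ipDl //; last exact: L2Z.
  rewrite (L2ipZl mD (-1) LS Lu) mulN1r L2ip_suml // => [|k]; last exact: L2Z.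
  by congr (_ - _); apply: eq_bigr => k _; rewrite L2ipZl // mulrC.
have psi'w : L2ip D psi' (w N) = 1.
  by rewrite ippsi' // -ipTw // -qr (L2ipC D q r) L2ipBl // !(L2ipC D q).
pose Psi k := if k == m then psi' else psi k.
pose E k := if k == m then r else e k.
exists m.+1, Psi, E; split.
- by move=> k; rewrite /Psi; case: eqP.
- by move=> k; rewrite /E; case: eqP.
- move=> j; rewrite ltnS => jN u Lu; rewrite big_ord_recr /= /Psi /E eqxx.
  rewrite (eq_bigr (fun k : 'I_m => L2ip D (psi k) (w j) * L2ip D u (e k))); last first.
    by move=> k _; rewrite ltn_eqF.
  move: jN; rewrite leq_eqVlt => /predU1P[->|jN].
    rewrite psi'w mul1r -ipTw // ![L2ip D u _]L2ipC -L2ipDl //.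
    by congr (L2ip D _ u); apply/funext => x; rewrite /r addrC subrK.
  rewrite ippsi' // -(fw j jN q Lq) subrr mul0r addr0.
  exact: fw.
Qed.

Lemma fixed_by_sum m psi e (I : Type) (s : seq I) (c : I -> R) (F : I -> 'rV[R]_n -> R) :
  (forall k, bump D (psi k)) -> (forall i, L2 D (F i)) ->
  (forall i, fixed_by m psi e (F i)) ->
  fixed_by m psi e (fun x => \sum_(i <- s) c i * F i x).
Proof.
move=> bpsi LF fF u Lu.
have ips u' : L2 D u' -> L2ip D u' (fun x => \sum_(i <- s) c i * F i x) =
    \sum_(i <- s) c i * L2ip D u' (F i).
  move=> Lu'; rewrite L2ipC L2ip_suml // => [|i]; last exact: L2Z.
  by apply: eq_bigr => i _; rewrite L2ipZl // (L2ipC D u').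
rewrite ips //.
under [RHS]eq_bigr => k _ do rewrite (ips _ (bL2 (bpsi k))) mulr_suml.
rewrite exchange_big /=; apply: eq_bigr => i _.
by rewrite fF // mulr_sumr; apply: eq_bigr => k _; rewrite mulrA.
Qed.

Lemma eq_fixed_by m psi e w w' : L2 D w -> L2 D w' ->
  (forall k, bump D (psi k)) -> L2norm D (fun x => w x - w' x) = 0 ->
  fixed_by m psi e w -> fixed_by m psi e w'.
Proof.
move=> Lw Lw' bpsi ww fw u Lu; have [E _] := L2normB0 mD Lw Lw' ww.
rewrite L2ipC -E // L2ipC fw //; apply: eq_bigr => k _.
congr (_ * _); rewrite L2ipC [RHS]L2ipC; apply: E; exact: bL2.
Qed.

(** The function [f = sum_k <w, e k> psi k]: since [w] is fixed, [<f, w> = sum_k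
    <w, e k> <psi k, w> = <w, w>]. *)
Lemma bump_dual m psi e : (forall k, bump D (psi k)) -> (forall k, L2 D (e k)) ->
  exists2 C : R, 0 <= C & forall w, L2 D w -> fixed_by m psi e w ->
    exists f, [/\ bump D f, L2ip D f w = L2ip D w w,
      L2norm D f <= C * L2norm D w &
      forall i, L2norm D (partial i f) <= C * L2norm D w].
Proof.
move=> bpsi Le.
have Lpsi k : L2 D (psi k) by exact: bL2.
have bdpsi k i : bump D (partial i (psi k)) by exact: bump_partial.
pose c k := L2norm D (psi k) + \sum_(i < n) L2norm D (partial i (psi k)).
exists (\sum_(k < m) L2norm D (e k) * c k).
  apply: sumr_ge0 => k _; rewrite mulr_ge0 ?L2norm_ge0 // addr_ge0 ?L2norm_ge0 //.
  by apply: sumr_ge0 => i _; exact: L2norm_ge0.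
move=> w Lw fw.
have bound (g : nat -> 'rV[R]_n -> R) : (forall k, L2 D (g k)) ->
    (forall k, L2norm D (g k) <= c k) ->
    L2norm D (fun x => \sum_(k < m) L2ip D w (e k) * g k x) <=
      (\sum_(k < m) L2norm D (e k) * c k) * L2norm D w.
  move=> Lg gc; rewrite (le_trans (L2norm_sum _ _ _)) // => [k|]; first exact: L2Z.
  rewrite mulr_suml; apply: ler_sum => k _; rewrite L2normZ //.
  rewrite mulrAC ler_pM ?L2norm_ge0 // mulrC; exact: cauchy_schwarz.
exists (fun x => \sum_(k < m) L2ip D w (e k) * psi k x); split.
- by apply: bump_sum => k; exact: bumpZ.
- rewrite L2ip_suml // => [|k]; last exact: L2Z.
  rewrite [RHS]fw //; apply: eq_bigr => k _; rewrite L2ipZl //; exact: mulrC.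
- apply: (bound psi) => // k; rewrite lerDl; apply: sumr_ge0 => i _; exact: L2norm_ge0.
- move=> i; rewrite (_ : partial i _ =
      fun x => \sum_(k < m) L2ip D w (e k) * partial i (psi k) x).
    apply: (bound (fun k => partial i (psi k))) => k; first exact: bL2.
    by rewrite /c (bigD1 i) //= addrCA lerDl addr_ge0 ?L2norm_ge0 // sumr_ge0 // => j _;
      exact: L2norm_ge0.
  apply/funext => x; rewrite partial_sum => [|k]; last by have [] := bumpZ (L2ip D w (e k)) (bpsi k).
  by apply: eq_bigr => k _; rewrite partialZ //; have [] := bpsi k.
Qed.

End finite_rank.

(** * The reference simplex and the cells *)

Section reference_simplex.
Context {R : realType} {d : nat}.
Hypothesis d0 : (0 < d)%N.
Local Notation mu := (lebesgue_rV (R := R) d).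
Local Notation ref := (@ref_simplex R d).

(** The open reference simplex as an intersection of half-spaces, to which the
    separation by bump functions applies. *)
Definition ref_half_spaces : seq (R * ('I_d -> R)) :=
  (1, fun=> -1) :: [seq (0, fun j => (j == i)%:R) | i <- enum 'I_d].

Lemma affine_form_coord i (x : 'rV[R]_d) : affine_form (0, fun j => (j == i)%:R) x = x ord0 i.
Proof.
rewrite /affine_form add0r (bigD1 i) //= eqxx mulr1 big1 ?addr0 // => j /negbTE ->.
by rewrite mulr0.
Qed.

Lemma affine_form_sum (x : 'rV[R]_d) : affine_form (1, fun=> -1) x = 1 - \sum_i x ord0 i.
Proof. by rewrite /affine_form /= -mulr_suml mulrN1. Qed.

Lemma ref_half_spacesP x : polyhedron ref_half_spaces x <->
  (forall i, 0 < x ord0 i) /\ \sum_i x ord0 i < 1.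
Proof.
rewrite /polyhedron /ref_half_spaces /= affine_form_sum subr_gt0 all_map; split.
  move=> /andP[x1 /allP hx]; split => // i.
  by have := hx i; rewrite mem_enum /= affine_form_coord; exact.
move=> [xi ->]; apply/allP => i _; by rewrite /= affine_form_coord.
Qed.

Lemma ref_simplex_le1 x i : ref x -> 0 <= x ord0 i <= 1.
Proof.
move=> [x0 x1]; rewrite x0 (le_trans _ x1) // (bigD1 i) //= lerDl.
by apply: sumr_ge0 => j _; exact: x0.
Qed.

Lemma ref_interiorE : ref° = polyhedron ref_half_spaces.
Proof.
apply/seteqP; split=> [x|]; last first.
  rewrite -open_subsetE; last exact: polyhedron_open.
  by move=> x /ref_half_spacesP[x0 x1]; split=> [i|]; exact: ltW.
move=> /nbhs_ballP[e /= e0 xe]; apply/ref_half_spacesP.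
have e2 : 0 < e / 2 by rewrite divr_gt0.
have inref (s : R) : `|s| <= e / 2 -> ref (x + const_mx s).
  move=> se; apply: xe; rewrite mx_norm_ball /ball_ /= opprD addrA subrr sub0r normrN.
  rewrite (@le_lt_trans _ _ (e / 2)) //; last by rewrite gtr_pMr // invf_lt1 // ltr1n.
  by apply: norm_le_coord => [|i]; rewrite ?mxE // ltW.
split=> [i|].
  have [|h _] := inref (- (e / 2)); first by rewrite normrN gtr0_norm.
  by have := h i; rewrite !mxE subr_ge0; exact: lt_le_trans.
have [|_] := inref (e / 2); first by rewrite gtr0_norm.
apply: lt_le_trans.
rewrite [ltRHS](eq_bigr (fun i => x ord0 i + e / 2)) => [|i _]; last by rewrite !mxE.
by rewrite big_split /= ltrDl sumr_const card_ord pmulrn_rgt0.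
Qed.

Lemma open_ref_interior : open ref°. Proof. exact: open_interior. Qed.

Lemma measurable_ref_interior : measurable ref°.
Proof. exact: open_measurable_rV open_ref_interior. Qed.

Lemma bounded_ref : bounded_set ref.
Proof.
apply/bounded_rVP; exists 1 => // x hx i; have /andP[h1 ->] := ref_simplex_le1 i hx.
by rewrite (le_trans _ h1) // oppr_le0.
Qed.

Lemma bounded_ref_interior : bounded_set ref°.
Proof.
apply/bounded_rVP; have [M M0 h] := (bounded_rVP _).1 bounded_ref; exists M => //.
by apply: subset_trans h; exact: interior_subset.
Qed.

Lemma measurable_ref : measurable ref.
Proof.
rewrite (_ : ref = (\bigcap_(i in [set: 'I_d]) ((fun x : 'rV[R]_d => x ord0 i) @^-1` `[0, +oo[)) `&`
   ((fun x : 'rV[R]_d => \sum_i x ord0 i) @^-1` `]-oo, 1])).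
  apply: measurableI.
    apply: fin_bigcap_measurable => // i _; rewrite -[X in measurable X]setTI.
    exact: (measurable_coord (T:=R)).
  rewrite -[X in measurable X]setTI.
  have : measurable_fun setT (fun x : 'rV[R]_d => \sum_i x ord0 i).
    by apply: measurable_sum => i; exact: (measurable_coord (T:=R)).
  exact.
apply/seteqP; split=> x /=; rewrite in_itv /= => -[h1 h2]; split => //.
  by move=> i _ /=; rewrite in_itv /= h1.
by move=> i; have := h1 i I; rewrite /= in_itv /= andbT.
Qed.

(** The boundary is contained in finitely many hyperplanes. *)
Lemma ref_boundary_null : mu (ref `\` ref°) = 0%E.
Proof.
have nullZ p (v : 'rV[R]_d) : \sum_i v ord0 i * p.2 i != 0 ->
    mu.-negligible (ref `&` [set x | affine_form p x = 0]).
  move=> vp; have mZ : measurable (ref `&` [set x | affine_form p x = 0]).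
    apply: measurableI; first exact: measurable_ref.
    rewrite -[X in measurable X]setTI.
    exact: (continuous_measurable_rV (@continuous_affine_form _ _ p) measurableT (measurable_set1 0)).
  apply/negligibleP => //; apply: (@hyperplane_null _ _ p.1 p.2 v _ vp mZ); last by move=> x [].
  apply/bounded_rVP; have [M M0 h] := (bounded_rVP _).1 bounded_ref; exists M => //.
  by move=> x [/h].
pose Z s := ref `&` [set x | has (fun i => x ord0 i == 0) s].
(* The union of the coordinate hyperplanes, by induction on the list of the
   coordinates. *)
have nullI s : mu.-negligible (Z s).
  elim: s => [|i s IH].
    suff -> : Z [::] = set0 by exact: negligible_set0.
    by rewrite -subset0 => y [].
  apply: (@negligibleS _ _ _ _ ((ref `&` [set x | affine_form (0, fun j => (j == i)%:R) x = 0]) `|` Z s)).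
    by move=> x [rx] /= /orP[/eqP xi|]; [left; split => //=; rewrite affine_form_coord|right].
  apply: negligibleU => //; apply: (nullZ _ (delta_mx ord0 i)).
  rewrite (bigD1 i) //= mxE !eqxx mulr1 big1 ?addr0 ?oner_eq0 // => j /negbTE ->.
  by rewrite mulr0.
apply/negligibleP; first by apply: measurableD; [exact: measurable_ref|exact: measurable_ref_interior].
apply: (negligibleS (A := (ref `&` [set x | affine_form (1, fun=> -1) x = 0]) `|` Z (enum 'I_d))).
  move=> x [rx nx]; have [x0 x1] := rx.
  have [s1|s1] := eqVneq (\sum_i x ord0 i) 1.
    by left; split => //=; rewrite affine_form_sum s1 subrr.
  right; split => //=; apply: contrapT => /negP/hasPn hx; apply: nx.
  rewrite ref_interiorE; apply/ref_half_spacesP; split=> [i|]; last by rewrite lt_neqAle s1.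
  by rewrite lt_neqAle x0 eq_sym hx // mem_enum.
apply: negligibleU => //; apply: (nullZ _ (const_mx 1)).
under eq_bigr do rewrite mxE mulrN1.
by rewrite sumrN oppr_eq0 sumr_const card_ord pnatr_eq0 -lt0n.
Qed.

End reference_simplex.

Section cells.
Context {R : realType} {d : nat}.
Local Notation cell := 'M[R]_(d.+1, d).
Local Notation ref := (@ref_simplex R d).
Implicit Types K : cell.

(** The inverse of [cell_map K] when [edges K] is invertible. *)
Definition cell_inv K : 'rV[R]_d -> 'rV[R]_d :=
  affine (- row ord0 K *m invmx (edges K)) (invmx (edges K)).

(** The interior of the simplex, encoded as a preimage to make it open and
    measurable at once. *)
Definition open_cell K : set 'rV[R]_d := cell_inv K @^-1` ref°.

Lemma cell_mapK K : edges K \in unitmx -> cancel (cell_map K) (cell_inv K).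
Proof. exact: affineK. Qed.

Lemma cell_invK K : edges K \in unitmx -> cancel (cell_inv K) (cell_map K).
Proof. exact: affineKV. Qed.

Lemma mulmx_cell K (w : 'rV[R]_d.+1) : \sum_i w ord0 i = 1 ->
  w *m K = cell_map K (\row_j w ord0 (lift ord0 j)).
Proof.
move=> w1; rewrite /cell_map !mulmx_sum_row big_ord_recl /=.
have -> : w ord0 ord0 = 1 - \sum_(j < d) w ord0 (lift ord0 j).
  by rewrite -w1 big_ord_recl /= addrK.
rewrite scalerBl scale1r -addrA; congr (_ + _).
rewrite scaler_suml addrC -sumrB; apply: eq_bigr => j _.
by rewrite /edges rowK mxE scalerBr.
Qed.

Lemma simplexE K : simplex K = cell_map K @` ref.
Proof.
apply/seteqP; split=> y.
  move=> [w [w0 _ w1 ->]]; exists (\row_j w ord0 (lift ord0 j)); last by rewrite mulmx_cell.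
  split=> [i|]; first by rewrite mxE.
  under eq_bigr do rewrite mxE.
  by rewrite -w1 big_ord_recl /= lerDr.
move=> [x [x0 x1] <-].
exists (\row_i oapp (fun j => x ord0 j) (1 - \sum_i x ord0 i) (unlift ord0 i)).
have s1 : \sum_i (\row_i oapp (fun j => x ord0 j) (1 - \sum_i x ord0 i) (unlift ord0 i)) ord0 i = 1 :> R.
  rewrite big_ord_recl /= mxE unlift_none /=.
  by under [X in _ + X]eq_bigr do rewrite mxE liftK /=; rewrite subrK.
split=> // [i|i|]; last first.
- rewrite mulmx_cell //; congr (cell_map K _); apply/rowP => j.
  by rewrite !mxE liftK.
- by rewrite inE.
- by rewrite mxE; case: unliftP => [j|] _ /=; rewrite ?subr_ge0.
Qed.

Lemma measurable_cell_inv K : measurable_fun setT (cell_inv K).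
Proof. exact: measurable_affine. Qed.

Lemma open_open_cell K : open (open_cell K).
Proof.
apply: open_comp; last exact: open_interior.
by move=> x _; exact: continuous_affine.
Qed.

Lemma open_cell_interior K : edges K \in unitmx -> open_cell K `<=` (simplex K)°.
Proof.
move=> uK; rewrite -open_subsetE; last exact: open_open_cell.
move=> x /interior_subset hx; rewrite simplexE; exists (cell_inv K x) => //.
exact: cell_invK.
Qed.

Lemma preimage_open_cell K : edges K \in unitmx -> cell_map K @^-1` open_cell K = ref°.
Proof. by move=> uK; apply/seteqP; split=> x; rewrite /open_cell /= cell_mapK. Qed.

Lemma preimage_cell_inv K (A : set 'rV[R]_d) : edges K \in unitmx ->
  cell_map K @` A = cell_inv K @^-1` A.
Proof.
move=> uK; apply/seteqP; split=> [_ [x Ax <-]|x Ax] /=; first by rewrite cell_mapK.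
by exists (cell_inv K x) => //; exact: cell_invK.
Qed.

End cells.

(** * Lipschitz boundaries and the decomposition into cells *)

Section lipschitz_interior.
Context {R : realType} {d : nat}.
Implicit Types (x y w e : 'rV[R]_d) (Omega : set 'rV[R]_d).

Lemma le_coord_enorm x i : `|x ord0 i| <= enorm x.
Proof.
rewrite -(ler_pXn2r (n := 2)) ?nnegrE ?sqrtr_ge0 // real_normK ?num_real //.
have x2 : 0 <= dot x x by apply: sumr_ge0 => j _; rewrite -expr2 sqr_ge0.
rewrite sqr_sqrtr // /dot (bigD1 i) //= expr2 lerDl.
by apply: sumr_ge0 => j _; rewrite -expr2 sqr_ge0.
Qed.

Lemma enorm_le x : enorm x <= d%:R * `|x|.
Proof.
rewrite -(ler_pXn2r (n := 2)) ?nnegrE ?sqrtr_ge0 ?mulr_ge0 //.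
have x2 : 0 <= dot x x by apply: sumr_ge0 => j _; rewrite -expr2 sqr_ge0.
rewrite sqr_sqrtr // /dot exprMn.
apply: (@le_trans _ _ (\sum_(i < d) `|x| ^+ 2)).
  apply: ler_sum => i _; rewrite -expr2 -(real_normK (num_real (x ord0 i))).
  by rewrite lerXn2r ?nnegrE // le_coord_norm.
rewrite sumr_const card_ord -[leLHS]mulr_natl.
apply: ler_wpM2r; first exact: sqr_ge0.
rewrite -natrX ler_nat; by case: (d) => // m; rewrite expnS leq_pmulr // expn1.
Qed.

Lemma dot_le x e : enorm e = 1 -> `|dot x e| <= d%:R * `|x|.
Proof.
move=> e1; rewrite (le_trans (ler_norm_sum _ _ _)) //.
apply: (@le_trans _ _ (\sum_(i < d) `|x|)); last by rewrite sumr_const card_ord mulr_natl.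
apply: ler_sum => i _; rewrite normrM -[leRHS]mulr1 ler_pM ?le_coord_norm //.
by rewrite -e1 le_coord_enorm.
Qed.

Lemma dotDl x y e : dot (x + y) e = dot x e + dot y e.
Proof. by rewrite /dot -big_split /=; apply: eq_bigr => i _; rewrite mxE mulrDl. Qed.

Lemma dotZl (t : R) x e : dot (t *: x) e = t * dot x e.
Proof. by rewrite /dot mulr_sumr; apply: eq_bigr => i _; rewrite mxE mulrA. Qed.

(** Let [x] be a boundary point. Moving from [x] by [t] along [- e] gives a
    point [z] strictly below the graph, and a neighbourhood of [z] does not meet
    [Omega]; so [x] is not interior to the closure. *)
Lemma lipschitz_interior_closure Omega : open Omega -> lipschitz_boundary Omega ->
  (closure Omega)° `<=` Omega.
Proof.
move=> oO lO x xi; apply: contrapT => nx.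
have oI : Omega° = Omega by apply/interior_id.
have [e [gamma [L [r [e1 r0 gL hO]]]]] : exists e (gamma : 'rV[R]_d -> R) L r,
    [/\ enorm e = 1, 0 < r, forall y z, `|gamma y - gamma z| <= L * enorm (y - z)
      & forall y, enorm (y - x) < r -> (Omega y <-> gamma (y - dot y e *: e) < dot y e)].
  by apply: lO; split; [exact: interior_subset|rewrite oI].
have ee : dot e e = 1.
  have : enorm e ^+ 2 = 1 by rewrite e1 expr1n.
  by rewrite sqr_sqrtr // sumr_ge0 // => i _; rewrite -expr2 sqr_ge0.
have enorm0 : enorm (0 : 'rV[R]_d) = 0.
  by rewrite /enorm /dot big1 ?sqrtr0 // => i _; rewrite mxE mul0r.
have gx : dot x e <= gamma (x - dot x e *: e).
  rewrite leNgt; apply/negP => h; apply: nx; apply/(hO x) => //.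
  by rewrite subrr enorm0.
have e_le i : `|e ord0 i| <= 1 by rewrite -e1 le_coord_enorm.
have ne : `|e| <= 1 by exact: norm_le_coord.
move/nbhs_ballP: xi => [s /= s0 xs].
(* The first bound keeps [z] in the closure of [Omega], the second keeps [z]
   and its neighbourhood in the chart, the sup norm and the Euclidean norm
   being equivalent with constant [d]. *)
pose t := Num.min (s / 2) (r / (2 * d.+1%:R)).
have D0 : 0 < d.+1%:R :> R by rewrite ltr0n.
have t0 : 0 < t by rewrite lt_min !divr_gt0 // mulr_gt0.
pose z := x - t *: e.
have cz : closure Omega z.
  apply: xs; rewrite mx_norm_ball /ball_ /= /z opprB addrC subrK normrZ gtr0_norm //.
  rewrite (@le_lt_trans _ _ (s / 2)) //; last by rewrite gtr_pMr // invf_lt1 // ltr1n.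
  by rewrite -[leRHS]mulr1; apply: ler_pM => //; [exact: ltW|rewrite /t ge_min lexx].
pose C := d%:R + `|L| * (d%:R * (1 + d%:R)).
have C0 : 0 <= C by rewrite addr_ge0 // !mulr_ge0 // addr_ge0.
(* [C] bounds the variation of [dot y e - gamma (pr y)]; points at distance
   less than [t / (C + 1)] from [z] are still below the graph. *)
pose del := Num.min t (t / (C + 1)).
have del0 : 0 < del by rewrite lt_min t0 divr_gt0 // ltr_wpDl.
have [y [Oy yz]] : (Omega `&` ball z del) !=set0.
  by apply: cz; exact: nbhsx_ballx.
have yzn : `|y - z| < del by move: yz; rewrite mx_norm_ball /ball_ /= distrC.
set w := y - z in yzn.
have yE : y = x - t *: e + w by rewrite /w /z addrC subrK.
have yx : enorm (y - x) < r.
  rewrite (le_lt_trans (enorm_le _)) //.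
  have : `|y - x| <= t + t.
    rewrite yE (_ : _ - x = w - t *: e); last first.
      by rewrite addrAC addrC; congr (_ + _); rewrite addrAC subrr sub0r.
    rewrite (le_trans (ler_normB _ _)) // lerD //.
      by rewrite (le_trans (ltW yzn)) // ge_min lexx.
    by rewrite normrZ gtr0_norm // ler_piMr // ltW.
  have tr : t <= r / (2 * d.+1%:R) by rewrite ge_min lexx orbT.
  move=> h; apply: (@le_lt_trans _ _ (d%:R * (t + t))); first exact: ler_wpM2l.
  apply: (@lt_le_trans _ _ (d.+1%:R * (t + t))).
    by rewrite ltr_pM2r ?addr_gt0 // ltr_nat.
  move: tr; rewrite ler_pdivlMr ?mulr_gt0 //; lra.
pose pr v := v - dot v e *: e.
have gy : gamma (pr y) < dot y e := (hO y yx).1 Oy.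
have gx' : dot x e <= gamma (pr x) := gx.
have prE : pr y = pr x + pr w.
  rewrite /pr yE !dotDl -scaleNr dotZl ee; apply/rowP => i; rewrite !mxE; ring.
have prw : enorm (pr w) <= d%:R * (1 + d%:R) * `|w|.
  rewrite (le_trans (enorm_le _)) // -mulrA; apply: ler_wpM2l => //.
  rewrite (le_trans (ler_normB _ _)) // mulrDl mul1r lerD2l normrZ.
  by rewrite -[leRHS]mulr1 ler_pM // dot_le.
have prB : pr y - pr x = pr w by rewrite prE addrAC subrr add0r.
have := gL (pr y) (pr x); rewrite prB => gxy.
have Lw : L * enorm (pr w) <= `|L| * (d%:R * (1 + d%:R)) * `|w|.
  rewrite (le_trans (ler_norm _)) // normrM [`|enorm _|]ger0_norm ?sqrtr_ge0 // -mulrA.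
  by apply: ler_wpM2l.
have yxe : dot y e = dot x e - t + dot w e.
  by rewrite yE !dotDl -scaleNr dotZl ee mulr1.
rewrite yxe in gy.
have dw := le_trans (ler_norm _) (dot_le w e1).
have tC : t < C * `|w|.
  have := le_trans gxy Lw; rewrite ler_norml => /andP[h _].
  have E : C * `|w| = d%:R * `|w| + `|L| * (d%:R * (1 + d%:R)) * `|w| by rewrite /C; ring.
  rewrite E; move: gx' gy h dw.
  set gX := gamma (pr x); set gY := gamma (pr y); set W := d%:R * `|w|.
  set LW := _ * `|w|; lra.
have : C * `|w| <= C * (t / (C + 1)).
  by apply: ler_wpM2l => //; rewrite (le_trans (ltW yzn)) // ge_min lexx orbT.
have C1 : 0 < C + 1 by rewrite ltr_wpDl.
rewrite mulrA ler_pdivlMr // => h.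
have := ltr_pM2r C1 t (C * `|w|); rewrite tC => /idP; nra.
Qed.

End lipschitz_interior.

Section decomposition.
Context {R : realType} {d : nat}.
Hypothesis d0 : (0 < d)%N.
Local Notation mu := (lebesgue_rV (R := R) d).
Local Notation cell := 'M[R]_(d.+1, d).
Local Notation ref := (@ref_simplex R d).
Variables (Omega : set 'rV[R]_d) (T : seq cell).
Hypotheses (hO : bounded_lipschitz_domain Omega)
  (hT : conforming_triangulation Omega T).

Implicit Types K L : cell.

Lemma domain_open : open Omega. Proof. by case: hO. Qed.

Lemma domain_bounded : bounded_set Omega. Proof. by case: hO. Qed.

Lemma domain_measurable : measurable Omega.
Proof. exact: open_measurable_rV domain_open. Qed.

Lemma cell_unit K : K \in T -> edges K \in unitmx.
Proof. by case: hT => h _ _ _; exact: h. Qed.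

Lemma simplex_closure K : K \in T -> simplex K `<=` closure Omega.
Proof. by case: hT => _ -> _ _ KT x Kx; exists K. Qed.

Lemma open_cell_sub K : K \in T -> open_cell K `<=` Omega.
Proof.
move=> KT x Kx; case: hO => _ oO _ _ lO.
apply: (lipschitz_interior_closure oO lO).
by apply: (interiorS (simplex_closure KT)); exact: open_cell_interior (cell_unit KT) _ Kx.
Qed.

Lemma open_cell_disjoint K L x :
  K \in T -> L \in T -> open_cell K x -> open_cell L x -> K = L.
Proof.
move=> KT LT Kx Lx; apply: contrapT => KL; case: hT => _ _ /(_ _ _ KT LT KL) h _.
suff : set0 x by [].
by rewrite -h; split; apply: open_cell_interior => //; exact: cell_unit.
Qed.

Lemma measurable_open_cell K : measurable (open_cell K).
Proof. apply: open_measurable_rV. exact: open_open_cell. Qed.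

(** [Omega] is covered by the closed simplices, whose boundaries are affine
    images of the null boundary of the reference simplex. *)
Lemma skeleton_null :
  mu (Omega `\` \big[setU/set0]_(K <- undup T) open_cell K) = 0%E.
Proof.
set U := \big[setU/set0]_(K <- undup T) open_cell K.
have mU : measurable U by apply: bigsetU_measurable => K _; exact: measurable_open_cell.
pose Z K := cell_inv K @^-1` (ref `\` ref°).
have nullK K : K \in T -> mu.-negligible (Z K).
  move=> KT; have mr : measurable (ref `\` ref°).
    by apply: measurableD; [exact: measurable_ref|exact: measurable_ref_interior].
  apply/negligibleP; first by rewrite -[X in measurable X]setTI; exact: measurable_cell_inv.
  have uV : invmx (edges K) \in unitmx by rewrite unitmx_inv cell_unit.
  have [c _ hc] := lebesgue_rV_affine (- row ord0 K *m invmx (edges K)) uV.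
  have := hc _ mr; rewrite ref_boundary_null // mule0; exact.
have null (s : seq cell) : {subset s <= T} ->
    mu.-negligible [set x : 'rV[R]_d | exists2 K, K \in s & Z K x].
  elim: s => [_|K s IH sT].
    suff -> : [set x : 'rV[R]_d | exists2 K, K \in [::] & Z K x] = set0.
      exact: negligible_set0.
    by rewrite -subset0 => x [].
  apply: (negligibleS (A := Z K `|`
    [set x : 'rV[R]_d | exists2 K, K \in s & Z K x])).
    by move=> x [L]; rewrite inE => /predU1P[->|Ls] Lx; [left|right; exists L].
  apply: negligibleU; first by apply: nullK; apply: sT; rewrite mem_head.
  by apply: IH => L Ls; apply: sT; rewrite inE Ls orbT.
apply/negligibleP; first by apply: measurableD => //; exact: domain_measurable.
apply: (negligibleS _ (null T _)) => // x [Ox nUx].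
case: hT => _ cO _ _.
have : closure Omega x by exact: subset_closure.
rewrite cO => -[K KT]; rewrite simplexE preimage_cell_inv ?cell_unit // => Kx.
exists K => //; split => // Kx'; apply: nUx.
rewrite /U -bigcup_seq; exists K => //=.
by rewrite mem_undup.
Qed.

(** The weights [vol K] are the factors by which affine maps multiply the
    measure. The later estimates compare two integrals over the same cell, where
    the weight cancels. *)
Lemma cell_decomposition : exists2 vol : cell -> R,
  (forall K, K \in T -> 0 < vol K) &
  forall f : 'rV[R]_d -> R, mu.-integrable Omega (EFin \o f) ->
    (forall K, K \in T -> mu.-integrable ref° (EFin \o (f \o cell_map K))) /\
    integral_on Omega f = \sum_(K <- undup T) vol K * integral_on ref° (f \o cell_map K).
Proof.
have hc K : exists c : R, K \in T -> 0 < c /\ forall A, measurable A ->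
    mu (cell_map K @^-1` A) = (c%:E * mu A)%E.
  have [KT|KT] := boolP (K \in T); last by exists 1.
  by have [c c0 h] := lebesgue_rV_affine (row ord0 K) (cell_unit KT); exists c.
have [c cP] := choice hc.
exists (fun K => (c K)^-1) => [K /cP[c0 _]|f fO]; first by rewrite invr_gt0.
have mO := domain_measurable.
have mK K := measurable_open_cell K.
have fK K : K \in T -> mu.-integrable (open_cell K) (EFin \o f).
  by move=> KT; apply: integrableS fO => //; exact: open_cell_sub.
have mphi K : measurable_fun setT (cell_map K) by exact: measurable_affine.
split=> [K KT|].
  have [c0 hK] := cP _ KT; rewrite -(preimage_open_cell (cell_unit KT)).
  exact: (integrable_scaled (mphi K) c0 hK (mK K) (fK _ KT)).
set U := \big[setU/set0]_(K <- undup T) open_cell K.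
have mU : measurable U by apply: bigsetU_measurable => K _.
have UO : U `<=` Omega.
  by rewrite /U -bigcup_seq => x [K /=]; rewrite mem_undup => KT; exact: open_cell_sub.
have mN : measurable (Omega `\` U) by exact: measurableD.
transitivity (integral_on U f).
  rewrite /integral_on /Rintegral (negligible_integral mN mO fO skeleton_null).
  by rewrite setDD setIidr.
rewrite {1}/integral_on /Rintegral integral_bigsetU_EFin //.
- have ffin K : K \in undup T -> (\int[mu]_(x in open_cell K) (f x)%:E)%E \is a fin_num.
    by rewrite mem_undup => KT; apply: integrable_fin_num => //; exact: fK.
  transitivity (\sum_(K <- undup T) integral_on (open_cell K) f).
    rewrite (eq_big_seq (fun K => (integral_on (open_cell K) f)%:E)) => [|K /ffin/fineK <- //].
    by rewrite sumEFin.
  rewrite big_seq [RHS]big_seq; apply: eq_bigr => K; rewrite mem_undup => KT.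
  have [c0 hK] := cP _ KT.
  have := integral_scaled (mphi K) c0 hK (mK K) (fK _ KT).
  by rewrite preimage_open_cell ?cell_unit // => ->; rewrite mulKf // gt_eqF.
- exact: undup_uniq.
- apply/trivIsetP => K L /=; rewrite !mem_undup => KT LT /eqP KL.
  by apply/seteqP; split=> // x [Kx Lx]; apply: KL; exact: open_cell_disjoint Kx Lx.
- have [mf _] := integrableP _ _ _ fO.
  by apply: measurable_funS mf.
Qed.

Lemma L2_cell K f : K \in T -> L2 Omega f -> L2 ref° (f \o cell_map K).
Proof.
move=> KT [mf f2]; split; last first.
  have [vol _ /(_ (fun x => f x ^+ 2) f2)[/(_ _ KT)]] := cell_decomposition.
  by [].
have mphi : measurable_fun setT (cell_map K) by exact: measurable_affine.
rewrite -(preimage_open_cell (cell_unit KT)).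
apply: (measurable_scaled mphi (measurable_open_cell K)).
apply: measurable_funS mf; [exact: domain_measurable|exact: open_cell_sub].
Qed.

End decomposition.

(** * Shape regularity *)

Section shape.
Context {R : realType} {d : nat}.
Local Notation cell := 'M[R]_(d.+1, d).
Implicit Types K : cell.

Lemma enorm_delta i (t : R) : enorm (t *: delta_mx ord0 i : 'rV[R]_d) = `|t|.
Proof.
rewrite /enorm /dot (bigD1 i) //= big1 ?addr0.
  by rewrite !mxE !eqxx mulr1 -expr2 sqrtr_sqr.
by move=> j /negbTE ji; rewrite !mxE ji andbF mulr0 mul0r.
Qed.

(** The points [x0 + r e_i] and [x0 - r e_i] are images of points [a] and [b] of
    the reference simplex, so that [2 r] times the [i]-th row of the inverse
    matrix is [a - b], whose entries are at most 1 in absolute value. *)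
Lemma inscribed_ball_inv K x0 (r : R) i j : edges K \in unitmx -> 0 <= r ->
  (forall y, enorm (y - x0) <= r -> simplex K y) ->
  2 * r * `|invmx (edges K) i j| <= 1.
Proof.
move=> uK r0 hb.
have hs (s : R) : `|s| = r -> simplex K (x0 + s *: delta_mx ord0 i).
  by move=> sr; apply: hb; rewrite addrAC subrr add0r enorm_delta sr.
have := hs r (ger0_norm r0); rewrite simplexE => -[a ra ea].
have := hs (- r); rewrite normrN ger0_norm // => /(_ erefl); rewrite simplexE => -[b rb eb].
have E : (2 * r) *: delta_mx ord0 i = (a - b) *m edges K.
  have : cell_map K a - cell_map K b = (2 * r) *: delta_mx ord0 i.
    rewrite ea eb scaleNr opprD opprK addrACA subrr add0r -scalerDl; congr (_ *: _); ring.
  by rewrite /cell_map opprD addrACA subrr add0r -mulmxBl => ->.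
have {}E : (2 * r) *: row i (invmx (edges K)) = a - b.
  by rewrite rowE scalemxAl E mulmxK.
have : ((2 * r) *: row i (invmx (edges K))) ord0 j = (a - b) ord0 j by rewrite E.
rewrite !mxE => h.
rewrite -[leLHS]ger0_norm ?mulr_ge0 // normrM normr_id -normrM h.
have /andP[a0 a1] := ref_simplex_le1 j ra; have /andP[b0 b1] := ref_simplex_le1 j rb.
by rewrite ler_norml; apply/andP; split; lra.
Qed.

Lemma has_sup_of_gt0 (A : set R) : 0 < sup A -> has_sup A.
Proof. by move=> A0; apply: contrapT => /sup_out h; rewrite h ltxx in A0. Qed.

(** Shape regularity and quasi-uniformity put a ball of radius at least [k h] in
    each simplex. The same ball lies in the bounded domain, which bounds [h]. *)
Lemma shape_regular_inv (Omega : set 'rV[R]_d) (sizes : set R) (T : R -> seq cell) :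
  (0 < d)%N -> bounded_set Omega -> (forall h, sizes h -> 0 < h) ->
  (forall h, sizes h -> conforming_triangulation Omega (T h)) ->
  shape_regular sizes T -> quasi_uniform sizes T ->
  exists2 C : R, 0 < C & forall h K, sizes h -> K \in T h ->
    h <= C /\ forall i j, h * `|invmx (edges K) i j| <= C.
Proof.
move=> d0 bO h0 hT [sigma s0 hs] [c1 [c2 [c10 c20 hq]]].
have [M M0 OM] := (bounded_rVP _).1 bO.
have OM' : closure Omega `<=` cube (- M) M.
  rewrite [X in _ `<=` X](closure_id _).1; first exact: closureS.
  rewrite (_ : cube _ _ = \bigcap_(i in [set: 'I_d])
      ((fun x : 'rV[R]_d => x ord0 i) @^-1` `[- M, M])).
    apply: closed_bigI => i _; apply: closed_comp; last exact: itv_closed.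
    by move=> x _; exact: continuous_coord.
  apply/seteqP; split=> x /= hx i; last by have := hx i I; rewrite /= in_itv.
  by move=> _; rewrite /= in_itv /=; exact: hx.
(* The inscribed diameter is at least [c1 h / sigma]; one factor 2 passes from
   diameter to radius, the other one from the supremum to an actual ball. *)
pose k := c1 / (4 * sigma).
have k0 : 0 < k by rewrite divr_gt0 // mulr_gt0.
exists ((M + 1) / k) => [|h K sh KT]; first by rewrite divr_gt0 // ltr_wpDl.
have hp := h0 _ sh.
have [uT cT _ _] := hT _ sh.
have /andP[dh _] := hq _ _ sh KT.
have ins : c1 * h / sigma <= inscribed_diameter (simplex K).
  by rewrite ler_pdivrMr // [leRHS]mulrC; exact: le_trans dh (hs _ _ sh KT).
have ins0 : 0 < c1 * h / sigma by rewrite divr_gt0 // mulr_gt0.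
have [_ [x0 [r [r0 hb ->]]] hr] : exists2 s, [set s | exists x r, [/\ 0 <= r,
    forall y, enorm (y - x) <= r -> simplex K y & s = 2 * r]] s & c1 * h / sigma / 2 < s.
  have hsup := has_sup_of_gt0 (lt_le_trans ins0 ins).
  have e0 : 0 < c1 * h / sigma / 2 by rewrite divr_gt0.
  have [s Ss hs'] := sup_adherent e0 hsup.
  by exists s => //; apply: le_lt_trans hs'; rewrite /inscribed_diameter in ins; lra.
have rk : k * h <= r.
  have -> : k * h = c1 * h / sigma / 2 / 2 by rewrite /k; field; rewrite gt_eqF.
  lra.
have rM : r <= M.
  have i : 'I_d by exists 0%N.
  have := hb (x0 + r *: delta_mx ord0 i); rewrite addrAC subrr add0r enorm_delta ger0_norm // lexx.
  move=> /(_ erefl) /(simplex_closure (hT _ sh) KT)/OM'/(_ i).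
  have := hb (x0 - r *: delta_mx ord0 i); rewrite addrAC subrr add0r -scaleNr enorm_delta normrN ger0_norm // lexx.
  move=> /(_ erefl) /(simplex_closure (hT _ sh) KT)/OM'/(_ i).
  by rewrite !mxE !eqxx !mulr1 => /andP[a1 a2] /andP[b1 b2]; lra.
split=> [|i j].
  by rewrite ler_pdivlMr // mulrC (le_trans rk) // (le_trans rM) // lerDl.
have := inscribed_ball_inv i j (uT _ KT) r0 hb.
set a := `|_| => h1.
rewrite ler_pdivlMr //; have a0 : 0 <= a by exact: normr_ge0.
nra.
Qed.

End shape.

(** * Weak derivatives and gluing over the cells *)

Section weak_partials.
Context {R : realType} {n : nat}.
Variables (D : set 'rV[R]_n).
Hypotheses (mD : measurable D) (bD : bounded_set D).

(** The form in which density of bump functions in [L^2 D] is used. *)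
Definition bump_separating : Prop := forall z, L2 D z ->
  (forall f, bump D f -> L2ip D f z = 0) -> L2norm D z = 0.

Hypothesis total : bump_separating.
Implicit Types (f g w : 'rV[R]_n -> R) (i : 'I_n).

Lemma weak_partialP f i : H1 D f -> is_weak_partial D i f (weak_partial D i f).
Proof. by move=> [_ /(_ i) ex]; exact: (xgetPex (fun=> 0) ex). Qed.

Lemma weak_partial_unique f g i : is_weak_partial D i f g ->
  L2norm D (weak_partial D i f) = L2norm D g /\
  forall w, L2 D w -> L2ip D (weak_partial D i f) w = L2ip D g w.
Proof.
move=> hg; have hw : is_weak_partial D i f (weak_partial D i f).
  by apply: (xgetPex (fun=> 0)); exists g.
have Lg := hg.1; have Lw := hw.1.
have z0 : L2norm D (fun x => weak_partial D i f x - g x) = 0.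
  apply: total => [|psi bpsi]; first exact: L2B.
  have Lpsi : L2 D psi by exact: bump_L2 bpsi.
  have tpsi := bump_test_function bpsi.
  have E1 := hg.2 _ tpsi; have E2 := hw.2 _ tpsi.
  rewrite L2ipC L2ipBl //; apply/eqP; rewrite subr_eq0; apply/eqP.
  by apply: oppr_inj; rewrite /L2ip -E1 -E2.
by have [E N] := L2normB0 mD Lw Lg z0.
Qed.

Lemma is_weak_partial_lin a f1 f2 g1 g2 i : L2 D f1 -> L2 D f2 ->
  is_weak_partial D i f1 g1 -> is_weak_partial D i f2 g2 ->
  is_weak_partial D i (fun x => a * f1 x + f2 x) (fun x => a * g1 x + g2 x).
Proof.
move=> L1 L2' [Lg1 h1] [Lg2 h2]; split; first by apply: L2D => //; exact: L2Z.
move=> phi tphi.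
have Lphi : L2 D phi by exact: test_function_L2 tphi.
have Ldphi : L2 D (partial i phi).
  by apply: (test_function_L2 mD bD); exact: test_function_partial tphi.
have E1 : L2ip D (fun x => a * f1 x + f2 x) (partial i phi) =
    a * L2ip D f1 (partial i phi) + L2ip D f2 (partial i phi).
  by rewrite (L2ipDl mD (L2Z mD a L1) L2' Ldphi) (L2ipZl mD a L1 Ldphi).
have E2 : L2ip D (fun x => a * g1 x + g2 x) phi = a * L2ip D g1 phi + L2ip D g2 phi.
  by rewrite (L2ipDl mD (L2Z mD a Lg1) Lg2 Lphi) (L2ipZl mD a Lg1 Lphi).
move: (h1 _ tphi) (h2 _ tphi); rewrite -!/(L2ip D _ _) => e1 e2.
by rewrite E1 E2 e1 e2 mulrN opprD.
Qed.

Lemma bump_H1 f : bump D f -> H1 D f.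
Proof.
move=> bf; split; first exact: bump_L2 bf.
by move=> i; exists (partial i f); exact: bump_weak_partial.
Qed.

(** The weak gradient of the zero function is an unspecified representative of
    0, hence the appeal to uniqueness. *)
Lemma H1norm0 f : bump D f -> H1norm D (f - f) = 0.
Proof.
move=> bf; have -> : f - f = (fun=> 0) by rewrite subrr.
rewrite /H1norm L2norm0 expr0n add0r /grad_norm big1 => [|i _].
  by rewrite sqrtr0 expr0n /= sqrtr0.
have [-> _] := weak_partial_unique (bump_weak_partial i mD bD (bump0 D)).
have -> : partial i (fun _ : 'rV[R]_n => 0 : R) = (fun=> 0).
  by apply/funext => x; rewrite partial_cst.
by rewrite L2norm0 expr0n.
Qed.

Lemma bump_H10 f : bump D f -> H10 D f.
Proof.
move=> bf; split; first exact: bump_H1.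
by move=> e e0; exists f; rewrite H1norm0 //; split => //; exact: bump_test_function.
Qed.

End weak_partials.

Section gluing.
Context {R : realType} {d : nat}.
Hypothesis d0 : (0 < d)%N.
Local Notation cell := 'M[R]_(d.+1, d).
Local Notation ref := (@ref_simplex R d).
Variables (Omega : set 'rV[R]_d) (T : seq cell).
Hypotheses (hO : bounded_lipschitz_domain Omega)
  (hT : conforming_triangulation Omega T).
Implicit Types (K L : cell) (F : cell -> 'rV[R]_d -> R).

Let mO := domain_measurable hO.
Let bO := domain_bounded hO.

Lemma ref_bump_separating : bump_separating (ref°).
Proof.
move=> z Lz hz; have E := @ref_interiorE R d d0.
rewrite E in Lz hz *; apply: orthogonal_bump0 => //.
by rewrite -E; exact: bounded_ref_interior.
Qed.

(** On the cell [K] the function is [F K] read on the reference simplex. *)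
Definition glue F (y : 'rV[R]_d) : R := \sum_(K <- undup T) F K (cell_inv K y).

Lemma bump_open_cell K f : K \in T -> bump ref° f -> bump (open_cell K) (f \o cell_inv K).
Proof.
move=> KT bf; apply: bump_affine; first exact: (cell_unit hT).
have -> : affine (row ord0 K) (edges K) @^-1` open_cell K = ref°.
  exact: (preimage_open_cell (cell_unit hT KT)).
exact: bf.
Qed.

(** The supports lie in the disjoint open cells, so a single term of the sum
    contributes. *)
Lemma glue_cell F L x : (forall K, bump ref° (F K)) -> L \in T -> ref° x ->
  glue F (cell_map L x) = F L x.
Proof.
move=> bF LT rx; rewrite /glue (bigD1_seq L) ?mem_undup ?undup_uniq //=.
rewrite cell_mapK ?(cell_unit hT LT) // big_seq_cond big1 ?addr0 // => K.
rewrite mem_undup => /andP[KT KL]; apply: (bump_out (bF K)) => hK.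
move/eqP: KL; apply; apply: (open_cell_disjoint hT KT LT (x := cell_map L x)).
  exact: hK.
by rewrite /open_cell /= cell_mapK // (cell_unit hT LT).
Qed.

Lemma bump_glue F : (forall K, bump ref° (F K)) -> bump Omega (glue F).
Proof.
move=> bF; rewrite /glue.
have : {subset undup T <= T} by move=> K; rewrite mem_undup.
elim: (undup T) => [_|K s IH sT].
  by under eq_fun do rewrite big_nil; exact: bump0.
under eq_fun do rewrite big_cons; apply: bumpD; last first.
  by apply: IH => L Ls; apply: sT; rewrite inE Ls orbT.
have KT : K \in T by apply: sT; rewrite mem_head.
apply: bump_sub (bump_open_cell KT (bF K)).
exact: (open_cell_sub hO hT KT).
Qed.

Definition cell_partial F (i : 'I_d) K (x : 'rV[R]_d) : R :=
  \sum_j invmx (edges K) i j * partial j (F K) x.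

Lemma bump_cell_partial F i K : (forall K, bump ref° (F K)) ->
  bump ref° (cell_partial F i K).
Proof.
by move=> bF; apply: bump_sum => j; apply: bumpZ; exact: bump_partial.
Qed.

Lemma partial_glue F i : (forall K, bump ref° (F K)) ->
  partial i (glue F) = glue (cell_partial F i).
Proof.
move=> bF; apply/funext => x; rewrite /glue.
have eF K : elementary (F K) by have [] := bF K.
rewrite (@partial_sum _ _ _ _ (fun K => F K \o cell_inv K)) => [|K]; last exact: elementary_affine.
apply: eq_bigr => K _; exact: partial_affine.
Qed.

(** The second formula is the one used for glued functions: on each cell [glue
    F] is [F K]. *)
Lemma L2ip_decomposition : exists2 vol : cell -> R,
  (forall K, K \in T -> 0 < vol K) &
  (forall f g, L2 Omega f -> L2 Omega g -> L2ip Omega f g =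
     \sum_(K <- undup T) vol K * L2ip ref° (f \o cell_map K) (g \o cell_map K)) /\
  (forall F g, (forall K, bump ref° (F K)) -> L2 Omega g -> L2ip Omega (glue F) g =
     \sum_(K <- undup T) vol K * L2ip ref° (F K) (g \o cell_map K)).
Proof.
have [vol vol0 hvol] := cell_decomposition d0 hO hT.
have dec f g : L2 Omega f -> L2 Omega g -> L2ip Omega f g =
     \sum_(K <- undup T) vol K * L2ip ref° (f \o cell_map K) (g \o cell_map K).
  by move=> Lf Lg; have [_ E] := hvol _ (L2_integrable_mul mO Lf Lg); exact: E.
exists vol => //; split => // F g bF Lg.
rewrite (dec _ _ (bump_L2 mO bO (bump_glue bF)) Lg).
rewrite big_seq [RHS]big_seq; apply: eq_bigr => K; rewrite mem_undup => KT.
congr (_ * _); apply: eq_integral_on => x rx /=.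
by rewrite glue_cell.
Qed.

Lemma L2ip_single_cell K f g (vol : cell -> R) :
  (forall F g, (forall K, bump ref° (F K)) -> L2 Omega g -> L2ip Omega (glue F) g =
     \sum_(K <- undup T) vol K * L2ip ref° (F K) (g \o cell_map K)) ->
  K \in T -> bump ref° f -> L2 Omega g ->
  L2ip Omega (f \o cell_inv K) g = vol K * L2ip ref° f (g \o cell_map K).
Proof.
move=> dec KT bf Lg.
pose F L := if L == K then f else fun=> 0.
have bF L : bump ref° (F L) by rewrite /F; case: ifP => // _; exact: bump0.
have -> : f \o cell_inv K = glue F.
  apply/funext => y; rewrite /glue (bigD1_seq K) ?mem_undup ?undup_uniq //= /F eqxx.
  by rewrite big1 ?addr0 // => L /negbTE ->.
rewrite (dec F g bF Lg) (bigD1_seq K) ?mem_undup ?undup_uniq //= /F eqxx.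
rewrite big1 ?addr0 // => L /negbTE ->.
by rewrite L2ip0l mulr0.
Qed.

(** Bump functions of the open cells are bump functions of [Omega], and the
    cells cover [Omega] up to a null set. *)
Lemma domain_bump_separating : bump_separating Omega.
Proof.
move=> z Lz hz; have [vol vol0 [dec decF]] := L2ip_decomposition.
apply/eqP; rewrite -sqrf_eq0 L2normE (dec _ _ Lz Lz); apply/eqP.
rewrite big_seq big1 // => K; rewrite mem_undup => KT.
have LK := L2_cell d0 hO hT KT Lz.
suff N : L2norm ref° (z \o cell_map K) = 0 by rewrite -L2normE N expr0n mulr0.
apply: ref_bump_separating => // f bf.
have := L2ip_single_cell decF KT bf Lz; rewrite hz; last first.
  by apply: bump_sub (bump_open_cell KT bf); exact: (open_cell_sub hO hT KT).
move/esym/eqP; rewrite mulf_eq0 gt_eqF ?vol0 //= => /eqP; exact.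
Qed.

End gluing.

(** * Local fields dual to the gradient *)

Section reference_space.
Context {R : realType} {d : nat}.
Hypothesis d0 : (0 < d)%N.
Local Notation ref := (@ref_simplex R d).
Local Notation refi := (ref°).

Let mD : measurable refi := measurable_ref_interior.
Let bD : bounded_set refi := bounded_ref_interior.
Let totD : bump_separating refi := ref_bump_separating d0.

(** The constant is chosen before the coefficients and before [g], which makes
    it uniform over all cells of all meshes. *)
Lemma reference_dual (I : finType) (w : I -> 'rV[R]_d -> R) :
  (forall p, L2 refi (w p)) ->
  exists2 C : R, 0 <= C & forall (c : I -> R) g, L2 refi g ->
    L2norm refi (fun x => g x - \sum_p c p * w p x) = 0 ->
    exists f, [/\ bump refi f, L2ip refi f g = L2ip refi g g,
      L2norm refi f <= C * L2norm refi g &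
      forall i, L2norm refi (partial i f) <= C * L2norm refi g].
Proof.
move=> Lw.
(* The family is reindexed by natural numbers and extended by 0. *)
pose u k : 'rV[R]_d -> R := if insub k is Some o then w (@enum_val I predT o) else fun=> 0.
have Lu k : L2 refi (u k) by rewrite /u; case: (insub k) => [r|]; [exact: Lw|exact: L2_cst0].
have [m [psi [e [bpsi Le fu]]]] := finite_rank_identity mD bD totD #|I| Lu.
have [C C0 hC] := bump_dual mD bD m bpsi Le.
exists C => // c g Lg gc.
have fw p : fixed_by refi m psi e (w p).
  have := fu (enum_rank p) (ltn_ord _).
  by rewrite /u valK enum_rankK.
apply: hC => //.
have LS : L2 refi (fun x => \sum_p c p * w p x) by apply: L2_sum => // p; exact: L2Z.
apply: (eq_fixed_by mD bD LS Lg bpsi); last exact: fixed_by_sum.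
rewrite -[RHS]gc -[RHS]mul1r -(normrN1 R) -(L2normZ mD); last exact: L2B.
by apply: eq_L2norm => x _; rewrite mulN1r opprB.
Qed.

End reference_space.

Section gradient_on_cells.
Context {R : realType} {d : nat}.
Hypothesis d0 : (0 < d)%N.
Local Notation cell := 'M[R]_(d.+1, d).
Local Notation mu := (lebesgue_rV (R := R) d).
Local Notation ref := (@ref_simplex R d).
Local Notation refi := (ref°).
Variables (Omega : set 'rV[R]_d) (T : seq cell).
Hypotheses (hO : bounded_lipschitz_domain Omega)
  (hT : conforming_triangulation Omega T).

Let mD : measurable refi := measurable_ref_interior.
Let bD : bounded_set refi := bounded_ref_interior.
Let mO := domain_measurable hO.
Let bO := domain_bounded hO.

Lemma L2ip_ae (f g w : 'rV[R]_d -> R) : L2 refi f -> L2 refi g -> L2 refi w ->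
  ae_equal ref g w -> L2ip refi f g = L2ip refi f w.
Proof.
move=> Lf Lg Lw gw; rewrite /L2ip /integral_on /Rintegral; congr fine.
apply: ae_eq_integral => //.
- by have [] := integrableP _ _ _ (L2_integrable_mul mD Lf Lg).
- by have [] := integrableP _ _ _ (L2_integrable_mul mD Lf Lw).
- apply: filterS gw => x gwx rx /=.
  by rewrite gwx //; exact: interior_subset.
Qed.

Lemma L2ip_weak_partial D (f g phi : 'rV[R]_d -> R) i :
  is_weak_partial D i f g -> test_function D phi ->
  L2ip D phi g = - L2ip D (partial i phi) f.
Proof.
by move=> [_ h] tphi; rewrite L2ipC [in RHS]L2ipC; apply: oppr_inj; rewrite opprK -[LHS](h _ tphi).
Qed.

(** By the chain rule for the weak derivatives of [q], with test functions
    transported from the reference simplex. The differences between both sides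
    are orthogonal to all bump functions, hence null. *)
Lemma gradient_on_cell (m : nat) (phi : 'I_m -> 'rV[R]_d -> R) q K (a : 'I_m -> R) (k : 'I_d) :
  K \in T -> H1 Omega q -> (forall j, H1 refi (phi j)) ->
  ae_equal ref (q \o cell_map K) (fun x => \sum_j a j * phi j x) ->
  L2norm refi (fun x => (weak_partial Omega k q \o cell_map K) x -
    \sum_(p : 'I_d * 'I_m) (invmx (edges K) k p.1 * a p.2) *
      weak_partial refi p.1 (phi p.2) x) = 0.
Proof.
move=> KT Hq Hphi qa; set g := weak_partial Omega k q.
have wg : is_weak_partial Omega k q g := weak_partialP k Hq.
have Lq := Hq.1; have Lg := wg.1.
have LgK := L2_cell d0 hO hT KT Lg.
have LqK := L2_cell d0 hO hT KT Lq.
have wphi i j : is_weak_partial refi i (phi j) (weak_partial refi i (phi j)).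
  exact: (weak_partialP i (Hphi j)).
have Lphi j : L2 refi (phi j) by case: (Hphi j).
have Lwphi i j : L2 refi (weak_partial refi i (phi j)) by case: (wphi i j).
pose S x := \sum_(p : 'I_d * 'I_m) (invmx (edges K) k p.1 * a p.2) *
  weak_partial refi p.1 (phi p.2) x.
have LS : L2 refi S by apply: L2_sum => // p; exact: L2Z.
apply: (ref_bump_separating d0) => [|psi bpsi]; first exact: L2B.
have Lpsi : L2 refi psi by exact: bump_L2 bpsi.
have bdpsi i : bump refi (partial i psi) by exact: bump_partial.
have Ldpsi i : L2 refi (partial i psi) by exact: bump_L2 (bdpsi i).
pose dpsi x := \sum_i invmx (edges K) k i * partial i psi x.
have bdp : bump refi dpsi by apply: bump_sum => i; exact: bumpZ.
have Ldp : L2 refi dpsi by exact: bump_L2 bdp.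
have E1 : L2ip refi psi (g \o cell_map K) = - L2ip refi dpsi (q \o cell_map K).
  have [vol vol0 [_ dec]] := L2ip_decomposition d0 hO hT.
  have bO' : bump Omega (psi \o cell_inv K).
    by apply: bump_sub (bump_open_cell hT KT bpsi); exact: (open_cell_sub hO hT KT).
  have := L2ip_weak_partial wg (bump_test_function bO').
  have -> : partial k (psi \o cell_inv K) = dpsi \o cell_inv K.
    by apply/funext => x; rewrite /cell_inv partial_affine //; case: bpsi.
  rewrite (L2ip_single_cell dec KT bpsi Lg) (L2ip_single_cell dec KT bdp Lq) -mulrN.
  by apply: mulfI; rewrite gt_eqF // vol0.
have Lsum : L2 refi (fun x => \sum_j a j * phi j x) by apply: L2_sum => // j; exact: L2Z.
have E2 : L2ip refi dpsi (q \o cell_map K) =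
    \sum_i \sum_j invmx (edges K) k i * a j * L2ip refi (partial i psi) (phi j).
  rewrite (L2ip_ae Ldp LqK Lsum qa) (L2ip_suml mD) //; last by move=> i; exact: L2Z.
  apply: eq_bigr => i _; rewrite (L2ipZl mD _ (Ldpsi i) Lsum).
  rewrite L2ipC (L2ip_suml mD) //; last by move=> j; exact: L2Z.
  rewrite mulr_sumr; apply: eq_bigr => j _.
  by rewrite (L2ipZl mD _ (Lphi j) (Ldpsi i)) mulrA L2ipC.
have E3 : L2ip refi psi S =
    - \sum_i \sum_j invmx (edges K) k i * a j * L2ip refi (partial i psi) (phi j).
  rewrite L2ipC (L2ip_suml mD) //; last by move=> p; exact: L2Z.
  rewrite pair_big /= -sumrN; apply: eq_bigr => p _.
  rewrite (L2ipZl mD _ (Lwphi _ _) Lpsi) L2ipC.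
  by rewrite (L2ip_weak_partial (wphi _ _) (bump_test_function bpsi)) mulrN.
rewrite L2ipC (L2ipBl mD LgK LS Lpsi) L2ipC E1 E2 L2ipC E3; exact: subrr.
Qed.

(** Gluing functions dual to [g] on each cell. A derivative in [Omega] is a
    combination of derivatives on the reference simplex with coefficients in the
    inverse matrix, bounded by [C1 / h]. *)
Lemma dual_bump (C C1 h : R) (g : 'rV[R]_d -> R) : 0 <= C -> 0 <= C1 -> 0 < h ->
  L2 Omega g ->
  (forall K, K \in T -> forall i j, h * `|invmx (edges K) i j| <= C1) ->
  (forall K, K \in T -> exists f, [/\ bump refi f,
      L2ip refi f (g \o cell_map K) = L2ip refi (g \o cell_map K) (g \o cell_map K),
      L2norm refi f <= C * L2norm refi (g \o cell_map K) &
      forall i, L2norm refi (partial i f) <= C * L2norm refi (g \o cell_map K)]) ->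
  exists V, [/\ bump Omega V, L2ip Omega V g = L2ip Omega g g,
    L2norm Omega V <= C * L2norm Omega g &
    forall i, h * L2norm Omega (partial i V) <= d%:R * C1 * C * L2norm Omega g].
Proof.
move=> C0 C10 h0 Lg hB hf.
have hF K : exists f, bump refi f /\ (K \in T -> [/\
      L2ip refi f (g \o cell_map K) = L2ip refi (g \o cell_map K) (g \o cell_map K),
      L2norm refi f <= C * L2norm refi (g \o cell_map K) &
      forall i, L2norm refi (partial i f) <= C * L2norm refi (g \o cell_map K)]).
  have [/hf[f [bf f1 f2 f3]]|KT] := boolP (K \in T); first by exists f; split.
  by exists (fun=> 0); split => //; exact: bump0.
have [F FP] := choice hF.
have bF K : bump refi (F K) by case: (FP K).
have [vol vol0 [dec decF]] := L2ip_decomposition d0 hO hT.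
have bound (A : R) (G : cell -> 'rV[R]_d -> R) : 0 <= A -> (forall K, bump refi (G K)) ->
    (forall K, K \in T -> L2norm refi (G K) <= A * L2norm refi (g \o cell_map K)) ->
    L2norm Omega (glue T G) <= A * L2norm Omega g.
  move=> A0 bG hG; have LG : L2 Omega (glue T G).
    exact: (bump_L2 mO bO (bump_glue hO hT bG)).
  rewrite (L2norm_le _ _ (mulr_ge0 A0 (L2norm_ge0 _ _))) exprMn L2normE.
  rewrite (decF _ _ bG LG) (dec _ _ Lg Lg) mulr_sumr big_seq [leRHS]big_seq.
  apply: ler_sum => K; rewrite mem_undup => KT.
  rewrite mulrCA; apply: ler_wpM2l; first exact: ltW (vol0 _ KT).
  rewrite -L2normE -exprMn.
  have -> : L2ip refi (G K) (glue T G \o cell_map K) = L2norm refi (G K) ^+ 2.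
    rewrite L2normE; apply: eq_integral_on => x rx /=.
    by rewrite (glue_cell hT bG KT rx).
  by rewrite ler_pXn2r ?nnegrE ?mulr_ge0 ?L2norm_ge0 // hG.
exists (glue T F); split.
- exact: (bump_glue hO hT bF).
- rewrite (decF _ _ bF Lg) (dec _ _ Lg Lg) big_seq [RHS]big_seq.
  apply: eq_bigr => K; rewrite mem_undup => KT; congr (_ * _).
  by have [_ /(_ KT)[]] := FP K.
- by apply: bound => // K KT; have [_ /(_ KT)[]] := FP K.
- move=> i; rewrite (partial_glue _ i bF) -ler_pdivlMl // mulrA.
  apply: bound => [||K KT].
  + by rewrite !mulr_ge0 // invr_ge0 ltW.
  + by move=> K; exact: bump_cell_partial.
  + have LdF j : L2 refi (partial j (F K)).
      by apply: (bump_L2 mD bD); exact: bump_partial (bF K).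
    rewrite /cell_partial (le_trans (L2norm_sum _ _ _)) //; first by move=> j; exact: L2Z.
    apply: (@le_trans _ _ (\sum_(j < d) h^-1 * C1 * C * L2norm refi (g \o cell_map K))).
      apply: ler_sum => j _; rewrite (L2normZ mD _ (LdF j)) -mulrA.
      apply: ler_pM; rewrite ?normr_ge0 ?L2norm_ge0 //.
        by rewrite -ler_pdivrMl ?invr_gt0 // invrK hB.
      by have [_ /(_ KT)[_ _]] := FP K.
    by rewrite sumr_const card_ord -[leLHS]mulr_natl !mulrA [d%:R * h^-1]mulrC.
Qed.

End gradient_on_cells.

(** * Pairing with the divergence *)

Section divergence_pairing.
Context {R : realType} {d : nat}.
Variables (Omega : set 'rV[R]_d).
Hypotheses (mO : measurable Omega) (bO : bounded_set Omega)
  (total : bump_separating Omega).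
Local Notation coord := Defs.coord.
Implicit Types (u v : 'rV[R]_d -> 'rV[R]_d) (q : 'rV[R]_d -> R).

(** The integral of [(div v) q], split into components. *)
Definition div_pairing v q : R :=
  \sum_i L2ip Omega (weak_partial Omega i (coord i v)) q.

Definition vH1 v : Prop := forall i, H1 Omega (coord i v).

Lemma L2_weak_partial v i j : vH1 v -> L2 Omega (weak_partial Omega i (coord j v)).
Proof. by move=> Hv; have [] := weak_partialP i (Hv j). Qed.

Lemma divergence_pairing v q : vH1 v -> L2 Omega q ->
  integral_on Omega (fun x => divergence Omega v x * q x) = div_pairing v q.
Proof. by move=> Hv Lq; apply: L2ip_suml => // i; exact: L2_weak_partial. Qed.

Lemma coord_lin a u v i :
  coord i (fun x => a *: u x + v x) = fun x => a * coord i u x + coord i v x.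
Proof. by apply/funext => x; rewrite /coord !mxE. Qed.

Lemma vH1_lin a u v : vH1 u -> vH1 v -> vH1 (fun x => a *: u x + v x).
Proof.
move=> Hu Hv i; rewrite coord_lin.
have Lu : L2 Omega (coord i u) by case: (Hu i).
have Lv : L2 Omega (coord i v) by case: (Hv i).
split; first by apply: L2D => //; exact: L2Z.
move=> j; eexists; apply: (is_weak_partial_lin mO bO a Lu Lv).
  exact: weak_partialP (Hu i).
exact: weak_partialP (Hv i).
Qed.

Lemma div_pairing_lin a u v q : vH1 u -> vH1 v -> L2 Omega q ->
  div_pairing (fun x => a *: u x + v x) q = a * div_pairing u q + div_pairing v q.
Proof.
move=> Hu Hv Lq; rewrite /div_pairing mulr_sumr -big_split /=.
apply: eq_bigr => i _; rewrite coord_lin.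
have Lu : L2 Omega (coord i u) by case: (Hu i).
have Lv : L2 Omega (coord i v) by case: (Hv i).
have wl := is_weak_partial_lin mO bO a Lu Lv (weak_partialP i (Hu i)) (weak_partialP i (Hv i)).
have [_ ->] := weak_partial_unique mO bO total wl; last exact: Lq.
have Lwu := L2_weak_partial i i Hu; have Lwv := L2_weak_partial i i Hv.
by rewrite (L2ipDl mO (L2Z mO a Lwu) Lwv Lq) (L2ipZl mO a Lwu Lq).
Qed.

Lemma vL2normE v : vL2norm Omega v ^+ 2 = \sum_i L2norm Omega (coord i v) ^+ 2.
Proof. by rewrite sqr_sqrtr // sumr_ge0 // => i _; exact: sqr_ge0. Qed.

Lemma grad_normE q : grad_norm Omega q ^+ 2 = \sum_i L2norm Omega (weak_partial Omega i q) ^+ 2.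
Proof. by rewrite sqr_sqrtr // sumr_ge0 // => i _; exact: sqr_ge0. Qed.

Lemma H1normE q : H1norm Omega q ^+ 2 = L2norm Omega q ^+ 2 + grad_norm Omega q ^+ 2.
Proof. by rewrite sqr_sqrtr // addr_ge0 // sqr_ge0. Qed.

Lemma vH1normE v : vH1norm Omega v ^+ 2 = \sum_i H1norm Omega (coord i v) ^+ 2.
Proof. by rewrite sqr_sqrtr // sumr_ge0 // => i _; exact: sqr_ge0. Qed.

Lemma weak_partial_le_vH1norm v i j :
  L2norm Omega (weak_partial Omega i (coord j v)) <= vH1norm Omega v.
Proof.
have h1 : L2norm Omega (weak_partial Omega i (coord j v)) ^+ 2 <= grad_norm Omega (coord j v) ^+ 2.
  rewrite (grad_normE (coord j v)) (bigD1 i) //= lerDl.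
  by apply: sumr_ge0 => k _; exact: sqr_ge0.
have h2 : grad_norm Omega (coord j v) ^+ 2 <= H1norm Omega (coord j v) ^+ 2.
  by rewrite (H1normE (coord j v)) lerDr sqr_ge0.
have h3 : H1norm Omega (coord j v) ^+ 2 <= vH1norm Omega v ^+ 2.
  rewrite (vH1normE v) (bigD1 j) //= lerDl.
  by apply: sumr_ge0 => k _; exact: sqr_ge0.
have := le_trans h1 (le_trans h2 h3).
by rewrite ler_pXn2r // ?nnegrE sqrtr_ge0.
Qed.

Lemma div_pairing_le v q : vH1 v -> L2 Omega q ->
  `|div_pairing v q| <= d%:R * (vH1norm Omega v * L2norm Omega q).
Proof.
move=> Hv Lq; rewrite (le_trans (ler_norm_sum _ _ _)) //.
apply: (@le_trans _ _ (\sum_(i < d) vH1norm Omega v * L2norm Omega q)).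
  apply: ler_sum => i _; apply: le_trans (cauchy_schwarz mO (L2_weak_partial i i Hv) Lq) _.
  by apply: ler_wpM2r; [exact: L2norm_ge0|exact: weak_partial_le_vH1norm].
by rewrite sumr_const card_ord -[leLHS]mulr_natl lexx.
Qed.

Lemma vL2normN u v : vH1 u -> (forall x, v x = 0) ->
  vL2norm Omega (fun x => -1 *: u x + v x) = vL2norm Omega u.
Proof.
move=> Hu v0; congr (Num.sqrt _); apply: eq_bigr => i _; congr (_ ^+ 2).
have Lu : L2 Omega (coord i u) by case: (Hu i).
have := L2normZ mO (-1) Lu; rewrite normrN1 mul1r coord_lin => <-.
by apply: eq_L2norm => x _; rewrite /coord v0 mxE addr0.
Qed.

Lemma vL2norm_le_sub u v : vH1 u -> vH1 v ->
  vL2norm Omega u ^+ 2 <= 2 * vL2norm Omega v ^+ 2 + 2 * vL2norm Omega (v - u) ^+ 2.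
Proof.
move=> Hu Hv; rewrite !vL2normE !mulr_sumr -big_split /=; apply: ler_sum => i _.
have Lu : L2 Omega (coord i u) by case: (Hu i).
have Lv : L2 Omega (coord i v) by case: (Hv i).
have E : coord i (v - u) = fun x => coord i v x - coord i u x.
  by apply/funext => x; rewrite /coord fctE !mxE.
have Lw : L2 Omega (coord i (v - u)) by rewrite E; exact: L2B.
have : L2norm Omega (coord i u) <= L2norm Omega (coord i v) + L2norm Omega (coord i (v - u)).
  have := L2normZ mO (-1) Lw; rewrite normrN1 mul1r => <-.
  have := L2normD mO Lv (L2Z mO (-1) Lw); apply: le_trans.
  rewrite le_eqVlt; apply/orP; left; apply/eqP; apply: eq_L2norm => x _.
  by rewrite E mulN1r opprB addrC subrK.
have := L2norm_ge0 Omega (coord i u); have := L2norm_ge0 Omega (coord i v).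
have := L2norm_ge0 Omega (coord i (v - u)).
set x := L2norm _ _; set y := L2norm _ _; set z := L2norm _ _ => z0 y0 x0 xyz.
have := sqr_ge0 (y - x); nra.
Qed.

End divergence_pairing.

(** * The generalized inf-sup condition *)

Theorem theorem3p6 (R : realType) (d : nat) (hd : d = 2%N \/ d = 3%N)
  (Omega : set 'rV[R]_d) (hOmega : bounded_lipschitz_domain Omega)
  (sizes : set R) (hsizes : forall h, sizes h -> 0 < h)
  (T : R -> seq 'M[R]_(d.+1, d))
  (hT : forall h, sizes h -> conforming_triangulation Omega (T h))
  (hTreg : shape_regular sizes T) (hTunif : quasi_uniform sizes T)
  (X : R -> set ('rV[R]_d -> 'rV[R]_d)) (M : R -> set ('rV[R]_d -> R))
  (hXdim : forall h, sizes h -> finite_dim_space Omega (X h))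
  (hX : forall h v, sizes h -> X h v -> vH10 Omega v)
  (hMdim : forall h, sizes h -> finite_dim_space Omega (M h : set ('rV[R]_d -> R^o)))
  (hM : forall h q, sizes h -> M h q -> L2_mean_zero Omega q /\ H1 Omega q)
  (hMT : built_on sizes T M)
  (hXinv : exists2 c : R, 0 < c & forall h v, sizes h -> X h v ->
     vH1norm Omega v <= c * h^-1 * vL2norm Omega v)
  (hMinv : exists2 c : R, 0 < c & forall h q, sizes h -> M h q ->
     H1norm Omega q <= c * h^-1 * L2norm Omega q)
  (hScottZhang : exists2 c : R, 0 < c & forall h, sizes h ->
     exists C : ('rV[R]_d -> 'rV[R]_d) -> 'rV[R]_d -> 'rV[R]_d,
       operator_into Omega (X h) C /\
       forall v, vH10 Omega v ->
         vL2norm Omega (v - C v) + h * vH1norm Omega (C v)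
           <= c * h * vH1norm Omega v)
  (hFortin : exists2 c : R, 0 < c & forall h, sizes h ->
     exists F : ('rV[R]_d -> 'rV[R]_d) -> 'rV[R]_d -> 'rV[R]_d,
       fortin_projection Omega (X h) (M h) F /\
       forall v, vH10 Omega v ->
         vL2norm Omega (v - F v) <= c * h * vH1norm Omega v) :
  exists2 c' : R, 0 < c' & forall h q, sizes h -> M h q ->
    c' * grad_norm Omega q <=
    sup [set t | exists v, [/\ X h v, vL2norm Omega v != 0 &
           t = integral_on Omega (fun x => divergence Omega v x * q x)
               / vL2norm Omega v]].
Proof.
have d0 : (0 < d)%N by case: hd => ->.
have mO := domain_measurable hOmega; have bO := domain_bounded hOmega.
have [m [phi [Hphi hphi]]] := hMT.
pose w (p : 'I_d * 'I_m) := weak_partial (@ref_simplex R d)° p.1 (phi p.2).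
have Lw p : L2 (@ref_simplex R d)° (w p) by have [] := weak_partialP p.1 (Hphi p.2).
have [C C0 hC] := reference_dual d0 Lw.
have [C1 C10 hC1] := shape_regular_inv d0 bO hsizes hT hTreg hTunif.
have [cF cF0 hF] := hFortin; have [cX cX0 hXi] := hXinv.
pose E := d%:R * C1 * C.
have E0 : 0 <= E by apply: mulr_ge0 => //; apply: mulr_ge0 => //; exact: ltW.
pose A := C1 ^+ 2 * C ^+ 2 + d%:R * E ^+ 2.
have A0 : 0 <= A by apply: addr_ge0; apply: mulr_ge0; rewrite ?sqr_ge0.
have Q0 : 0 <= 2 * C ^+ 2 + 2 * (cF ^+ 2 * A).
  by apply: addr_ge0; apply: mulr_ge0 => //; rewrite ?sqr_ge0 // mulr_ge0 ?sqr_ge0.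
pose B := Num.sqrt (2 * C ^+ 2 + 2 * (cF ^+ 2 * A) + 1).
have B2 : B ^+ 2 = 2 * C ^+ 2 + 2 * (cF ^+ 2 * A) + 1.
  by rewrite sqr_sqrtr // addr_ge0.
have B0 : 0 < B by rewrite sqrtr_gt0 ltr_wpDl.
exists B^-1; first by rewrite invr_gt0.
move=> h q sh Mq; have h0 := hsizes _ sh; have hTh := hT _ sh.
have total := domain_bump_separating d0 hOmega hTh.
have [_ Hq] := hM _ _ sh Mq; have Lq := Hq.1.
pose g k := weak_partial Omega k q.
have wg k : is_weak_partial Omega k q (g k) := weak_partialP k Hq.
have Lg k : L2 Omega (g k) by case: (wg k).
set G := grad_norm Omega q.
have G0 : 0 <= G by exact: sqrtr_ge0.
set S := [set t | _].
have XH1 v : X h v -> vH1 Omega v by move=> /(hX _ _ sh) Hv i; case: (Hv i).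
(* By the inverse inequality the pairing is continuous for the L^2 norm on [X
   h]. *)
have pbound v : X h v -> `|div_pairing Omega v q| <=
    (d%:R * (cX * h^-1) * L2norm Omega q) * vL2norm Omega v.
  move=> Xv; apply: le_trans (div_pairing_le mO (XH1 _ Xv) Lq) _.
  rewrite [leRHS](_ : _ = d%:R * ((cX * h^-1 * vL2norm Omega v) * L2norm Omega q)); last by ring.
  apply: ler_wpM2l => //; apply: ler_wpM2r; first exact: L2norm_ge0.
  exact: hXi.
have Sub : has_ubound S.
  exists (d%:R * (cX * h^-1) * L2norm Omega q) => _ [v [Xv v0 ->]].
  rewrite (divergence_pairing mO (XH1 _ Xv) Lq).
  rewrite ler_pdivrMr ?lt0r ?v0 ?sqrtr_ge0 //.
  exact: le_trans (ler_norm _) (pbound _ Xv).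
have [X0 Xlin _] := hXdim _ sh.
have H00 : vH1 Omega (fun=> 0) by exact: XH1.
have p0 : div_pairing Omega (fun=> 0) q = 0.
  have := div_pairing_lin mO bO total 1 H00 H00 Lq; rewrite mul1r.
  under [in X in X = _ -> _]eq_fun do rewrite scaler0 addr0.
  by move/eqP; rewrite -subr_eq subrr => /eqP.
have Xopp v : X h v -> X h (fun x => -1 *: v x + 0) by move=> Xv; exact: Xlin.
have popp v : X h v -> div_pairing Omega (fun x => -1 *: v x + 0) q = - div_pairing Omega v q.
  move=> Xv; have E1 := div_pairing_lin mO bO total (-1) (XH1 _ Xv) H00 Lq.
  by rewrite p0 addr0 mulN1r in E1.
have Smem v : X h v -> vL2norm Omega v != 0 ->
    div_pairing Omega v q / vL2norm Omega v <= sup S.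
  move=> Xv v0; apply: ub_le_sup => //; exists v; split => //.
  by rewrite (divergence_pairing mO (XH1 _ Xv) Lq).
(* If [grad q = 0] the supremum is still nonnegative, because the quotients of
   [v] and [- v] are opposite. *)
have [Gz|Gn] := eqVneq G 0.
  rewrite Gz mulr0.
  have [[t [v [Xv v0 _]]]|S0] := pselect (S !=set0); last first.
    by rewrite sup_out // => -[].
  have n0 : 0 <= vL2norm Omega v by exact: sqrtr_ge0.
  have h1 := Smem _ Xv v0.
  have := Smem _ (Xopp _ Xv); rewrite (vL2normN mO (XH1 _ Xv)) // popp // => /(_ v0) h2.
  rewrite -(pmulrn_lge0 _ (ltn0Sn 1)) mulr2n.
  apply: le_trans (lerD h1 h2); rewrite mulNr subrr; exact: lexx.
have Gp : 0 < G by rewrite lt0r Gn.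
have dual k : exists V, [/\ bump Omega V, L2ip Omega V (g k) = L2ip Omega (g k) (g k),
    L2norm Omega V <= C * L2norm Omega (g k) &
    forall i, h * L2norm Omega (partial i V) <= E * L2norm Omega (g k)].
  apply: (dual_bump d0 hOmega hTh C0 (ltW C10) h0 (Lg k)) => K KT.
    by have [_ +] := hC1 _ _ sh KT.
  have [a qa] := hphi _ _ _ sh KT Mq.
  apply: (hC (fun p => invmx (edges K) k p.1 * a p.2)).
    exact: (L2_cell d0 hOmega hTh KT (Lg k)).
  exact: (gradient_on_cell d0 hOmega hTh k KT Hq Hphi qa).
(* The components of the test field, dual to those of the gradient. *)
have [V VP] := choice dual.
pose v0 x : 'rV[R]_d := \row_k V k x.
have cv0 k : Defs.coord k v0 = V k by apply/funext => x; rewrite /Defs.coord mxE.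
have Hv0 : vH10 Omega v0.
  by move=> k; rewrite cv0; apply: (bump_H10 mO bO total); case: (VP k).
have Hv01 : vH1 Omega v0 by move=> i; case: (Hv0 i).
have G2 : G ^+ 2 = \sum_k L2norm Omega (g k) ^+ 2 by exact: grad_normE.
have wV k i : L2norm Omega (weak_partial Omega i (V k)) = L2norm Omega (partial i (V k)) /\
    forall u, L2 Omega u -> L2ip Omega (weak_partial Omega i (V k)) u = L2ip Omega (partial i (V k)) u.
  apply: (weak_partial_unique mO bO total); apply: (bump_weak_partial i mO bO).
  by case: (VP k).
have pv0 : div_pairing Omega v0 q = - G ^+ 2.
  rewrite G2 -sumrN; apply: eq_bigr => k _; rewrite cv0.
  have [_ ->] := wV k k; last exact: Lq.
  have [bV dV _ _] := VP k.
  rewrite L2normE -dV (L2ip_weak_partial (wg k) (bump_test_function bV)) opprK.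
  by [].
have n1 : vL2norm Omega v0 ^+ 2 <= C ^+ 2 * G ^+ 2.
  rewrite vL2normE G2 mulr_sumr; apply: ler_sum => k _; rewrite cv0 -exprMn.
  have [_ _ hV _] := VP k.
  by rewrite ler_pXn2r ?nnegrE ?mulr_ge0 ?L2norm_ge0.
have hh : h <= C1.
  have [[x Ox] _ _ _ _] := hOmega.
  have : closure Omega x by exact: subset_closure.
  case: hTh => _ -> _ _ [K KT _].
  by have [] := hC1 _ _ sh KT.
have n2 : h ^+ 2 * vH1norm Omega v0 ^+ 2 <= A * G ^+ 2.
  rewrite vH1normE G2 !mulr_sumr; apply: ler_sum => k _; rewrite cv0 H1normE grad_normE mulrDr.
  rewrite /A mulrDl; have [_ _ hV hdV] := VP k; apply: lerD.
    rewrite -!exprMn ler_pXn2r ?nnegrE ?mulr_ge0 ?L2norm_ge0 ?(ltW h0) ?(ltW C10) //.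
    by rewrite -mulrA; apply: ler_pM => //; rewrite ?L2norm_ge0 // ltW.
  rewrite mulr_sumr.
  apply: (@le_trans _ _ (\sum_(i < d) E ^+ 2 * L2norm Omega (g k) ^+ 2)); last first.
    by rewrite sumr_const card_ord -[leLHS]mulr_natl mulrA.
  apply: ler_sum => i _.
  rewrite [X in _ * X ^+ 2 <= _](wV k i).1 -[leLHS]exprMn -[leRHS]exprMn.
  apply: lerXn2r; rewrite ?nnegrE; last exact: hdV.
    by apply: mulr_ge0; [exact: ltW|exact: L2norm_ge0].
  by apply: mulr_ge0; [exact: E0|exact: L2norm_ge0].
have [F [hFp hFb]] := hF _ sh.
have [[FX _] _ Fdiv] := hFp.
have XF := FX _ Hv0; have HF1 := XH1 _ XF.
have n3 : vL2norm Omega (F v0) ^+ 2 <= B ^+ 2 * G ^+ 2.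
  apply: le_trans (vL2norm_le_sub mO HF1 Hv01) _.
  have hFv : vL2norm Omega (v0 - F v0) ^+ 2 <= cF ^+ 2 * (A * G ^+ 2).
    apply: (@le_trans _ _ (cF ^+ 2 * (h ^+ 2 * vH1norm Omega v0 ^+ 2))).
      rewrite -!exprMn ler_pXn2r ?nnegrE ?mulr_ge0 ?sqrtr_ge0 ?(ltW cF0) ?(ltW h0) //.
      by rewrite mulrA hFb.
    by apply: ler_wpM2l => //; exact: sqr_ge0.
  rewrite -[leLHS]addr0; have := sqr_ge0 G; rewrite B2; move: n1 hFv.
  set a := vL2norm _ _ ^+ 2; set b := vL2norm _ _ ^+ 2; set c := G ^+ 2.
  have -> : (2 * C ^+ 2 + 2 * (cF ^+ 2 * A) + 1) * c =
    2 * (C ^+ 2 * c) + 2 * (cF ^+ 2 * (A * c)) + c by ring.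
  by move=> h1 h2 h3; apply: lerD => //; apply: lerD; apply: ler_wpM2l.
(* The Fortin property, with [v0 - F v0] written as a linear combination. *)
have pF : div_pairing Omega (F v0) q = - G ^+ 2.
  have Hd : vH1 Omega (fun x => -1 *: F v0 x + v0 x) by exact: vH1_lin.
  have FE : v0 - F v0 = fun x => -1 *: F v0 x + v0 x.
    by apply/funext => x; rewrite fctE scaleN1r addrC.
  have := Fdiv _ _ Hv0 Mq; rewrite FE => Fq.
  have Ep := div_pairing_lin mO bO total (-1) HF1 Hv01 Lq.
  have := etrans (esym Ep) (etrans (esym (divergence_pairing mO Hd Lq)) Fq).
  by rewrite mulN1r pv0 -opprD => /eqP; rewrite oppr_eq0 addr_eq0 => /eqP.
(* A vanishing [F v0] would have a vanishing pairing with [q]. *)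
have N0 : vL2norm Omega (F v0) != 0.
  apply/eqP => Nz; have := pbound _ XF; rewrite Nz mulr0 pF normrN.
  by rewrite normr_le0 sqrf_eq0 (negbTE Gn).
have Np : 0 < vL2norm Omega (F v0) by rewrite lt0r N0 sqrtr_ge0.
have NB : vL2norm Omega (F v0) <= B * G.
  by rewrite -(ler_pXn2r (n := 2)) ?nnegrE ?mulr_ge0 ?sqrtr_ge0 // exprMn.
have := Smem _ (Xopp _ XF); rewrite (vL2normN mO HF1) // popp // pF opprK => /(_ N0).
apply: le_trans; rewrite ler_pdivlMr //.
apply: (@le_trans _ _ (B^-1 * G * (B * G))).
  by apply: ler_wpM2l => //; rewrite mulr_ge0 // invr_ge0 ltW.
by rewrite le_eqVlt; apply/orP; left; apply/eqP; field; rewrite gt_eqF.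
Qed.
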